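(* Let $\mathbf{F}$ be a symbol system of rank $2$ on a complex vector space $W$ of dimension $n$, with $F^2=\langle Q_1,\dots,Q_c\rangle\subset\operatorname{Sym}^2W^*$ of dimension $c$, and let $M(\mathbf{F})\subset\mathbb{P}V_{\mathbf{F}}$ be the associated Euler-symmetric variety, of dimension $n$. Let $\mathbf{Bs}(\mathbf F)=\{Q_1=\cdots=Q_c=0\}\subset\mathbb{P}W$. The following statements are equivalent: (1) $M(\mathbf{F})$ is a complete intersection of codimension $c$ in $\mathbb{P}V_{\mathbf{F}}$; (2) $\mathbf{Bs}(\mathbf F)\subset\mathbb{P}W$ is a set-theoretic complete intersection of codimension $c$; (3) for a general point $x\in M(\mathbf{F})$, the variety of lines $\mathcal{L}_x(M(\mathbf{F}))\subset\mathbb{P}T_xM(\mathbf{F})$ is a set-theoretic complete intersection of codimension $c$; (4) the finite sequence $(Q_1,\dots,Q_c)$ is a regular sequence in $\operatorname{Sym}(W^* )$.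
   Context: Everything is over $\mathbb{C}$; $\mathbb{P}W$ is the space of one-dimensional subspaces of $W$. Elements of $\operatorname{Sym}^kW^*$ are viewed as homogeneous polynomials of degree $k$ on $W$, so $\operatorname{Sym}(W^* )\cong\mathbb{C}[x_1,\dots,x_n]$. A symbol system of rank $2$ on $W$ is a graded subspace $\mathbf F=F^0\oplus F^1\oplus F^2\subset\operatorname{Sym}(W^* )$ with $F^0=\mathbb{C}$, $F^1=W^*$, $0\ne F^2\subset\operatorname{Sym}^2W^*$ and $F^k=0$ for $k\ge3$. Put $V_{\mathbf F}=\mathbb{C}\oplus W\oplus(F^2)^*$. $M(\mathbf F)\subset\mathbb{P}V_{\mathbf F}=\mathbb{P}^{n+c}$ is the Zariski closure of the image of the rational map $\mathbb{P}(\mathbb{C}\oplus W)\dashrightarrow\mathbb{P}V_{\mathbf F}$, $[t:w]\mapsto[t^2:tw:\iota_w^2]$, where $\iota_w^2\in(F^2)^*$ is evaluation $Q\mapsto Q(w)$; in coordinates, $[t:w]\mapsto[t^2:tw_1:\cdots:tw_n:Q_1(w):\cdots:Q_c(w)]$. For a projective variety $Z\subset\mathbb{P}^N$ and a general smooth point $x\in Z$, the variety of lines $\mathcal{L}_x(Z)=\{[l]\mid x\in l\subset Z,\ l\text{ a line in }\mathbb{P}^N\}$ is regarded as a subset of $\mathbb{P}T_xZ$ by sending a line to its tangent direction at $x$. A subvariety $Z$ of dimension $d$ in $\mathbb{P}^{d+c}$ is a complete intersection (of codimension $c$) if its homogeneous vanishing ideal can be generated by $c$ elements; it is a set-theoretic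 complete intersection (of codimension $c$) if it is the intersection of $c$ hypersurfaces, i.e. $I(Z)=\operatorname{rad}((g_1,\dots,g_c))$ for some homogeneous polynomials $g_1,\dots,g_c$. Subvarieties need not be irreducible. Convention: when $c=n$, a closed subset of an $(n-1)$-dimensional projective space (such as $\mathbb{P}W$ or $\mathbb{P}T_xM(\mathbf F)$) is called a set-theoretic complete intersection of codimension $c=n$ if it is empty (dimension $-1$, codimension $n$). A sequence $a_1,\dots,a_d$ in a commutative ring $R$ is regular if $a_i$ is not a zero-divisor on $R/(a_1,\dots,a_{i-1})$ for $i=1,\dots,d$. *)

(* Defs.v *)
From HB Require Import structures.
From mathcomp Require Import all_boot all_order all_algebra.
From mathcomp Require Import reals complex mpoly.

Set Implicit Arguments.
Unset Strict Implicit.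
Unset Printing Implicit Defensive.

Import GRing.Theory.
Local Open Scope ring_scope.

Section Ideals.
Variable A : comNzRingType.

Definition ideal_of (s : seq A) (f : A) : Prop :=
  exists a : 'I_(size s) -> A, f = \sum_i a i * s`_i.

Definition radical (I : A -> Prop) (f : A) : Prop := exists k, I (f ^+ k).

Definition regular_seq (s : seq A) : Prop :=
  forall i, (i < size s)%N -> forall f,
    ideal_of (take i s) (s`_i * f) -> ideal_of (take i s) f.

End Ideals.

Section Projective.
Variables (K : fieldType) (m : nat).

(* The projective space P(K^m), of dimension m - 1. *)
Definition proj := {L : {vspace 'rV[K]_m} | \dim L == 1%N}.

Implicit Types (Z Y : proj -> Prop) (x p : proj) (f : {mpoly K[m]}).

Definition subset Y Z := forall p, Y p -> Z p.

Definition vanishes_at f p := forall v, v \in val p -> f.@[v 0] = 0.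

(* The homogeneous vanishing ideal: since [vanishes_at] ranges over all the
   representatives of a point, over an infinite K a polynomial is a member iff
   all its homogeneous components are.  It is the unit ideal if Z is empty. *)
Definition vanishing_ideal Z f := forall p, Z p -> vanishes_at f p.

Definition zclosed Z :=
  exists2 S : {mpoly K[m]} -> Prop,
    (forall f, S f -> exists d, f \is d.-homog) &
    forall p, Z p <-> forall f, S f -> vanishes_at f p.

Definition zclosure Z p := forall Y, zclosed Y -> subset Z Y -> Y p.

Definition zirreducible Z :=
  [/\ zclosed Z, (exists p, Z p) &
      forall Y1 Y2, zclosed Y1 -> zclosed Y2 ->
        (forall p, Z p -> Y1 p \/ Y2 p) -> subset Z Y1 \/ subset Z Y2].

Definition has_chain Z (d : nat) :=
  exists Y : nat -> proj -> Prop,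
    (forall i, (i <= d)%N -> zirreducible (Y i) /\ subset (Y i) Z) /\
    (forall i, (i < d)%N -> subset (Y i) (Y i.+1) /\ ~ subset (Y i.+1) (Y i)).

(* Krull dimension; no natural number is the dimension of the empty set. *)
Definition zdim Z (d : nat) := has_chain Z d /\ ~ has_chain Z d.+1.

Definition complete_intersection (c : nat) Z :=
  zclosed Z /\
  exists d, [/\ m = (d + c).+1, zdim Z d &
    exists g : c.-tuple {mpoly K[m]},
      forall f, vanishing_ideal Z f <-> ideal_of g f].

(* The second alternative is the convention that the empty set has dimension
   -1, that is codimension m in P(K^m). *)
Definition set_theoretic_ci (c : nat) Z :=
  zclosed Z /\
  ((exists d, [/\ m = (d + c).+1, zdim Z d &
      exists2 g : c.-tuple {mpoly K[m]},
        (forall i, exists e, tnth g i \is e.-homog) &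
        forall f, vanishing_ideal Z f <-> radical (ideal_of g) f])
   \/ (c = m /\ forall p, ~ Z p)).

(* A general point of Z satisfies P: P holds on a dense open subset of Z. *)
Definition for_general_point Z (P : proj -> Prop) :=
  exists Y, [/\ zclosed Y,
    forall p, Z p -> zclosure (fun q => Z q /\ ~ Y q) p &
    forall p, Z p -> ~ Y p -> P p].

(* The cone in K^m over the embedded projective tangent space of Z at x. *)
Definition tangent_cone Z x (u : 'rV[K]_m) :=
  forall f, vanishing_ideal Z f -> forall v, v \in val x ->
    \sum_i f^`M(i).@[v 0] * u 0 i = 0.

(* T_x Z is the quotient of the linear space [tangent_cone Z x] by the line x
   (up to the twist by x^*, which does not change its projectivization).  A
   [tangent_basis] lifts a basis of this quotient, and so identifies P(T_x Z)
   with P(K^d). *)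
Definition tangent_basis d Z x (B : d.-tuple 'rV[K]_m) :=
  [/\ free B, (val x :&: <<B>> = 0)%VS &
      forall u, tangent_cone Z x u <-> u \in (val x + <<B>>)%VS].

Definition smooth_at Z x :=
  exists d, zdim Z d /\ exists B : d.-tuple 'rV[K]_m, tangent_basis Z x B.

End Projective.

(* The variety of lines through x, as a set of tangent directions in the
   coordinates of P(T_x Z) given by B: a line P(l) through x has the tangent
   direction l/x, and l/x is spanned by the class of any element of l lying in
   <<B>>. *)
Definition lines_through (K : fieldType) m d (Z : proj K m -> Prop)
    (x : proj K m) (B : d.-tuple 'rV[K]_m) (p : proj K d) : Prop :=
  exists l : {vspace 'rV[K]_m},
    [/\ \dim l = 2, (val x <= l)%VS,
        forall y : proj K m, (val y <= l)%VS -> Z y &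
        forall a, a \in val p -> \sum_i a 0 i *: tnth B i \in l].

Section SymbolSystem.
Variables (K : fieldType) (n : nat).

(* W is K^(n+1) and Sym^k W^* is the space of forms of degree k; a graded
   subspace of Sym W^* is given by its homogeneous parts.  There is no symbol
   system of rank 2 on the zero space, as F^2 is nonzero. *)
Definition graded_subspace := forall k, {vspace dhomog n.+1 K k}.

Definition symbol_system2 (F : graded_subspace) :=
  [/\ F 0%N = fullv, F 1%N = fullv, F 2%N != 0%VS &
      forall k, (3 <= k)%N -> F k = 0%VS].

Variables (c : nat) (Q : c.-tuple (dhomog n.+1 K 2)).

(* (t, w) |-> (t^2, t w, iota_w^2), where (F^2)^* has the basis dual to Q. *)
Definition euler_map (t : K) (w : 'rV[K]_n.+1) : 'rV[K]_(1 + n.+1 + c) :=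
  row_mx (row_mx (t ^+ 2)%:M (t *: w))
         (\row_i (mpoly_of_dhomog (tnth Q i)).@[w 0]).

Definition euler_symmetric : proj K (1 + n.+1 + c) -> Prop :=
  zclosure (fun p => exists t w,
    euler_map t w != 0 /\ val p = <[euler_map t w]>%VS).

Definition base_locus (p : proj K n.+1) : Prop :=
  forall i, vanishes_at (mpoly_of_dhomog (tnth Q i)) p.

End SymbolSystem.

(* Main.v *)
Require Import Defs.
From HB Require Import structures.
From mathcomp Require Import all_boot all_order all_algebra.
From mathcomp Require Import reals complex mpoly.
From mathcomp Require Import boolp zify ring.

(** Write q_1, ..., q_c for the quadrics, N for the dimension of W, and call a
    polynomial a form when it is homogeneous of positive degree.  Everything
    rests on a criterion valid for any forms q_1, ..., q_c in N variables:

    the sequence is regular iff c <= N and some N - c linear forms have no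
    common zero with q_1, ..., q_c in projective space.

    Both directions connect algebra with chains of irreducible closed sets.

    - If N forms have no common zero, they are a regular sequence
      ([regular_of_no_common_zero]).  Starting from N independent linear forms,
      which are regular after a change of coordinates, the forms are exchanged
      one at a time.  Such an exchange is harmless: when a is a nonzerodivisor
      modulo I and some power of a lies in I + (b), then b is a nonzerodivisor
      modulo I, because b u in I forces a^k u in I ([nzd_mod_exchange]).  The
      Nullstellensatz supplies the power, and regular sequences of forms can be
      permuted.  What has to be found at each step is a linear form l such that
      the system with l in place of q still has no common zero; any l that
      vanishes identically on no irreducible component of the zero set of the
      other forms will do, because a linear form can have a zero on an
      irreducible Y without zeros of q only by vanishing on all of Y
      ([irreducible_no_zero]).

    - Regular sequences and strict chains of irreducible closed sets both yield
      long towers of ideals in which each ideal contains a nonzerodivisor modulo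
      the previous one.  Such a tower of length t produces k^t linearly
      independent polynomials of degree O(k), so t is at most the number of
      variables ([tower_bound]).  Hence a regular sequence of length c and a
      chain of length d in its zero set satisfy c + d < N
      ([regular_chain_bound]).

    - Cutting a closed set by a linear form that vanishes on none of its
      irreducible components shortens chains; so a closed set without a chain of
      length d is emptied by d linear forms ([chain_or_forms]).

    Statements (2) and (4) are thereby equivalent for all sequences of forms
    ([set_theoretic_ci_regular]).

    Let M be the Euler-symmetric variety and z, x_j, y_i the coordinates of its
    ambient space.  It is the closure of the graph of (q_1, ..., q_c) over the
    chart z = 1; it is irreducible of dimension N, and the equations
    z y_i = q_i(x) hold on it.  If the q_i are regular, the criterion shows that
    z is a nonzerodivisor modulo these equations, so they generate the ideal of
    M, whence (1).  If conversely the ideal of M has c generators, comparison of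
    the parts of degree 2 shows that the equations z y_i = q_i(x) already cut
    out M; then M meets the hyperplane z = 0 in the common zeros of z and the
    q_i.  As M is irreducible, this section contains no chain of length N, so N
    further linear forms empty it, and the criterion in all the variables
    z, x_j, y_i gives (4).

    At a point of the chart, a tangent direction modulo the point itself is a
    vector u of W, and the line in that direction lies on M iff q_i(u) = 0 for
    all i.  So the variety of lines is the base locus up to a linear change of
    coordinates, and (3) is (2) for the transformed quadrics; regularity is
    insensitive to this change. *)

Set Implicit Arguments.
Unset Strict Implicit.
Unset Printing Implicit Defensive.

Import GRing.Theory.
Local Open Scope ring_scope.
Local Notation zsubset := Defs.subset.

(** * Ideals and Noetherian rings *)

Record is_ideal (A : comNzRingType) (I : A -> Prop) : Prop := IsIdeal {
  ideal0 : I 0;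
  idealD : forall x y, I x -> I y -> I (x + y);
  idealM : forall a x, I x -> I (a * x)}.

Record is_prime (A : comNzRingType) (P : A -> Prop) : Prop := IsPrime {
  prime_ideal : is_ideal P;
  prime_proper : ~ P 1;
  primeM : forall x y, P (x * y) -> P x \/ P y}.

Definition noetherian (A : comNzRingType) := forall I : A -> Prop, is_ideal I ->
  exists2 s : seq A, (forall x, x \in s -> I x) & forall x, I x -> ideal_of s x.

Section Ideals.
Variable A : comNzRingType.
Implicit Types (I J P : A -> Prop) (s t : seq A) (x : A).

Lemma idealN I : is_ideal I -> forall x, I x -> I (- x).
Proof. by move=> hI x /(idealM hI (-1)); rewrite mulN1r. Qed.

Lemma idealB I : is_ideal I -> forall x y, I x -> I y -> I (x - y).
Proof. by move=> hI x y hx hy; apply: idealD => //; apply: idealN. Qed.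

Lemma idealMr I : is_ideal I -> forall a x, I x -> I (x * a).
Proof. by move=> hI a x hx; rewrite mulrC; apply: idealM. Qed.

Lemma ideal_sum I : is_ideal I -> forall T (r : seq T) (Q : pred T) (F : T -> A),
  (forall i, Q i -> I (F i)) -> I (\sum_(i <- r | Q i) F i).
Proof.
move=> hI T r Q F hF; apply: (big_ind I) => //; first exact: ideal0.
by move=> x y; apply: idealD.
Qed.

Lemma ideal_subl I x y : is_ideal I -> I (x - y) -> I y -> I x.
Proof. by move=> hI hxy hy; rewrite -(subrK y x); apply: idealD. Qed.

Lemma prime_exp P : is_prime P -> forall x k, P (x ^+ k) -> P x.
Proof.
move=> hP x; elim=> [|k IH]; first by rewrite expr0 => /(prime_proper hP).
by rewrite exprS => /(primeM hP)[|/IH].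
Qed.

Lemma ideal_of_nil x : ideal_of [::] x <-> x = 0.
Proof.
split=> [[a ->]|->]; first by rewrite big_ord0.
by exists (fun _ => 0); rewrite big_ord0.
Qed.

Lemma ideal_of_cons a s x :
  ideal_of (a :: s) x <-> exists b, ideal_of s (x - b * a).
Proof.
split=> [[c ->]|[b [c hc]]].
  exists (c ord0); exists (fun i => c (lift ord0 i)).
  by rewrite big_ord_recl /= addrC addKr.
exists (fun i => if unlift ord0 i is Some j then c j else b).
rewrite big_ord_recl unlift_none /=.
under eq_bigr do rewrite liftK /=.
by rewrite -hc addrC subrK.
Qed.

Lemma ideal_of_is_ideal s : is_ideal (ideal_of s).
Proof.
split=> [|x y [a ->] [b ->]|c x [a ->]].
- by exists (fun _ => 0); rewrite big1 // => i _; rewrite mul0r.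
- exists (fun i => a i + b i); rewrite -big_split /=.
  by apply: eq_bigr => i _; rewrite mulrDl.
- exists (fun i => c * a i); rewrite mulr_sumr.
  by apply: eq_bigr => i _; rewrite mulrA.
Qed.

Lemma mem_ideal_of s x : x \in s -> ideal_of s x.
Proof.
elim: s => // a s IH; rewrite inE => /orP[/eqP ->|/IH hx].
  apply/ideal_of_cons; exists 1; rewrite mul1r subrr.
  exact: ideal0 (ideal_of_is_ideal s).
by apply/ideal_of_cons; exists 0; rewrite mul0r subr0.
Qed.

Lemma ideal_of_min I s : is_ideal I ->
  (forall x, x \in s -> I x) -> forall x, ideal_of s x -> I x.
Proof.
move=> hI hs x [a ->]; apply: ideal_sum => // i _.
by apply: idealM => //; apply/hs/mem_nth.
Qed.

Lemma ideal_of_sub s t : {subset s <= t} -> forall x, ideal_of s x -> ideal_of t x.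
Proof.
move=> st; apply: ideal_of_min (ideal_of_is_ideal t) _ => x /st.
exact: mem_ideal_of.
Qed.

(** Were there no maximal member, choice would give a strictly increasing sequence
    of ideals; the union is generated by finitely many elements, which already lie in
    one of its terms. *)
Lemma noetherian_max (F : (A -> Prop) -> Prop) : noetherian A ->
    (forall I, F I -> is_ideal I) -> (exists I, F I) ->
  exists2 I, F I & forall J, F J -> (forall x, I x -> J x) -> forall x, J x -> I x.
Proof.
move=> nA idF [I0 FI0]; apply: contrapT => noM.
have step (I : {I | F I}) : exists J : {J | F J},
    (forall x, sval I x -> sval J x) /\ exists x, sval J x /\ ~ sval I x.
  apply: contrapT => h; apply: noM; exists (sval I); first exact: svalP.
  move=> J FJ sub x Jx; apply: contrapT => nIx; apply: h.
  by exists (exist _ J FJ); split=> //; exists x.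
have [g hg] := choice step.
pose c k := sval (iter k g (exist _ I0 FI0)).
have ci k : is_ideal (c k) by apply: idF; apply: svalP.
have cS k x : c k x -> c k.+1 x by apply: (hg _).1.
have cle k l x : (k <= l)%N -> c k x -> c l x.
  by move/subnK <-; elim: (l - k)%N => //= n IH /IH; apply: cS.
have uI : is_ideal (fun x => exists k, c k x).
  split=> [|x y [k hx] [l hy]|a x [k hx]].
  - by exists 0%N; apply: ideal0.
  - exists (maxn k l); apply: idealD => //.
      by apply: cle hx; apply: leq_maxl.
    by apply: cle hy; apply: leq_maxr.
  - by exists k; apply: idealM.
have [s hs us] := nA _ uI.
have [k hk] : exists k, forall x, x \in s -> c k x.
  elim: s hs {us} => [|a s IH] hs; first by exists 0%N.
  have [|k hk] := IH; first by move=> x xs; apply: hs; rewrite inE xs orbT.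
  have [l hl] := hs a (mem_head _ _).
  exists (maxn k l) => x; rewrite inE => /orP[/eqP ->|/hk].
    by apply: cle hl; apply: leq_maxr.
  by apply: cle; apply: leq_maxl.
have [_ [x [hx nx]]] := hg (iter k g (exist _ I0 FI0)).
apply: nx; apply: (ideal_of_min (ci k) hk); apply: us.
by exists k.+1.
Qed.

Definition ideal_add I b x := exists a, I (x - a * b).

Lemma ideal_add_ideal I b : is_ideal I -> is_ideal (ideal_add I b).
Proof.
move=> hI; split=> [|y z [a ha] [a' ha']|a' y [a ha]].
- by exists 0; rewrite mul0r subr0; apply: ideal0.
- by exists (a + a'); rewrite mulrDl opprD addrACA; apply: idealD.
- by exists (a' * a); rewrite -mulrA -mulrBr; apply: idealM.
Qed.

Lemma ideal_add_sub I b x : I x -> ideal_add I b x.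
Proof. by move=> Ix; exists 0; rewrite mul0r subr0. Qed.

Lemma ideal_add_mem I b : is_ideal I -> ideal_add I b b.
Proof. by move=> hI; exists 1; rewrite mul1r subrr; apply: ideal0. Qed.

Lemma zero_ideal : is_ideal (fun x : A => x = 0).
Proof. by split=> // [x y -> ->|a x ->]; rewrite ?addr0 ?mulr0. Qed.

(** An ideal maximal among those containing I and no power of h is prime: if x and y
    lie outside it, then it contains some h^k - a x and some h^l - b y, so x y in it
    would put h^(k + l) there as well. *)
Lemma prime_avoiding I h : noetherian A -> is_ideal I ->
    (forall k, ~ I (h ^+ k)) ->
  exists P, [/\ is_prime P, forall x, I x -> P x & ~ P h].
Proof.
move=> nA hI hh.
pose F J := [/\ is_ideal J, forall x, I x -> J x & forall k, ~ J (h ^+ k)].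
have [||P [iP IP hP] maxP] := noetherian_max (F := F) nA.
- by move=> J [].
- by exists I.
have key x : ~ P x -> exists k a, P (h ^+ k - a * x).
  move=> nPx; apply: contrapT => no; apply: nPx.
  apply: (maxP (ideal_add P x)); last exact: ideal_add_mem.
    split; [exact: ideal_add_ideal | by move=> y /IP; apply: ideal_add_sub |].
    by move=> k [a ha]; apply: no; exists k, a.
  exact: ideal_add_sub.
exists P; split=> //; last by have := hP 1%N; rewrite expr1.
split=> // [|x y Pxy]; first by have := hP 0%N; rewrite expr0.
apply: contrapT => /not_orP[/key[k [a hk]] /key[l [b hl]]].
apply: (hP (k + l)%N); rewrite exprD.
have -> : h ^+ k * h ^+ l = (h ^+ k - a * x) * h ^+ l
    + (a * x * (h ^+ l - b * y) + a * b * (x * y)).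
  by rewrite mulrBl mulrBr addrA subrKA -!mulrA [b * (x * y)]mulrCA subrK.
apply: idealD => //; first exact: idealMr.
by apply: idealD => //; apply: idealM.
Qed.

End Ideals.

Lemma preim_ideal (A B : comNzRingType) (f : {rmorphism A -> B}) (I : B -> Prop) :
  is_ideal I -> is_ideal (fun x => I (f x)).
Proof.
move=> hI; split=> [|x y hx hy|a x hx]; first by rewrite rmorph0; apply: ideal0.
  by rewrite rmorphD; apply: idealD.
by rewrite rmorphM; apply: idealM.
Qed.

Lemma preim_prime (A B : comNzRingType) (f : {rmorphism A -> B}) (P : B -> Prop) :
  is_prime P -> is_prime (fun x => P (f x)).
Proof.
move=> hP; split=> [||x y]; first exact: preim_ideal (prime_ideal hP).
  by rewrite rmorph1; apply: prime_proper.
by rewrite rmorphM; apply: primeM.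
Qed.

Lemma ideal_of_map (A B : comNzRingType) (f : {rmorphism A -> B}) s x :
  ideal_of s x -> ideal_of (map f s) (f x).
Proof.
apply: (ideal_of_min (I := fun x => ideal_of (map f s) (f x))).
  exact: preim_ideal (ideal_of_is_ideal _).
by move=> y ys; apply: mem_ideal_of; apply: map_f.
Qed.

Lemma noetherian_surj (A B : comNzRingType) (f : {rmorphism A -> B}) (g : B -> A) :
  cancel g f -> noetherian A -> noetherian B.
Proof.
move=> gK nA I hI; have [s hs us] := nA _ (preim_ideal f hI).
exists (map f s) => [_ /mapP[x xs ->]|x Ix]; first exact: hs.
by rewrite -(gK x); apply/ideal_of_map/us; rewrite gK.
Qed.

Lemma noetherian_field (K : fieldType) : noetherian K.
Proof.
move=> I hI; have [[x [Ix x0]]|no] := pselect (exists x, I x /\ x != 0).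
  exists [:: x] => y; first by rewrite inE => /eqP ->.
  move=> _; apply/ideal_of_cons; exists (y / x).
  by rewrite divfK // subrr; apply/ideal_of_nil.
exists [::] => // x Ix; apply/ideal_of_nil; apply: contrapT => /eqP x0.
by apply: no; exists x.
Qed.

(** Hilbert's basis theorem.  The coefficients in degree d of the members of I of
    degree at most d form an ideal L d, increasing in d and constant from some D on.
    Lifting generators of L 0, ..., L D gives generators of I: they allow the top
    coefficient of any member of I to be cancelled. *)
Lemma noetherian_poly (B : comNzRingType) : noetherian B -> noetherian {poly B}.
Proof.
move=> nB I hI.
pose L d c := exists f, [/\ I f, (size f <= d.+1)%N & f`_d = c].
have LI d : is_ideal (L d).
  split=> [|_ _ [f [If sf <-]] [g [Ig sg <-]]|a _ [f [If sf <-]]].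
  - by exists 0; rewrite size_poly0 coef0; split=> //; apply: ideal0.
  - exists (f + g); rewrite coefD; split=> //; first exact: idealD.
    by apply: leq_trans (size_polyD _ _) _; rewrite geq_max sf.
  - exists (a%:P * f); rewrite coefCM; split=> //; first exact: idealM.
    by rewrite mul_polyC; apply: leq_trans (size_scale_leq _ _) _.
have LS d e c : (d <= e)%N -> L d c -> L e c.
  move=> de [f [If sf <-]]; exists (f * 'X^(e - d)); split.
  - exact: idealMr.
  - have [->|f0] := eqVneq f 0; first by rewrite mul0r size_poly0.
    by rewrite size_mulXn // -[in e.+1](subnK de) -addnS leq_add2l.
  - by rewrite coefMXn ltnNge leq_subr /= subKn.
have LU : is_ideal (fun c => exists d, L d c).
  split=> [|x y [d hx] [e hy]|a x [d hx]].
  - by exists 0%N; apply: ideal0.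
  - exists (maxn d e); apply: idealD => //.
      by apply: LS hx; apply: leq_maxl.
    by apply: LS hy; apply: leq_maxr.
  - by exists d; apply: idealM.
have [D hD] : exists D, forall d c, L d c -> L D c.
  have [s hs us] := nB _ LU.
  suff [D hD] : exists D, forall x, x \in s -> L D x.
    by exists D => d c Lc; apply: (ideal_of_min (LI D) hD); apply: us; exists d.
  elim: s hs {us} => [|a s IH] hs; first by exists 0%N.
  have [|k hk] := IH; first by move=> x xs; apply: hs; rewrite inE xs orbT.
  have [l hl] := hs a (mem_head _ _).
  exists (maxn k l) => x; rewrite inE => /orP[/eqP ->|/hk].
    by apply: LS hl; apply: leq_maxr.
  by apply: LS; apply: leq_maxl.
have lift d : exists l : seq {poly B}, (forall f, f \in l -> I f) /\
    forall c, L d c -> exists h, [/\ ideal_of l h, (size h <= d.+1)%N & h`_d = c].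
  have [s hs us] := nB _ (LI d).
  suff [l [hl1 hl2]] : exists l : seq {poly B}, (forall f, f \in l -> I f) /\
      forall c, ideal_of s c ->
        exists h, [/\ ideal_of l h, (size h <= d.+1)%N & h`_d = c].
    by exists l; split=> // c /us/hl2.
  elim: s hs {us} => [|a s IH] hs.
    exists [::]; split=> // c /ideal_of_nil ->; exists 0.
    by rewrite size_poly0 coef0; split=> //; apply/ideal_of_nil.
  have [|l [hl1 hl2]] := IH; first by move=> x xs; apply: hs; rewrite inE xs orbT.
  have [f [If sf fa]] := hs a (mem_head _ _).
  exists (f :: l); split=> [g|c]; first by rewrite inE => /orP[/eqP ->|/hl1].
  move/ideal_of_cons => [b /hl2[h [lh sh hc]]].
  exists (h + b%:P * f); split.
  - by apply/ideal_of_cons; exists b%:P; rewrite addrK.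
  - apply: leq_trans (size_polyD _ _) _; rewrite geq_max sh mul_polyC.
    by apply: leq_trans (size_scale_leq _ _) _.
  - by rewrite coefD coefCM fa hc subrK.
have [l hl] := choice lift.
pose G := flatten [seq l d | d <- iota 0 D.+1].
have GI f : f \in G -> I f.
  by move=> /flattenP[_ /mapP[d _ ->]]; apply: (hl d).1.
exists G => // f; move: {2}(size f) (leqnn (size f)) => k.
elim: k f => [|k IH] f.
  rewrite leqn0 size_poly_eq0 => /eqP -> _.
  exact: ideal0 (ideal_of_is_ideal _).
move=> sf If; pose d := minn k D.
have Lc : L d f`_k.
  have Lk : L k f`_k by exists f.
  by rewrite /d /minn; case: ltnP => // _; apply: hD Lk.
have [h [lh sh hc]] := (hl d).2 _ Lc.
have Gh : ideal_of G h.
  apply: ideal_of_sub lh => g gl; apply/flattenP; exists (l d) => //.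
  by apply/mapP; exists d => //; rewrite mem_iota /= add0n ltnS geq_minr.
have dk : (d <= k)%N by apply: geq_minl.
pose g := h * 'X^(k - d).
have Gg : ideal_of G g by apply: idealMr => //; apply: ideal_of_is_ideal.
apply: (ideal_subl (ideal_of_is_ideal G) _ Gg).
apply: IH; last first.
  by apply: idealB => //; apply: (ideal_of_min hI GI Gg).
apply/leq_sizeP => j; rewrite leq_eqVlt => /orP[/eqP <-|kj].
  by rewrite coefB /g coefMXn ltnNge leq_subr /= subKn // hc subrr.
rewrite coefB (nth_default 0 (leq_trans sf kj)) sub0r /g coefMXn.
case: ltnP => _; first by rewrite oppr0.
rewrite nth_default ?oppr0 // (leq_trans sh) //.
by rewrite ltn_subRL subnK.
Qed.

(** * Polynomial rings by adjoining the last variable *)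

(** Two substitutions that are congruent on the variables are congruent everywhere;
    with the zero ideal this says that a morphism is determined by its values on
    constants and variables. *)
Lemma mpoly_rmorph_congr (n : nat) (K S : comNzRingType) (I : S -> Prop)
    (f g : {rmorphism {mpoly K[n]} -> S}) : is_ideal I ->
    (forall c, f c%:MP = g c%:MP) -> (forall i, I (f 'X_i - g 'X_i)) ->
  forall p, I (f p - g p).
Proof.
move=> hI hC hX.
have I0 : I 0 := ideal0 hI.
have congM x y x' y' : I (x - x') -> I (y - y') -> I (x * y - x' * y').
  move=> hx hy; have -> : x * y - x' * y' = (x - x') * y + x' * (y - y').
    by rewrite mulrBl mulrBr subrKA.
  by apply: (idealD hI); [apply: (idealMr hI) | apply: (idealM hI)].
have hM m : I (f 'X_[m] - g 'X_[m]).
  rewrite mpolyXE_id !rmorph_prod.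
  elim/big_rec2: _ => [|i x y _ IH]; first by rewrite subrr.
  apply: (congM _ _ _ _ _ IH); rewrite !rmorphXn; elim: (m i) => [|k IHk].
    by rewrite !expr0 subrr.
  by rewrite !exprS; apply: (congM).
elim/mpolyind=> [|c m p _ _ IH]; first by rewrite !rmorph0 subrr.
rewrite -mul_mpolyC !rmorphD !rmorphM hC opprD addrACA -mulrBr.
by apply: (idealD hI) => //; apply: (idealM hI).
Qed.

Lemma mpoly_rmorph_ext (n : nat) (K S : comNzRingType)
    (f g : {rmorphism {mpoly K[n]} -> S}) :
    (forall c, f c%:MP = g c%:MP) -> (forall i, f 'X_i = g 'X_i) -> f =1 g.
Proof.
move=> hC hX p; apply/eqP; rewrite -subr_eq0; apply/eqP.
apply: (mpoly_rmorph_congr (I := fun x => x = 0)) => // [|i].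
  exact: zero_ideal.
by rewrite hX subrr.
Qed.

Lemma meval_ideal (n : nat) (K : comNzRingType) (a : 'I_n -> K) :
  is_ideal (fun f : {mpoly K[n]} => f.@[a] = 0).
Proof. exact: (preim_ideal (meval a) (zero_ideal K)). Qed.

Section LastVariable.
Variables (n : nat) (K : comNzRingType).

Lemma muniXw (i : 'I_n) : muni ('X_(lift ord_max i) : {mpoly K[n.+1]}) = ('X_i)%:P.
Proof.
rewrite muniE msuppX big_seq1 mcoeffX eqxx scale1r mnm1E eq_sym.
rewrite (negbTE (neq_lift _ _)) expr0 alg_polyC; congr ('X_[_])%:P.
apply/mnmP=> j; rewrite mnmE !mnm1E; congr nat_of_bool.
by rewrite -!val_eqE /= /bump leqNgt ltn_ord.
Qed.

Lemma muniXmax : muni ('X_ord_max : {mpoly K[n.+1]}) = 'X.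
Proof.
rewrite muniE msuppX big_seq1 mcoeffX eqxx scale1r mnm1E eqxx expr1.
rewrite (_ : [multinom _ | i < n] = 0%MM) ?mpolyX0 ?scale1r //.
apply/mnmP=> j; rewrite mnmE mnm1E mnm0E -val_eqE /=.
by rewrite gtn_eqF.
Qed.

(** Inverse of [muni], the reading of a polynomial as a univariate polynomial in its
    last variable. *)
Definition mofpoly : {poly {mpoly K[n]}} -> {mpoly K[n.+1]} :=
  horner_eval 'X_ord_max \o map_poly (@mwiden n K).
HB.instance Definition _ := GRing.RMorphism.on mofpoly.

Lemma mofpolyC p : mofpoly p%:P = mwiden p.
Proof. by rewrite /mofpoly /= map_polyC /= /horner_eval hornerC. Qed.

Lemma mofpolyX : mofpoly 'X = 'X_ord_max.
Proof. by rewrite /mofpoly /= map_polyX /horner_eval hornerX. Qed.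

Lemma mwidenXU (i : 'I_n) : mwiden ('X_i : {mpoly K[n]}) = 'X_(lift ord_max i).
Proof.
rewrite mwidenX mnmwiden1; congr 'X_[U_(_)].
by apply: val_inj; rewrite /= /bump leqNgt ltn_ord.
Qed.

Lemma muniK : cancel (@muni n K) mofpoly.
Proof.
apply: (mpoly_rmorph_ext (f := mofpoly \o @muni n K) (g := idfun)) => [c|i] /=.
  by rewrite muniC mofpolyC mwidenC.
case: (unliftP ord_max i) => [j|] ->; last by rewrite muniXmax mofpolyX.
by rewrite muniXw mofpolyC mwidenXU.
Qed.

Definition ext_point (a : 'I_n -> K) (b : K) (i : 'I_n.+1) : K :=
  if unlift ord_max i is Some j then a j else b.

Lemma meval_muni a b (p : {mpoly K[n.+1]}) :
  p.@[ext_point a b] = (map_poly (meval a) (muni p)).[b].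
Proof.
apply: (mpoly_rmorph_ext (f := meval (ext_point a b))
  (g := horner_eval b \o map_poly (meval a) \o @muni n K)) => [c|i] /=.
  by rewrite mevalC muniC map_polyC /= mevalC /horner_eval hornerC.
rewrite mevalXU /ext_point /horner_eval.
case: (unliftP ord_max i) => [j|] ->.
  by rewrite muniXw map_polyC /= mevalXU hornerC.
by rewrite muniXmax map_polyX hornerX.
Qed.

End LastVariable.

Lemma noetherian_mpoly (K : fieldType) n : noetherian {mpoly K[n]}.
Proof.
elim: n => [|n IH].
  apply: (noetherian_surj (f := @mpolyC 0 K) (g := mcoeff 0%MM)).
    by move=> p; rewrite [RHS]nvar0_mpolyC.
  exact: noetherian_field.
exact: noetherian_surj (@muniK n K) (noetherian_poly IH).
Qed.

(** * Hilbert's Nullstellensatz *)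

Section PseudoDivision.
Variables (B : idomainType) (P : B -> Prop).
Hypothesis hP : is_prime P.
Implicit Types (J : {poly B} -> Prop) (f g q w : {poly B}).

(** The ideal generated by P in the polynomial ring, for an ideal P of B. *)
Definition coef_in q := forall i, P q`_i.

Lemma coef_in_sub J : is_ideal J -> (forall c, P c -> J c%:P) ->
  forall q, coef_in q -> J q.
Proof.
move=> hJ PJ q hq; rewrite -[q]coefK poly_def; apply: ideal_sum => // i _.
by rewrite -mul_polyC; apply: (idealMr hJ); apply: PJ.
Qed.

(** Division with remainder modulo P.  An element w of J of least size outside P[X]
    cannot have its leading coefficient in P, since that term could be subtracted; and
    pseudo-division by w leaves a remainder in J of smaller size, hence in P[X]. *)
Lemma minimal_outside J : is_ideal J -> (forall c, P c -> J c%:P) ->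
    (exists2 f, J f & ~ coef_in f) ->
  exists w, [/\ J w, ~ coef_in w, ~ P (lead_coef w),
    (forall q, J q -> ~ coef_in q -> (size w <= size q)%N) &
    (forall g, J g -> coef_in ((lead_coef w ^+ scalp g w)%:P * g - g %/ w * w))].
Proof.
move=> hJ PJ [f0 Jf0 nf0].
have iP := prime_ideal hP.
pose T k := `[< exists q, [/\ J q, ~ coef_in q & size q = k] >].
have exT : exists k, T k by exists (size f0); apply/asboolP; exists f0.
case: (ex_minnP exT) => k /asboolP[w [Jw nw sw]] mink.
have minw q : J q -> ~ coef_in q -> (size w <= size q)%N.
  by move=> Jq nq; rewrite sw; apply: mink; apply/asboolP; exists q.
have small q : J q -> (size q < size w)%N -> coef_in q.
  by move=> Jq sq; apply: contrapT => /(minw q Jq); rewrite leqNgt sq.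
have w0 : w != 0.
  by apply: contra_notN nw => /eqP -> i; rewrite coef0; apply: ideal0 iP.
have nlc : ~ P (lead_coef w).
  move=> Plc; apply: nw; pose l := (lead_coef w)%:P * 'X^((size w).-1).
  have Pl : coef_in l.
    by move=> i; rewrite coefCM coefXn; apply: (idealMr iP).
  have Pr : coef_in (w - l).
    apply: small; first by apply: (idealB hJ) => //; apply: coef_in_sub.
    rewrite -[X in (_ < X)%N]prednK ?size_poly_gt0 //.
    apply/leq_sizeP => j; rewrite leq_eqVlt => /orP[/eqP <-|hj].
      by rewrite coefB coefCM coefXn eqxx mulr1 subrr.
    rewrite coefB coefCM coefXn gtn_eqF // mulr0 subr0 nth_default //.
    by move: hj; rewrite -ltnS prednK ?size_poly_gt0.
  by move=> i; rewrite -(subrK l w) coefD; apply: (idealD iP).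
exists w; split=> // g Jg.
rewrite mul_polyC Pdiv.WeakIdomain.divp_eq addrC addrA addNr add0r.
apply: small; last by rewrite ltn_modp.
rewrite (_ : g %% w = (lead_coef w ^+ scalp g w)%:P * g - g %/ w * w).
  by apply: (idealB hJ); apply: (idealM hJ).
by rewrite mul_polyC Pdiv.WeakIdomain.divp_eq addrC addrA addNr add0r.
Qed.

End PseudoDivision.

(** Nullstellensatz for a prime P and h outside P, by induction on the number of
    variables.  Let P' be the contraction of P to the polynomials in the first n
    variables.  If P is generated by P', some coefficient of h is outside P'; a zero of
    P' at which that coefficient does not vanish leaves a nonzero univariate polynomial,
    which has a nonroot.  Otherwise let f in P be of least degree outside P'[X].  A least
    element w of P + (h) outside P'[X] is a constant e, since otherwise dividing f and h
    by w would give an element of P of smaller degree than f, or put h in P.  At a zero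
    of P' where e and the leading coefficient of f do not vanish, any root of f is a zero
    of P by division, and h does not vanish there because e lies in P + (h). *)
Lemma prime_zero (K : closedFieldType) n (P : {mpoly K[n]} -> Prop) h :
    is_prime P -> ~ P h ->
  exists2 a, (forall p, P p -> p.@[a] = 0) & h.@[a] != 0.
Proof.
elim: n P h => [|n IH] P h hP nPh.
  have iP := prime_ideal hP.
  have P0 p : P p -> p = 0.
    rewrite [p]nvar0_mpolyC => Pp; have [->|c0] := eqVneq (p@_0%MM) 0.
      by rewrite mpolyC0.
    case: (prime_proper hP); rewrite -mpolyC1 -(mulVf c0) mpolyCM.
    exact: (idealM iP).
  exists (fun _ => 0) => [p /P0 ->|]; first by rewrite meval0.
  rewrite [h]nvar0_mpolyC mevalC; apply/eqP => h0; apply: nPh.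
  by rewrite [h]nvar0_mpolyC h0 mpolyC0; apply: ideal0 iP.
have [Pt PtP hPt] : exists2 Pt, (forall q, Pt q = P (mofpoly q)) & is_prime Pt.
  by exists (fun q => P (mofpoly q)); [move=> q | exact: (preim_prime (@mofpoly n K) hP)].
have iPt := prime_ideal hPt.
pose P' b := Pt b%:P.
have hP' : is_prime P' by apply: (preim_prime (@polyC _) hPt).
have iP' := prime_ideal hP'.
have [h' h'E] : exists h', h' = muni h by exists (muni h).
have nh' : ~ Pt h' by rewrite PtP h'E muniK.
have EPt q : coef_in P' q -> Pt q by apply: coef_in_sub.
have Eval a q : (forall p, P' p -> p.@[a] = 0) -> coef_in P' q ->
    map_poly (meval a) q = 0.
  by move=> ha hq; apply/polyP=> i; rewrite coef_map coef0; apply/ha/hq.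
suff [a [b [hab hb]]] : exists a b,
    (forall q, Pt q -> (map_poly (meval a) q).[b] = 0)
    /\ (map_poly (meval a) h').[b] != 0.
  exists (ext_point a b) => [p Pp|]; rewrite meval_muni -?h'E //.
  by apply: hab; rewrite PtP muniK.
have [exf|nof] := pselect (exists2 f, Pt f & ~ coef_in P' f); last first.
  have PtE q : Pt q -> coef_in P' q.
    by move=> Pq; apply: contrapT => nq; apply: nof; exists q.
  have [i hi] : exists i, ~ P' h'`_i.
    by apply/existsNP => /EPt.
  have [a ha hia] := IH P' _ hP' hi.
  have : map_poly (meval a) h' != 0.
    by apply: contraNneq hia => /polyP/(_ i); rewrite coef_map coef0 /= => ->.
  case/closed_nonrootP => b hb; exists a, b; split=> // q /PtE/(Eval _ _ ha) ->.
  by rewrite horner0.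
have [f [Pf nf nlcf minf divf]] := minimal_outside hP' iPt (fun _ x => x) exf.
pose J := ideal_add Pt h'.
have iJ : is_ideal J by apply: ideal_add_ideal.
have PtJ q : Pt q -> J q by apply: ideal_add_sub.
have Jh : J h' by apply: ideal_add_mem.
have [||w [Jw nw nlcw minw divw]] := minimal_outside hP' iJ.
- by move=> c; apply: PtJ.
- by exists h'; [exact: Jh | move/EPt; exact: nh'].
(* Were w in P, division of h by w would put h into P. *)
have nPw : ~ Pt w.
  move=> Pw; have /EPt := divw h' Jh.
  move/(ideal_subl iPt)/(_ (idealM iPt _ Pw))/(primeM hPt)=> [|//].
  by rewrite rmorphXn => /(prime_exp hPt)/nlcw.
(* Otherwise the quotient of f by w, which lies in P as w does not, would have
   smaller size than f. *)
have sw : (size w <= 1)%N.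
  rewrite leqNgt; apply/negP => sw.
  have Eq : coef_in P' (f %/ w).
    apply: contrapT => nq.
    have Pq : Pt (f %/ w).
      have /EPt hq := divw f (PtJ _ Pf).
      have : Pt (f %/ w * w).
        have -> : f %/ w * w = (lead_coef w ^+ scalp f w)%:P * f
            - ((lead_coef w ^+ scalp f w)%:P * f - f %/ w * w).
          by rewrite opprB addrC subrK.
        by apply: (idealB iPt) => //; apply: (idealM iPt).
      by case/(primeM hPt).
    have := minf _ Pq nq; rewrite Pdiv.CommonIdomain.size_divp; last first.
      by rewrite -size_poly_gt0 ltnW.
    rewrite leqNgt; case/negP; rewrite ltn_subrL -ltnS prednK ?(ltnW sw) // sw /=.
    by rewrite size_poly_gt0; apply: contra_notN nf => /eqP -> i; rewrite coef0; apply: ideal0.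
  apply: nf => i; have := divw f (PtJ _ Pf) i.
  rewrite coefB coefCM => /(ideal_subl iP'); case/(_ _)/(primeM hP')=> //.
    rewrite coefM; apply: (ideal_sum iP') => j _; exact: (idealMr iP').
  by move/(prime_exp hP').
have we : w = (lead_coef w)%:P.
  rewrite lead_coefE (_ : (size w).-1 = 0%N); first exact: size1_polyC.
  by case: (size w) sw => [|[]].
have sf : size f != 1%N.
  apply/eqP => sf; apply: nlcf; rewrite /P' lead_coefE sf /=.
  by rewrite -size1_polyC ?sf.
have [a ha] : exists2 a, (forall p, P' p -> p.@[a] = 0)
    & (lead_coef f * lead_coef w).@[a] != 0.
  by apply: (IH P' _ hP'); move/(primeM hP') => [/nlcf|/nlcw].
rewrite mevalM mulf_eq0 => /norP[ca ea].
have : size (map_poly (meval a) f) != 1%N by rewrite size_map_poly_id0.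
case/closed_rootP => b /eqP rb; exists a, b.
have van q : Pt q -> (map_poly (meval a) q).[b] = 0.
  move=> Pq; have /(Eval _ _ ha)/(congr1 (fun q => q.[b])) := divf q Pq.
  rewrite rmorphB !rmorphM /= map_polyC /= hornerD hornerN !hornerM rb mulr0 subr0.
  rewrite hornerC horner0 rmorphXn => /eqP; rewrite mulf_eq0 expf_eq0.
  by rewrite (negbTE ca) andbF => /eqP.
split=> //; case: Jw => u /van; rewrite we rmorphB rmorphM /= map_polyC /=.
rewrite hornerD hornerN hornerM hornerC => /eqP; rewrite subr_eq0 => /eqP hu.
by apply: contraNneq ea => hb; rewrite hu hb mulr0.
Qed.

Theorem nullstellensatz (K : closedFieldType) n (I : {mpoly K[n]} -> Prop) h :
    is_ideal I ->
    (forall a, (forall p, I p -> p.@[a] = 0) -> h.@[a] = 0) ->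
  radical I h.
Proof.
move=> iI hh; apply: contrapT => /forallNP nr.
have [P [hP IP /(prime_zero hP)[a Pa]]] := prime_avoiding (@noetherian_mpoly K n) iI nr.
by rewrite hh ?eqxx // => p /IP/Pa.
Qed.

(** The case of the prime ideal zero. *)
Lemma mpoly_nonroot (K : closedFieldType) n (p : {mpoly K[n]}) :
  p != 0 -> exists a, p.@[a] != 0.
Proof.
move=> /eqP p0; have [|a _ ha] := @prime_zero K n (fun x => x = 0) p _ p0.
  split=> [||x y /eqP]; last by rewrite mulf_eq0 => /orP[] /eqP; [left|right].
    exact: zero_ideal.
  exact/eqP/oner_neq0.
by exists a.
Qed.

(** * Closed sets in projective space *)

(** The value at 0 may be left out because an algebraically closed field is infinite.
    This is how limits are taken along punctured lines. *)
Lemma poly_eq0_eval (K : closedFieldType) (p : {poly K}) :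
  (forall x, x != 0 -> p.[x] = 0) -> p = 0.
Proof.
move=> hp; apply: contrapT => /eqP p0.
have : p * 'X != 0 by rewrite mulf_neq0 ?polyX_eq0.
case/closed_nonrootP=> x; rewrite rootM rootX negb_or => /andP[rx x0].
by move: rx; rewrite /root hp ?eqxx.
Qed.

Lemma meval_homog (K : comNzRingType) n d (f : {mpoly K[n]}) (a : K) (v : 'I_n -> K) :
  f \is d.-homog -> f.@[fun i => a * v i] = a ^+ d * f.@[v].
Proof.
move=> /dhomogP hf; rewrite !mevalE mulr_sumr big_seq [RHS]big_seq.
apply: eq_bigr => m /hf hm; rewrite [RHS]mulrCA; congr (_ * _).
under eq_bigr do rewrite exprMn; rewrite big_split /=; congr (_ * _).
by rewrite -hm /= mdegE expr_sum.
Qed.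

Lemma meval0_homog (K : comNzRingType) n d (f : {mpoly K[n]}) : (0 < d)%N ->
  f \is d.-homog -> f.@[fun=> 0] = 0.
Proof.
move=> d0 df; have h := meval_homog 0 (fun=> 0) df.
rewrite -[RHS](mul0r f.@[fun=> 0]) -[X in X * _](_ : 0 ^+ d = 0) -?h; last by rewrite expr0n gtn_eqF.
by apply: meval_eq => i; rewrite mul0r.
Qed.

Lemma homog0_const (K : comNzRingType) n (f : {mpoly K[n]}) : f \is 0.-homog ->
  f = (f.@[fun=> 0])%:MP.
Proof.
move=> hf; have e : f = (f@_0%MM)%:MP.
  apply: msize1_polyC; rewrite leqNgt; apply/negP => h2.
  have nz : f != 0 by apply: contraTneq h2 => ->; rewrite msize0.
  have := mlead_deg nz; have /dhomogP := hf; move/(_ _ (mlead_supp nz)) => /= ->.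
  by move=> h3; rewrite -h3 in h2.
by rewrite {2}e mevalC.
Qed.

Lemma pihomog_sumE (K : nzRingType) n (f : {mpoly K[n]}) k : (msize f <= k)%N ->
  f = \sum_(d < k) pihomog mdeg d f.
Proof. by move/(@pihomog_partitionE _ _ mdeg). Qed.


(** The restriction of f to the line spanned by v, as a polynomial in the parameter.
    Its coefficients are the values at v of the homogeneous parts of f. *)
Definition ray_poly (K : comNzRingType) n (f : {mpoly K[n]}) (v : 'I_n -> K) : {poly K} :=
  \poly_(d < msize f) (pihomog mdeg d f).@[v].

Lemma ray_polyE (K : comNzRingType) n (f : {mpoly K[n]}) v a :
  (ray_poly f v).[a] = f.@[fun i => a * v i].
Proof.
rewrite horner_poly [RHS](congr1 (meval _) (pihomog_sumE (leqnn (msize f)))) raddf_sum /=.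
apply: eq_bigr => d _.
by rewrite (meval_homog _ _ (pihomogP _ _ _)) mulrC.
Qed.

Lemma pihomog_large (K : nzRingType) n (f : {mpoly K[n]}) d :
  (msize f <= d)%N -> pihomog mdeg d f = 0.
Proof.
move=> hd; apply/mpolyP => m; rewrite mcoeff0 pihomogE raddf_sum /=.
rewrite big_seq_cond big1 // => m' /andP[/msize_mdeg_lt hm /eqP hm'].
by move: hd; rewrite leqNgt -hm' hm.
Qed.

Lemma ray_poly_coef (K : comNzRingType) n (f : {mpoly K[n]}) v d :
  (ray_poly f v)`_d = (pihomog mdeg d f).@[v].
Proof.
by rewrite coef_poly; case: ltnP => // /pihomog_large ->; rewrite meval0.
Qed.

Section Projective.
Variables (K : closedFieldType) (m : nat).
Implicit Types (p q : proj K m) (Y Z : proj K m -> Prop) (f g : {mpoly K[m]}).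
Implicit Types (v : 'rV[K]_m).

Lemma proj_gen p : exists2 v, v != 0 & val p = <[v]>%VS.
Proof.
case: p => L /= hL; have hd : L != 0%VS by rewrite -dimv_eq0 (eqP hL).
exists (vpick L); first by rewrite vpick0.
apply/esym/eqP; rewrite eqEdim -memvE memv_pick dim_vline vpick0 hd.
by rewrite (eqP hL).
Qed.

Lemma proj_of v : v != 0 -> exists p, val p = <[v]>%VS.
Proof.
move=> v0; have h : \dim <[v]>%VS == 1%N by rewrite dim_vline v0.
by exists (exist (fun L : {vspace 'rV[K]_m} => \dim L == 1%N) _ h).
Qed.

Lemma vanishes_atE f p v : val p = <[v]>%VS ->
  vanishes_at f p <-> forall a, f.@[fun i => a * v 0 i] = 0.
Proof.
move=> hp; split=> [hf a|hf u].
  rewrite -(hf (a *: v)); last by rewrite hp memvZ // memv_line.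
  by apply: meval_eq => i; rewrite mxE.
rewrite hp => /vlineP[a ->]; rewrite -(hf a).
by apply: meval_eq => i; rewrite mxE.
Qed.

Lemma vanishes_at_ray f p v : val p = <[v]>%VS ->
  vanishes_at f p <-> ray_poly f (v 0) = 0.
Proof.
move=> hp; rewrite (vanishes_atE _ hp); split=> [hf|hf a].
  by apply: poly_eq0_eval => a _; rewrite ray_polyE.
by rewrite -ray_polyE hf horner0.
Qed.

Lemma vanishes_at_homog f p v d : val p = <[v]>%VS -> f \is d.-homog ->
  vanishes_at f p <-> f.@[v 0] = 0.
Proof.
move=> hp hf; rewrite (vanishes_atE _ hp); split=> [/(_ 1)|fv a].
  by rewrite (meval_homog _ _ hf) expr1n mul1r.
by rewrite (meval_homog _ _ hf) fv mulr0.
Qed.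

Lemma vanishes_at_pihomog f p :
  vanishes_at f p <-> forall d, vanishes_at (pihomog mdeg d f) p.
Proof.
have [v v0 hp] := proj_gen p; rewrite (vanishes_at_ray _ hp).
have hd d := vanishes_at_homog hp (pihomogP mdeg d f).
split=> [hf d|hf].
  by apply/hd; rewrite -ray_poly_coef hf coef0.
by apply/polyP => d; rewrite ray_poly_coef coef0; apply/hd.
Qed.

Lemma vanishes_at_ideal p : is_ideal (fun f => vanishes_at f p).
Proof.
split=> [v _|f g hf hg v hv|f g hg v hv]; first exact: meval0.
  by rewrite mevalD hf // hg // addr0.
by rewrite mevalM hg // mulr0.
Qed.

(** Along the line p, the restrictions of f and g are univariate polynomials with
    product zero. *)
Lemma vanishes_atM f g p : vanishes_at (f * g) p -> vanishes_at f p \/ vanishes_at g p.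
Proof.
have [v v0 hp] := proj_gen p; rewrite !(vanishes_at_ray _ hp) => hfg.
suff : ray_poly f (v 0) * ray_poly g (v 0) = 0.
  by move/eqP; rewrite mulf_eq0 => /orP[] /eqP; [left|right].
apply: poly_eq0_eval => a _; rewrite hornerM !ray_polyE -mevalM.
by rewrite -ray_polyE hfg horner0.
Qed.

Lemma vanishes_at_prime p : is_prime (fun f => vanishes_at f p).
Proof.
split; [exact: vanishes_at_ideal | | by move=> f g /vanishes_atM].
have [v v0 hp] := proj_gen p; move/(vanishes_atE _ hp)/(_ 0).
by rewrite meval1 => /eqP; rewrite oner_eq0.
Qed.

Lemma vanishing_ideal_ideal Z : is_ideal (vanishing_ideal Z).
Proof.
split=> [p _|f g hf hg p Zp|f g hg p Zp].
- exact: (ideal0 (vanishes_at_ideal p)).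
- by apply: (idealD (vanishes_at_ideal p)); [apply: hf|apply: hg].
- by apply: (idealM (vanishes_at_ideal p)); apply: hg.
Qed.

Lemma vanishing_ideal_pihomog Z f d :
  vanishing_ideal Z f -> vanishing_ideal Z (pihomog mdeg d f).
Proof. by move=> hf p /hf/vanishes_at_pihomog. Qed.

Lemma vanishing_ideal_sub Y Z f :
  zsubset Y Z -> vanishing_ideal Z f -> vanishing_ideal Y f.
Proof. by move=> YZ hf p /YZ/hf. Qed.

(** A polynomial vanishes on a line through 0 iff its homogeneous parts do, and these
    serve as the homogeneous equations. *)
Lemma zclosed_zeros (S : {mpoly K[m]} -> Prop) :
  zclosed (fun p => forall f, S f -> vanishes_at f p).
Proof.
exists (fun g => exists f d, S f /\ g = pihomog mdeg d f).
  by move=> _ [f [d [_ ->]]]; exists d; apply: pihomogP.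
move=> p; split=> [h _ [f [d [Sf ->]]]|h f Sf].
  by have /vanishes_at_pihomog := h f Sf; apply.
by apply/vanishes_at_pihomog => d; apply: h; exists f, d.
Qed.

Lemma zclosed_iff Y Z : (forall p, Y p <-> Z p) -> zclosed Y -> zclosed Z.
Proof.
move=> YZ [S hS hY]; exists S => // p.
by split=> [/YZ/hY //|/hY/YZ].
Qed.

Lemma zclosed_vanishes f : zclosed (vanishes_at f).
Proof.
apply: zclosed_iff (zclosed_zeros (fun g => g = f)) => p.
by split=> [|h g ->//]; apply.
Qed.

Lemma zclosedI Y Z : zclosed Y -> zclosed Z -> zclosed (fun p => Y p /\ Z p).
Proof.
move=> [S hS hY] [T hT hZ]; exists (fun f => S f \/ T f).
  by move=> f [/hS|/hT].
move=> p; split=> [[/hY h /hZ h'] f []|h]; [exact: h|exact: h'|].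
by split; [apply/hY|apply/hZ] => f hf; apply: h; [left|right].
Qed.

Lemma zclosedU Y Z : zclosed Y -> zclosed Z -> zclosed (fun p => Y p \/ Z p).
Proof.
move=> [S hS hY] [T hT hZ].
apply: zclosed_iff (zclosed_zeros (fun h => exists f g, [/\ S f, T g & h = f * g])).
move=> p; split=> [h|hp _ [f [g [Sf Tg ->]]]]; last first.
  case: hp => [/hY/(_ f Sf)|/hZ/(_ g Tg)] hp.
    exact: (idealMr (vanishes_at_ideal p)).
  exact: (idealM (vanishes_at_ideal p)).
apply: contrapT => /not_orP[/hY/existsNP[f /not_implyP[Sf nf]] /hZ].
move/existsNP=> [g /not_implyP[Tg ng]].
by have /vanishes_atM[] : vanishes_at (f * g) p by apply: h; exists f, g.
Qed.

Lemma zclosedP Z : zclosed Z ->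
  forall p, (forall f, vanishing_ideal Z f -> vanishes_at f p) -> Z p.
Proof. by move=> [S hS hZ] p h; apply/hZ => f Sf; apply: h => q /hZ; apply. Qed.

Lemma zclosed_separate Z p : zclosed Z -> ~ Z p ->
  exists d f, [/\ f \is d.-homog, vanishing_ideal Z f & ~ vanishes_at f p].
Proof.
move=> [S hS hZ] /hZ/existsNP[f /not_implyP[Sf nf]].
by have [d hd] := hS f Sf; exists d, f; split=> // q /hZ; apply.
Qed.

Lemma zclosed_subset Y Z : zclosed Z ->
  (forall f, vanishing_ideal Z f -> vanishing_ideal Y f) -> zsubset Y Z.
Proof. by move=> cZ h p Yp; apply: zclosedP => // f /h; apply. Qed.

Lemma zclosure_closed Z : zclosed (zclosure Z).
Proof.
apply: zclosed_iff (zclosed_zeros (vanishing_ideal Z)) => p; split=> [h Y cY ZY|h f hf].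
  by apply: (zclosedP cY) => f hf; apply: h; apply: vanishing_ideal_sub hf.
by apply: (h _ (zclosed_vanishes f)).
Qed.

Lemma sub_zclosure Z : zsubset Z (zclosure Z).
Proof. by move=> p Zp Y _; apply. Qed.

Lemma zclosure_min Y Z : zclosed Y -> zsubset Z Y -> zsubset (zclosure Z) Y.
Proof. by move=> cY ZY p; apply. Qed.

Lemma vanishing_zclosure Z f : vanishing_ideal Z f -> vanishing_ideal (zclosure Z) f.
Proof. by move=> hf; apply: zclosure_min (zclosed_vanishes f) hf. Qed.

Lemma vanishing_ideal_prime Z : zirreducible Z -> is_prime (vanishing_ideal Z).
Proof.
move=> [cZ [p Zp] irrZ]; split.
- exact: vanishing_ideal_ideal.
- by move=> /(_ p Zp)/(prime_proper (vanishes_at_prime p)).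
move=> f g hfg.
have [] // := irrZ _ _ (zclosed_vanishes f) (zclosed_vanishes g).
  by move=> q /hfg/vanishes_atM.
by left. by right.
Qed.

Lemma vanishing_ideal_eval0 Z f : (exists p, Z p) -> vanishing_ideal Z f ->
  f.@[fun=> 0] = 0.
Proof.
move=> [p Zp] /(_ p Zp); have [v v0 hp] := proj_gen p.
move/(vanishes_atE _ hp)/(_ 0) => h0; rewrite -[RHS]h0.
by apply: meval_eq => i; rewrite mul0r.
Qed.

(** Irreducibility of a closure can be tested on the generating set, and with forms
    only. *)
Lemma zclosure_irreducible Z : (exists p, Z p) ->
    (forall d e f g, f \is d.-homog -> g \is e.-homog ->
      vanishing_ideal Z (f * g) -> vanishing_ideal Z f \/ vanishing_ideal Z g) ->
  zirreducible (zclosure Z).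
Proof.
move=> [p Zp] hZ; split; first exact: zclosure_closed.
  by exists p; apply: sub_zclosure.
move=> Y1 Y2 c1 c2 cov; apply: contrapT => /not_orP[n1 n2].
have sep Y : zclosed Y -> ~ zsubset (zclosure Z) Y -> exists d f,
    [/\ f \is d.-homog, vanishing_ideal Y f & ~ vanishing_ideal Z f].
  move=> cY /existsNP[q /not_implyP[Zq nYq]].
  have [d [f [df Yf nf]]] := zclosed_separate cY nYq.
  by exists d, f; split=> // /vanishing_zclosure/(_ q Zq).
have [d [f [df Yf nf]]] := sep _ c1 n1.
have [e [g [eg Yg ng]]] := sep _ c2 n2.
have [] // := hZ d e f g df eg.
move=> q /sub_zclosure/cov[/Yf|/Yg].
  exact: (idealMr (vanishes_at_ideal q)).
exact: (idealM (vanishes_at_ideal q)).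
Qed.

Lemma zclosure_point_irreducible p : zirreducible (zclosure (fun q => q = p)).
Proof.
apply: zclosure_irreducible; first by exists p.
move=> d e f g _ _ /(_ p erefl)/vanishes_atM.
by case=> h; [left|right] => _ ->.
Qed.

Lemma irreducible_cover Y (s : seq (proj K m -> Prop)) : zirreducible Y ->
    (forall i, (i < size s)%N -> zclosed (nth (fun=> False) s i)) ->
    (forall p, Y p -> exists2 i, (i < size s)%N & nth (fun=> False) s i p) ->
  exists2 i, (i < size s)%N & zsubset Y (nth (fun=> False) s i).
Proof.
move=> [cY [p0 Yp0] irr]; elim: s => [|Z s IH] cs cov.
  by have [] := cov p0 Yp0.
have cU : zclosed (fun p => exists2 i, (i < size s)%N & nth (fun=> False) s i p).
  elim: s {IH cov} cs => [|Z' s IH] cs.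
    apply: zclosed_iff (zclosed_vanishes 1) => p; split=> [h|[]//].
    by case: (prime_proper (vanishes_at_prime p)).
  have c1 : zclosed Z' by apply: (cs 1%N).
  have c2 := IH (fun i => match i with 0 => fun _ => cs 0%N isT | i.+1 => fun hi => cs i.+2 hi end).
  apply: zclosed_iff (zclosedU c1 c2) => p; split=> [[h|[i hi h]]|[[|i] hi h]].
  - by exists 0%N.
  - by exists i.+1.
  - by left.
  - by right; exists i.
have [] := irr _ _ (cs 0%N isT) cU.
- move=> p /cov[[|i] hi h]; first by left.
  by right; exists i.
- by exists 0%N.
move=> sub; have [||i hi hs] := IH.
- by move=> i hi; apply: (cs i.+1).
- exact: sub.
by exists i.+1.
Qed.

End Projective.

(** * Irreducible components and linear sections *)

Section Components.
Variables (K : closedFieldType) (m : nat).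
Implicit Types (p q : proj K m) (Y Z : proj K m -> Prop) (f g : {mpoly K[m]}).

Definition components Z (s : seq (proj K m -> Prop)) :=
  (forall i, (i < size s)%N ->
     zirreducible (nth (fun=> False) s i) /\ zsubset (nth (fun=> False) s i) Z) /\
  forall p, Z p -> exists2 i, (i < size s)%N & nth (fun=> False) s i p.

(** Noetherian induction on the vanishing ideal: a closed set with maximal vanishing
    ideal among those without a decomposition would be reducible, and its two pieces would
    decompose. *)
Lemma components_exist Z : zclosed Z -> exists s, components Z s.
Proof.
move=> cZ; apply: contrapT => bad.
pose F I := exists Y, [/\ zclosed Y, ~ (exists s, components Y s) & I = vanishing_ideal Y].
have [||_ [Y [cY nY ->]] maxY] := noetherian_max (F := F) (@noetherian_mpoly K m).
- by move=> _ [Y [_ _ ->]]; apply: vanishing_ideal_ideal.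
- by exists (vanishing_ideal Z), Z.
have [neY|eY] := pselect (exists p, Y p); last first.
  by apply: nY; exists [::]; split=> // p Yp; case: eY; exists p.
have [irrY|nirr] := pselect (zirreducible Y).
  by apply: nY; exists [:: Y]; split=> [[]// _|p Yp]; [split|exists 0%N].
apply: nirr; split=> // Y1 Y2 c1 c2 cov; apply: contrapT => /not_orP[n1 n2].
have small Y' : zclosed Y' -> ~ zsubset Y Y' ->
    exists s, components (fun p => Y p /\ Y' p) s.
  move=> cY' nY'; apply: contrapT => no; apply: nY' => p Yp.
  suff [] : Y p /\ Y' p by [].
  have cYY' := zclosedI cY cY'.
  apply: (zclosedP cYY') => f hf; apply: (maxY (vanishing_ideal (fun p => Y p /\ Y' p))) => //.
    by exists (fun p => Y p /\ Y' p).
  by move=> g hg q [Yq _]; apply: hg.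
have [s1 [h1 v1]] := small _ c1 n1; have [s2 [h2 v2]] := small _ c2 n2.
apply: nY; exists (s1 ++ s2); split=> [i|p Yp].
  rewrite size_cat nth_cat; case: (ltnP i (size s1)) => hi hs.
    by have [irr sub] := h1 i hi; split=> // p /sub[].
  have [|irr sub] := h2 (i - size s1)%N; first by rewrite ltn_subLR.
  by split=> // p /sub[].
rewrite size_cat; have [Y1p|Y2p] := cov p Yp.
  have [i hi hp] := v1 p (conj Yp Y1p); exists i; first exact: ltn_addr.
  by rewrite nth_cat hi.
have [i hi hp] := v2 p (conj Yp Y2p); exists (size s1 + i)%N; first by rewrite ltn_add2l.
by rewrite nth_cat ltnNge leq_addr /= addKn.
Qed.

(** The forms x_0 + t x_1 + t^2 x_2 + ... depend on one parameter t; each v excludes the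
    roots of a single nonzero polynomial in t. *)
Lemma linear_form_avoiding (s : seq 'rV[K]_m) : (forall v, v \in s -> v != 0) ->
  exists2 l : {mpoly K[m]}, l \is 1.-homog & forall v, v \in s -> l.@[v 0] != 0.
Proof.
move=> hs; pose P (v : 'rV[K]_m) : {poly K} := \sum_i (v 0 i)%:P * 'X^i.
have P0 v : v != 0 -> P v != 0.
  apply: contra_neq => Pv; apply/rowP => i; rewrite mxE.
  move/polyP/(_ i): Pv; rewrite coef0 coef_sum (bigD1 i) //= coefCM coefXn eqxx mulr1.
  rewrite big1 ?addr0 // => j ji; rewrite coefCM coefXn.
  by rewrite eq_sym val_eqE (negbTE ji) mulr0.
have : \prod_(v <- s) P v != 0.
  rewrite prodf_seq_neq0; apply/allP => v vs; exact: P0 (hs v vs).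
case/closed_nonrootP => t; rewrite /root horner_prod prodf_seq_neq0 => /allP ht.
exists (\sum_(i < m) t ^+ i *: 'X_i).
  by apply: rpred_sum => i _; apply: rpredZ; rewrite dhomogX /= mdeg1.
move=> v /ht /=; congr (_ != _); rewrite horner_sum (raddf_sum (meval (v 0))); apply: eq_bigr => i _ /=.
by rewrite mevalZ mevalXU hornerM hornerC hornerXn mulrC.
Qed.

(** A form that avoids one point of each component. *)
Lemma form_cutting_components Z s : components Z s ->
  exists2 l, l \is 1.-homog &
    forall i, (i < size s)%N -> ~ vanishing_ideal (nth (fun=> False) s i) l.
Proof.
move=> [hs _].
have hv (i : 'I_(size s)) : exists v : 'rV[K]_m,
    v != 0 /\ exists2 p, val p = <[v]>%VS & nth (fun=> False) s i p.
  have [[_ [p hp] _] _] := hs i (ltn_ord i).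
  by have [v v0 pv] := proj_gen p; exists v; split=> //; exists p.
have [w hw] := choice hv.
have [|l l1 hl] := linear_form_avoiding (s := codom w).
  by move=> _ /codomP[i ->]; apply: (hw i).1.
exists l => // i hi van; have [_ [p pv Yp]] := hw (Ordinal hi).
have /eqP[] := hl _ (codom_f w (Ordinal hi)).
by apply/(vanishes_at_homog pv l1); apply: van.
Qed.

Lemma has_chain_sub Y Z d : zsubset Y Z -> has_chain Y d -> has_chain Z d.
Proof.
move=> YZ [C [h1 h2]]; exists C; split=> // i /h1[irr sub]; split=> // p /sub/YZ //.
Qed.

Lemma has_chain_extend Y Z d : zirreducible Z -> zsubset Y Z -> ~ zsubset Z Y ->
  has_chain Y d -> has_chain Z d.+1.
Proof.
move=> irrZ YZ nZY [C [h1 h2]].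
exists (fun i => if (i <= d)%N then C i else Z); split=> i hi.
  case: ifP => [/h1[irr sub]|_]; split=> // p /sub/YZ //.
rewrite -ltnS hi; case: ltnP => hid; first exact: h2.
have [_ sub] := h1 i hi; split=> [p /sub/YZ //|ZC].
by apply: nZY => p /ZC/sub.
Qed.

(** A linear form l that vanishes on no component of Z is chosen first.  If the section
    by l contains a chain of length d, its top lies in a component of Z, and this component
    prolongs the chain, being different from the top since l does not vanish on it.  If
    not, induction provides d forms for the section. *)
Lemma chain_or_forms Z d : zclosed Z -> has_chain Z d \/
  exists fs : seq {mpoly K[m]}, [/\ size fs = d, forall f, f \in fs -> f \is 1.-homog &
    forall p, Z p -> ~ (forall f, f \in fs -> vanishes_at f p)].
Proof.
elim: d Z => [|d IH] Z cZ.
  have [[p Zp]|nZ] := pselect (exists p, Z p); last first.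
    by right; exists [::]; split=> // p Zp; case: nZ; exists p.
  left; exists (fun _ => zclosure (fun q => q = p)); split=> // _ _; split.
    exact: zclosure_point_irreducible.
  by apply: zclosure_min => // _ ->.
have [s cs] := components_exist cZ; have [l l1 hl] := form_cutting_components cs.
have [ch|[fs [sf hf nf]]] := IH _ (zclosedI cZ (zclosed_vanishes l)); last first.
  right; exists (l :: fs); split=> [|f|p Zp h]; first by rewrite /= sf.
    by rewrite inE => /orP[/eqP ->|/hf].
  apply: (nf p) => [|f ff]; last by apply: h; rewrite inE ff orbT.
  by split=> //; apply: h; apply: mem_head.
left; have [hs cov] := cs.
have [C [h1 h2]] := ch; have [irrC subC] := h1 d (leqnn d).
have [||i hi sub] := irreducible_cover irrC (s := s).
- by move=> i /hs[[]].
- by move=> p /subC[/cov].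
have [irr subZ] := hs i hi.
apply: (has_chain_sub subZ).
apply: (has_chain_extend (Y := C d) irr sub) => [h|].
  by apply: (hl i hi) => p /h/subC[].
exists C; split=> // j hj; have [irrj _] := h1 j hj; split=> //.
move: h1 h2 hj {IH ch irrC subC sub}; elim: d => [|d IH] h1 h2; first by rewrite leqn0 => /eqP ->.
rewrite leq_eqVlt => /orP[/eqP -> //|hj].
have := IH (fun i hi => h1 i (leqW hi)) (fun i hi => h2 i (leqW hi)) hj.
by move=> sub p /sub; apply: (h2 d (ltnSn d)).1.
Qed.

End Components.

Lemma pihomogM_homog (K : comNzRingType) n d e (b q : {mpoly K[n]}) :
  q \is e.-homog -> pihomog mdeg (d + e) (b * q) = pihomog mdeg d b * q.
Proof.
move=> hq; pose k := maxn (msize b) d.+1.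
have hb := pihomog_sumE (leq_maxl (msize b) d.+1).
rewrite [in LHS]hb mulr_suml raddf_sum /= (bigD1 (Ordinal (leq_maxr (msize b) d.+1))) //=.
rewrite pihomog_dE ?dhomogM ?pihomogP // big1 ?addr0 // => i hi.
rewrite (pihomog_ne0 (d := (i + e)%N)) ?dhomogM ?pihomogP // eqn_add2r.
by rewrite -val_eqE in hi.
Qed.

(** Powers of l up to the lowest one with a nonzero coefficient can be cancelled. *)
Lemma prime_factor_lowest (K : fieldType) m (P : {mpoly K[m]} -> Prop) l r (c : 'I_r -> K)
    (u : nat -> {mpoly K[m]}) : is_prime P -> ~ P l ->
    P (\sum_(i < r) c i *: (u i * l ^+ i)) -> (exists i, c i != 0) ->
  exists a b (i : 'I_r), a != 0 /\ P (a *: u i + l * b).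
Proof.
move=> hP nPl; elim: r c u => [|r IH] c u; first by move=> _ [[]].
rewrite big_ord_recl expr0 mulr1.
have -> : \sum_(i < r) c (lift ord0 i) *: (u (lift ord0 i) * l ^+ lift ord0 i)
  = l * \sum_(i < r) c (lift ord0 i) *: (u i.+1 * l ^+ i).
  rewrite mulr_sumr; apply: eq_bigr => i _.
  by rewrite exprS -scalerAr mulrCA.
set S := \sum_(i < r) _ => Ps [i ci].
have [c0|c0] := eqVneq (c ord0) 0; last by exists (c ord0), S, ord0.
move: Ps; rewrite c0 scale0r add0r => /(primeM hP)[//|/(IH (fun i => c (lift ord0 i)) (fun i => u i.+1))[]].
  case: (unliftP ord0 i) ci => [j ->|->]; first by exists j.
  by rewrite c0 eqxx.
by move=> a [b [j [a0 h]]]; exists a, b, (lift ord0 j).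
Qed.

Section FormOnCurve.
Variables (K : closedFieldType) (m : nat).
Implicit Types (p : proj K m) (Y Z : proj K m -> Prop) (f g l q : {mpoly K[m]}).

Lemma cone_zero Y (a : 'I_m -> K) : zclosed Y ->
    (forall f, vanishing_ideal Y f -> f.@[a] = 0) ->
  (forall i, a i = 0) \/ exists2 p, Y p & val p = <[\row_i a i]>%VS.
Proof.
move=> cY ha; have [a0|a0] := eqVneq (\row_i a i) 0.
  by left=> i; move/rowP/(_ i): a0; rewrite !mxE.
right; have [p hp] := proj_of a0; exists p => //; apply: (zclosedP cY) => f hf.
apply/vanishes_at_pihomog => d; apply/(vanishes_at_homog hp (pihomogP _ _ _)).
rewrite -[RHS](ha _ (vanishing_ideal_pihomog d hf)).
by apply: meval_eq => i; rewrite mxE.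
Qed.

(** When q has no zero on Y, the Nullstellensatz puts a power of each variable into
    I(Y) + (q), hence every monomial of large degree. *)
Lemma irrelevant_power Y q : zclosed Y -> (forall p, Y p -> ~ vanishes_at q p) ->
    (exists e, q \is e.-homog) ->
  exists k, forall D f, (k < D)%N -> f \is D.-homog ->
    exists b, vanishing_ideal Y (f - b * q).
Proof.
move=> cY hq [e qe]; pose J := ideal_add (vanishing_ideal Y) q.
have iY := vanishing_ideal_ideal Y.
have iJ : is_ideal J by apply: ideal_add_ideal.
have rX (i : 'I_m) : radical J 'X_i.
  apply: (nullstellensatz iJ) => a ha; rewrite mevalXU.
  have [|//|[p Yp pa]] := @cone_zero Y a cY.
    by move=> f hf; apply: ha; apply: ideal_add_sub.
  case: (hq p Yp); apply/(vanishes_at_homog pa qe).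
  rewrite -[RHS](ha q); last exact: ideal_add_mem.
  by apply: meval_eq => j; rewrite mxE.
have [k hk] := choice rX; pose k0 := \max_i k i.
have hk0 i j : (k0 < j)%N -> J ('X_i ^+ j).
  move=> hj; have /subnK <- : (k i <= j)%N by apply: leq_trans (ltnW hj); apply: leq_bigmax.
  by rewrite exprD; apply: (idealM iJ).
exists (m * k0)%N => D f hD /dhomogP hf; rewrite [f]mpolyE.
apply: (ideal_sum iJ) => mm _; rewrite -mul_mpolyC.
have [hm|/memN_msupp_eq0 ->] := boolP (mm \in msupp f); last first.
  by rewrite mpolyC0 mul0r; apply: ideal0.
apply: (idealM iJ); have [i hi] : exists i, (k0 < mm i)%N.
  apply: contrapT => /forallNP no; move: hD; rewrite -(hf _ hm) ltnNge /= mdegE.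
  rewrite -[X in (_ <= X * _)%N]card_ord -sum_nat_const leq_sum // => i _.
  by rewrite leqNgt; apply/negP.
rewrite mpolyXE_id (bigD1 i) //=; apply: (idealMr iJ); exact: hk0.
Qed.

(** On Y, the homogeneous coordinate ring is finite over the polynomials in q.
    Concretely, modulo I(Y) every form of degree e (k + 1) + e j is q^j times a form of the
    fixed degree D0 = e (k + 1).  More products q^a l^(e i) of one common degree than the
    dimension of the space of forms of degree D0 are therefore dependent modulo I(Y).
    Cancelling the lowest power of l leaves a power of q in I(Y) + (l^e): a zero of l on Y
    would be a zero of q. *)
Lemma irreducible_no_zero Y q l e : zirreducible Y -> (0 < e)%N -> q \is e.-homog ->
    (forall p, Y p -> ~ vanishes_at q p) -> l \is 1.-homog -> ~ vanishing_ideal Y l ->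
  forall p, Y p -> ~ vanishes_at l p.
Proof.
move=> irrY e0 qe hq l1 nl.
have [cY _ _] := irrY; have hP := vanishing_ideal_prime irrY.
have iP := prime_ideal hP.
have [k hk] := irrelevant_power cY hq (ex_intro _ e qe).
(* The quotient by q can be taken homogeneous. *)
have hk' D f : (k < D + e)%N -> f \is (D + e).-homog ->
    exists2 b, b \is D.-homog & vanishing_ideal Y (f - q * b).
  move=> hD hf; have [b hb] := hk _ _ hD hf; exists (pihomog mdeg D b); first exact: pihomogP.
  have := vanishing_ideal_pihomog (D + e) hb.
  by rewrite raddfB /= pihomogM_homog // pihomog_dE // mulrC.
(* A multiple of e, large enough for the division by q to be possible. *)
pose D0 := (e * k.+1)%N.
have kD0 : (k < D0)%N by apply: leq_pmull.
have red j f : f \is (D0 + e * j).-homog ->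
    exists2 a, a \is D0.-homog & vanishing_ideal Y (f - q ^+ j * a).
  elim: j f => [|j IH] f.
    rewrite muln0 addn0 => hf; exists f => //.
    by rewrite expr0 mul1r subrr; apply: ideal0 iP.
  rewrite mulnS addnCA addnC => hf.
  have [|b hb fb] := hk' _ _ _ hf; first by rewrite -addnA ltn_addr.
  have [a ha ba] := IH b hb; exists a => //.
  rewrite -(subrKA (q * b)) exprS -mulrA -mulrBr; apply: (idealD iP) => //.
  exact: (idealM iP).
case: m q l Y irrY qe hq l1 nl cY hP iP hk hk' red => [|m'] q' l' Y' irrY qe hq l1 nl cY hP iP hk hk' red.
  move=> p; have [v /eqP[]] := proj_gen p; exact: thinmx0.
pose r := (\dim {: dhomog m'.+1 K D0}).+1.
have hu (i : 'I_r) : exists a : dhomog m'.+1 K D0,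
    vanishing_ideal Y' (q' ^+ (k.+1 + r - i) * (l' ^+ e) ^+ i - q' ^+ r * mpoly_of_dhomog a).
  have [|a ha hua] := red r (q' ^+ (k.+1 + r - i) * (l' ^+ e) ^+ i).
    rewrite -exprM (_ : D0 + e * r = e * (k.+1 + r - i) + 1 * (e * i))%N.
      by apply: dhomogM; apply: dhomogMn.
    rewrite mul1n -!mulnDr subnK // ltnW //.
    by apply: leq_trans (ltn_ord i) _; apply: leq_addl.
  by exists (DHomog ha).
have [a ha] := choice hu.
(* More forms a_i than the dimension of their space are dependent. *)
have [c c0 [i0 ci0]] : exists2 c : 'I_r -> K, \sum_(i < r) c i *: a i = 0 &
    exists i, c i != 0.
  apply: contrapT => no.
  have : free [tuple a i | i < r].
    apply/freeP => c hc i; apply/eqP; apply: contrapT => /negP ci; apply: no.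
    exists c; last by exists i.
    by rewrite -[RHS]hc; apply: eq_bigr => j _; rewrite -tnth_nth tnth_mktuple.
  rewrite /free size_tuple => /eqP h; have := dimvS (subvf <<[tuple a i | i < r]>>%VS).
  by rewrite h ltnn.
have [|||a' [b [i [a0 hab]]]] := @prime_factor_lowest K m'.+1 _ (l' ^+ e) r c (fun i => q' ^+ (k.+1 + r - i)) hP.
- by move/(prime_exp hP).
- have : vanishing_ideal Y' (q' ^+ r * mpoly_of_dhomog (\sum_(i < r) c i *: a i)).
    by rewrite c0; apply: (idealM iP); apply: ideal0 iP.
  rewrite raddf_sum /= mulr_sumr; apply: (ideal_subl iP).
  rewrite -sumrB; apply: (ideal_sum iP) => i _.
  rewrite /= -scalerAr -scalerBr -mul_mpolyC; apply: (idealM iP); exact: ha.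
- by exists i0.
move=> p Yp lp; apply: (hq p Yp).
have hp := vanishes_at_prime p; have ip := prime_ideal hp.
apply: (prime_exp (k := (k.+1 + r - i)%N) hp).
rewrite -[_ ^+ _]scale1r -(mulVf a0) -scalerA -mul_mpolyC; apply: (idealM ip).
rewrite -(addrK (l' ^+ e * b) (a' *: _)); apply: (idealB ip); first exact: hab.
by rewrite -(prednK e0) exprS -mulrA; apply: (idealMr ip).
Qed.

End FormOnCurve.

(** * Counting independent polynomials *)

(** A chain of ideals in which each one contains a nonzerodivisor modulo the previous
    one; both regular sequences and chains of irreducible closed sets give towers, and their
    lengths are bounded by the number of variables.  [tower_weaken] lets the bottom ideal
    shrink, which is how the two kinds of towers are put together. *)
Inductive tower (A : comNzRingType) : (A -> Prop) -> nat -> Prop :=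
| tower_base I : is_ideal I -> ~ I 1 -> tower I 0
| tower_step I J g t : is_ideal I -> is_ideal J -> (forall x, I x -> J x) -> J g ->
    (forall x, I (g * x) -> I x) -> tower J t -> tower I t.+1
| tower_weaken (I J : A -> Prop) t : (forall x, I x -> J x) -> tower J t -> tower I t.

Section Counting.
Variables (K : fieldType) (n : nat).
Implicit Types (I : {mpoly K[n]} -> Prop).

Definition independent_mod I (J : finType) (b : J -> {mpoly K[n]}) :=
  forall c : J -> K, I (\sum_j c j *: b j) -> forall j, c j = 0.

(** If b is independent modulo I', then the g^i b_j are independent modulo I: a relation
    read modulo I' involves only the terms with i = 0, so these vanish, and the remaining
    relation can be divided by g. *)
Lemma independent_mul I I' g (J : finType) (b : J -> {mpoly K[n]}) k :
    is_ideal I -> is_ideal I' -> (forall x, I x -> I' x) -> I' g ->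
    (forall x, I (g * x) -> I x) -> independent_mod I' b ->
  independent_mod I (fun ij : 'I_k * J => g ^+ ij.1 * b ij.2).
Proof.
move=> hI hI' sub I'g nzd ind c.
have -> : \sum_ij c ij *: (g ^+ ij.1 * b ij.2)
    = \sum_(i < k) g ^+ i * \sum_j c (i, j) *: b j.
  transitivity (\sum_(p : 'I_k * J) c (p.1, p.2) *: (g ^+ p.1 * b p.2)).
    by apply: eq_bigr => -[].
  rewrite -(pair_bigA _ (fun (i : 'I_k) j => c (i, j) *: (g ^+ i * b j))) /=.
  apply: eq_bigr => i _; rewrite mulr_sumr; apply: eq_bigr => j _.
  by rewrite scalerAr.
elim: k c => [|k IH] c; first by move=> _ [[]].
rewrite big_ord_recl expr0 mul1r => hc.
have tailE : \sum_(i < k) g ^+ lift ord0 i * \sum_j c (lift ord0 i, j) *: b j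
   = g * \sum_(i < k) g ^+ i * \sum_j c (lift ord0 i, j) *: b j.
  by rewrite mulr_sumr; apply: eq_bigr => i _; rewrite mulrA -exprS.
have c0 : forall j, c (ord0, j) = 0.
  apply: (ind (fun j => c (ord0, j))); rewrite -[X in I' X](addrK (\sum_(i < k) g ^+ lift ord0 i * \sum_j c (lift ord0 i, j) *: b j)).
  apply: (idealB hI'); first exact: sub.
  by rewrite tailE; apply: (idealMr hI').
move: hc; rewrite big1 ?add0r => [|j _]; last by rewrite c0 scale0r.
rewrite tailE => /nzd/(IH (fun ij => c (lift ord0 ij.1, ij.2))) hc [i j].
by case: (unliftP ord0 i) => [i' ->|-> //]; apply: (hc (i', j)).
Qed.

Lemma msizeM_pred (f g : {mpoly K[n]}) : (msize (f * g) <= (msize f + msize g).-1)%N.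
Proof.
have [->|f0] := eqVneq f 0; first by rewrite mul0r msize0.
have [->|g0] := eqVneq g 0; first by rewrite mulr0 msize0.
by rewrite msizeM.
Qed.

Lemma msize_exp_le (g : {mpoly K[n]}) i : (msize (g ^+ i) <= (i * msize g).+1)%N.
Proof.
elim: i => [|i IH]; first by rewrite expr0 msize1.
rewrite exprS mulSn; apply: leq_trans (msizeM_pred _ _) _; lia.
Qed.

(** Each storey multiplies the number of independent polynomials by k and adds only a
    multiple of k to their degrees. *)
Lemma tower_independent I t : tower I t -> exists E, forall k,
  exists (J : finType) (b : J -> {mpoly K[n]}),
    [/\ independent_mod I b, #|J| = (k ^ t)%N & forall j, (msize (b j) <= E * k.+1)%N].
Proof.
elim=> {I t} [I hI nI|I J g t hI hJ IJ Jg nzd _ [E IH]|I J t IJ _ [E IH]].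
- exists 1%N => k; exists unit, (fun=> 1); split=> [c|//|_].
  + rewrite (big_pred1 tt) => [hc []|[]//]; apply: contrapT => /eqP c0; apply: nI.
    rewrite -[1]scale1r -(mulVf c0) -scalerA -mul_mpolyC; exact: (idealM hI).
  + by rewrite card_unit.
  + by rewrite msize1 mul1n.
- exists (msize g + 1 + E)%N => k; have [J' [b [ind card hb]]] := IH k.
  exists ('I_k * J')%type, (fun ij : 'I_k * J' => g ^+ ij.1 * b ij.2); split.
  + exact: independent_mul nzd ind.
  + by rewrite card_prod card_ord card expnS.
  + move=> [i j] /=; apply: leq_trans (msizeM_pred _ _) _.
    have h1 := msize_exp_le g i; have h2 := hb j; have h3 := ltn_ord i.
    have h4 : (i * msize g <= k * msize g)%N by rewrite leq_mul2r ltnW ?orbT.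
    move: h1 h2 h4; move: (msize (g ^+ i)) (msize (b j)) (msize g) => x y z.
    nia.
- exists E => k; have [J' [b [ind card hb]]] := IH k.
  by exists J', b; split=> // c /IJ; apply: ind.
Qed.

(** A polynomial of degree at most D is determined by its (D + 1)^n coefficients with
    all exponents at most D. *)
Lemma independent_card (J : finType) (b : J -> {mpoly K[n]}) D :
    independent_mod (fun f => f = 0) b -> (forall j, (msize (b j) <= D.+1)%N) ->
  (#|J| <= D.+1 ^ n)%N.
Proof.
move=> ind hb; rewrite leqNgt; apply/negP => lt.
pose T := {ffun 'I_n -> 'I_D.+1}.
have cT : #|T| = (D.+1 ^ n)%N by rewrite card_ffun !card_ord.
pose mon (e : T) : 'X_{1..n} := [multinom (e i : nat) | i < n].
pose M := \matrix_(i < #|J|, j < #|T|) (b (enum_val i))@_(mon (enum_val j)).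
have : kermx M != 0.
  rewrite -mxrank_eq0 mxrank_ker subn_eq0 -ltnNge.
  by apply: leq_ltn_trans (rank_leq_col M) _; rewrite cT.
case/rowV0Pn => v /sub_kermxP vM /eqP[]; apply/rowP => i; rewrite mxE.
rewrite -(enum_valK i); apply: (ind (fun j => v 0 (enum_rank j))).
apply/mpolyP => m; rewrite mcoeff0 raddf_sum /=.
have [hm|hm] := boolP [forall i, (m i < D.+1)%N]; last first.
  apply: big1 => j _; rewrite mcoeffZ; case/forallPn: hm => k; rewrite -leqNgt => hk.
  rewrite (memN_msupp_eq0 (p := b j)) ?mulr0 //; apply: msize_mdeg_ge.
  apply: leq_trans (hb j) (leq_trans hk _).
  by rewrite mdegE (bigD1 k) //= leq_addr.
pose e : T := [ffun i => inord (m i)].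
have me : mon e = m by apply/mnmP => k; rewrite mnmE ffunE inordK // (forallP hm).
move/rowP/(_ (enum_rank e)): vM; rewrite !mxE => e0; rewrite -[RHS]e0.
rewrite (reindex (@enum_val J predT)) /=; last first.
  by exists (@enum_rank J) => j _; rewrite ?enum_valK ?enum_rankK.
by apply: eq_bigr => j _; rewrite mcoeffZ mxE enum_valK enum_rankK me.
Qed.

End Counting.

(** At k = C^n + 2 an exponent s > n would be too large. *)
Lemma power_growth C s n :
  (forall k, (0 < k)%N -> k ^ s <= (C * k) ^ n)%N -> (s <= n)%N.
Proof.
move=> h; rewrite leqNgt; apply/negP => ns.
pose k := (C ^ n).+2.
have := h k isT; rewrite expnMn -(subnK (ltnW ns)) expnD leq_mul2r.
rewrite expn_eq0 /= => /(leq_trans _) hk.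
have : (k <= C ^ n)%N.
  by apply: hk; rewrite -[X in (X <= _)%N]expn1 leq_exp2l // subn_gt0.
by rewrite ltnNge leqnSn.
Qed.

Lemma msize_subst (K : fieldType) m r (h : 'I_m -> {mpoly K[r]}) (f : {mpoly K[m]}) H :
  (forall i, (msize (h i) <= H)%N) -> (msize (mmap (@mpolyC r K) h f) <= (msize f * H).+1)%N.
Proof.
move=> hH; rewrite /mmap; apply: leq_trans (msize_sum _ _ _) _.
rewrite big_seq; elim/big_ind: _ => // [x y hx hy|mm hm]; first by rewrite geq_max hx.
rewrite mul_mpolyC; apply: leq_trans (msizeZ_le _ _) _.
have : (msize (mmap1 h mm) <= (mdeg mm * H).+1)%N.
  rewrite mdegE big_distrl /= /mmap1; elim/big_rec2: _ => [|i x y _ IH]; first by rewrite msize1.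
  apply: leq_trans (msizeM_pred _ _) _.
  have h1 := msize_exp_le (h i) (mm i); have h2 := hH i.
  have h3 : (mm i * msize (h i) <= mm i * H)%N by rewrite leq_mul2l h2 orbT.
  move: h1 h3 IH; move: (msize (h i ^+ mm i)) (msize _) (_ * _)%N (_ * H)%N => a b' c d.
  lia.
move/leq_trans; apply; rewrite ltnS leq_mul2r ltnW ?orbT //; exact: msize_mdeg_lt.
Qed.

(** The substitution h detects membership in I, so polynomials independent modulo I
    stay independent after it; in r variables there is room for only O(k^r) of them. *)
Lemma tower_bound (K : fieldType) m r (h : 'I_m -> {mpoly K[r]}) I t :
  (forall f, mmap (@mpolyC r K) h f = 0 -> I f) -> tower I t -> (t <= r)%N.
Proof.
move=> hI /tower_independent[E hE].
pose H := \max_i msize (h i).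
have hH i : (msize (h i) <= H)%N by apply: leq_bigmax.
apply: (@power_growth (2 * E * H).+1) => k k0.
have [J [b [ind <- hb]]] := hE k.
have := @independent_card K r J (fun j => mmap (@mpolyC r K) h (b j)) (E * k.+1 * H).
move=> card; apply: leq_trans (card _ _) _.
- move=> c hc; apply: ind; apply: hI; rewrite -[RHS]hc raddf_sum /=.
  by apply: eq_bigr => j _; rewrite mmapZ mul_mpolyC.
- move=> j; apply: leq_trans (msize_subst _ hH) _.
  by rewrite ltnS leq_mul2r hb orbT.
have le : ((E * k.+1 * H).+1 <= (2 * E * H).+1 * k)%N.
  have : (E * H * k.+1 <= E * H * (2 * k))%N by rewrite leq_mul2l; apply/orP; right; lia.
  move=> h1; have -> : (E * k.+1 * H = E * H * k.+1)%N by lia.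
  have -> : ((2 * E * H).+1 * k = E * H * (2 * k) + k)%N by lia.
  by lia.
by have [r0|r0] := posnP r; [rewrite r0 !expn0 | rewrite leq_exp2r].
Qed.

Lemma tower_zero_bound (K : fieldType) n t :
  tower (fun f : {mpoly K[n]} => f = 0) t -> (t <= n)%N.
Proof.
move=> ht; apply: (tower_bound (h := fun i => 'X_i) _ ht) => f <-.
apply: (mpoly_rmorph_ext (f := idfun) (g := mmap (@mpolyC n K) (fun i => 'X_i))) => [c|i] /=.
  by rewrite mmapC.
by rewrite mmapX mmap1U.
Qed.

(** * Regular sequences of forms *)

Definition nzd_mod (A : comNzRingType) (I : A -> Prop) (a : A) :=
  forall x, I (a * x) -> I x.

Section Regular.
Variable A : comNzRingType.
Implicit Types (s t : seq A) (a b : A).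

Lemma regular_rcons s a :
  regular_seq (rcons s a) <-> regular_seq s /\ nzd_mod (ideal_of s) a.
Proof.
have take_s i : (i <= size s)%N -> take i (rcons s a) = take i s.
  by move=> hi; rewrite -cats1 takel_cat.
split=> [h|[hs ha] i].
  split=> [i hi f|f].
    by have := h i; rewrite size_rcons nth_rcons hi take_s ?(ltnW hi) //; apply; rewrite ltnW.
  have := h (size s); rewrite size_rcons nth_rcons ltnn eqxx take_s // take_size.
  by apply.
rewrite size_rcons ltnS nth_rcons => hi; rewrite take_s //.
move: hi; rewrite leq_eqVlt => /orP[/eqP ->|hi]; last by rewrite hi; apply: hs.
by rewrite ltnn eqxx take_size.
Qed.

Lemma regular_prefix s t : regular_seq (s ++ t) -> regular_seq s.
Proof.
elim/last_ind: t => [|t a IH]; first by rewrite cats0.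
by rewrite -rcons_cat => /regular_rcons[/IH].
Qed.

Lemma ideal_of_eq s t : s =i t -> forall x, ideal_of s x <-> ideal_of t x.
Proof. by move=> st x; split; apply: ideal_of_sub => y; rewrite st. Qed.

Lemma nzd_mod_iff I J a : (forall x, I x <-> J x) -> nzd_mod I a -> nzd_mod J a.
Proof. by move=> IJ h x /IJ/h/IJ. Qed.

Lemma ideal_of_rcons s a x : ideal_of (rcons s a) x <-> exists b, ideal_of s (x - b * a).
Proof.
rewrite -ideal_of_cons; apply: ideal_of_eq => y; by rewrite mem_rcons.
Qed.

Lemma nzd_mod_swap s a b :
  nzd_mod (ideal_of s) a -> nzd_mod (ideal_of (rcons s a)) b ->
  nzd_mod (ideal_of (rcons s b)) a.
Proof.
move=> ha hb u; have iI := ideal_of_is_ideal s.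
move/ideal_of_rcons => [c hc].
have /hb/ideal_of_rcons[c' hc'] : ideal_of (rcons s a) (b * c).
  apply/ideal_of_rcons; exists u; rewrite -opprB mulrC [b * c]mulrC.
  exact: (idealN iI).
apply/ideal_of_rcons; exists c'; apply: ha.
have -> : a * (u - c' * b) = (a * u - c * b) + b * (c - c' * a).
  by rewrite !mulrBr [c * b]mulrC subrKA mulrCA !mulrA [b * c']mulrC mulrAC.
by apply: (idealD iI) => //; apply: (idealM iI).
Qed.

(** If b u lies in I, then so does a^k u, and a can be cancelled. *)
Lemma nzd_mod_exchange I a b k : is_ideal I -> nzd_mod I a ->
  ideal_add I b (a ^+ k) -> nzd_mod I b.
Proof.
move=> iI ha [c hc] u hu.
have : I (a ^+ k * u).
  rewrite -(subrK (c * b * u) (_ * u)) -mulrBl -mulrA.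
  by apply: (idealD iI); [apply: (idealMr iI)|apply: (idealM iI)].
elim: k {hc} => [|k IH]; first by rewrite mul1r.
by rewrite exprS -mulrA => /ha/IH.
Qed.

(** The ideals generated by the initial segments of s form a tower, which continues with
    any tower that starts above the ideal generated by s. *)
Lemma regular_tower s J (t : nat) : regular_seq s -> is_ideal J ->
  (forall x, ideal_of s x -> J x) -> tower J t -> tower (fun x : A => x = 0) (size s + t).
Proof.
elim/last_ind: s J t => [|s a IH] J t.
  move=> _ _ sub; apply: tower_weaken => x x0; apply: sub; exact/ideal_of_nil.
move/regular_rcons=> [hs ha] iJ sub ht.
rewrite size_rcons addSnnS; apply: (IH (ideal_of s)) => //.
  exact: ideal_of_is_ideal.
apply: (tower_step (J := J) (g := a)) => //.
- exact: ideal_of_is_ideal.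
- by move=> x hx; apply: sub; apply: ideal_of_sub hx => y; rewrite mem_rcons inE orbC => ->.
- by apply: sub; apply: mem_ideal_of; rewrite mem_rcons mem_head.
Qed.

End Regular.

Lemma regular_map (A B : comNzRingType) (f : {rmorphism A -> B}) (g : {rmorphism B -> A}) s :
  cancel f g -> cancel g f -> regular_seq s -> regular_seq (map f s).
Proof.
move=> fK gK hs i; rewrite size_map => hi x.
rewrite (nth_map 0) // -map_take => /(ideal_of_map g).
rewrite -map_comp (eq_map (g := id)) => [|y /=]; last by rewrite fK.
rewrite map_id rmorphM fK => /(hs i hi) /(ideal_of_map f); by rewrite gK.
Qed.

Lemma pihomogM_small (K : comNzRingType) n d e (b q : {mpoly K[n]}) :
  (d < e)%N -> q \is e.-homog -> pihomog mdeg d (b * q) = 0.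
Proof.
move=> de hq; rewrite [in LHS](pihomog_sumE (leqnn (msize b))) mulr_suml raddf_sum /=.
rewrite big1 // => i _; rewrite (pihomog_ne0 (d := (i + e)%N)) ?dhomogM ?pihomogP //.
by rewrite gtn_eqF // ltn_addl.
Qed.

Section Graded.
Variables (K : comNzRingType) (n : nat).
Implicit Types (s t : seq {mpoly K[n]}) (I : {mpoly K[n]} -> Prop).

Definition graded I := forall f d, I f -> I (pihomog mdeg d f).
Definition form (f : {mpoly K[n]}) := exists2 e, (0 < e)%N & f \is e.-homog.

Lemma graded_ideal_of s : (forall f, f \in s -> form f) -> graded (ideal_of s).
Proof.
move=> hs f d; elim: s hs f => [|a s IH] hs f.
  by move=> /ideal_of_nil ->; rewrite raddf0; apply/ideal_of_nil.
move/ideal_of_cons => [b hb]; apply/ideal_of_cons.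
have hs' g : g \in s -> form g by move=> gs; apply: hs; rewrite inE gs orbT.
have hsb := IH hs' _ hb; rewrite raddfB /= in hsb.
have [e e0 ae] := hs a (mem_head _ _).
have [de|ed] := ltnP d e.
  by exists 0; rewrite mul0r; rewrite (pihomogM_small _ de ae) in hsb.
exists (pihomog mdeg (d - e)%N b); by rewrite -(pihomogM_homog _ _ ae) subnK.
Qed.

Lemma graded_comp I f : is_ideal I -> (forall d, I (pihomog mdeg d f)) -> I f.
Proof.
by move=> iI hf; rewrite (pihomog_sumE (leqnn (msize f))); apply: (ideal_sum iI).
Qed.

(** If b u is in I = (s), then u is in I + (a), because b is a nonzerodivisor modulo it;
    writing u = a v modulo I, again b v is in I.  So u is in I + (a^k) for every k, and for
    degree reasons in I. *)
Lemma nzd_mod_swap_graded s a b : (forall f, f \in s -> form f) -> form a ->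
  nzd_mod (ideal_of s) a -> nzd_mod (ideal_of (rcons s a)) b -> nzd_mod (ideal_of s) b.
Proof.
move=> hs [e e0 ae] ha hb u hu; have iI := ideal_of_is_ideal s.
have step k : exists2 v, ideal_of s (u - a ^+ k * v) & ideal_of s (b * v).
  elim: k => [|k [v hv bv]].
    by exists u => //; rewrite mul1r subrr; apply: ideal0 iI.
  have /hb/ideal_of_rcons[w hw] : ideal_of (rcons s a) (b * v).
    by apply: ideal_of_sub bv => y; rewrite mem_rcons inE orbC => ->.
  exists w.
    rewrite -(subrKA (a ^+ k * v)) exprSr -mulrA -mulrBr [a * w]mulrC.
    by apply: (idealD iI) => //; apply: (idealM iI).
  apply: ha; rewrite mulrCA [a * w]mulrC.
  rewrite -[w * a](subKr v) mulrBr; apply: (idealB iI) => //; exact: (idealM iI).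
apply: (graded_comp iI) => d; have [v hv _] := step d.+1.
have := graded_ideal_of hs d hv.
rewrite raddfB /= [a ^+ _ * v]mulrC (pihomogM_small _ _ (dhomogMn d.+1 ae)) ?subr0 //.
exact: leq_pmull.
Qed.

Lemma regular_swap s a b t : (forall f, f \in s -> form f) -> form a ->
  regular_seq (s ++ [:: a, b & t]) -> regular_seq (s ++ [:: b, a & t]).
Proof.
move=> hs fa; elim/last_ind: t => [|t c IH].
  have e x y : s ++ [:: x; y] = rcons (rcons s x) y by rewrite -!cats1 -catA.
  rewrite !e => /regular_rcons[/regular_rcons[rs ha] hb].
  apply/regular_rcons; split; last exact: nzd_mod_swap hb.
  by apply/regular_rcons; split=> //; apply: nzd_mod_swap_graded hb.
rewrite -!rcons_cons -!rcons_cat => /regular_rcons[/IH h1 h2].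
apply/regular_rcons; split=> //; apply: nzd_mod_iff h2; apply: ideal_of_eq => x.
by rewrite !mem_cat !inE orbCA ![(x == a) || _]orbCA.
Qed.

Lemma regular_move s a t : (forall f, f \in s ++ a :: t -> form f) ->
  regular_seq (s ++ a :: t) <-> regular_seq (s ++ rcons t a).
Proof.
elim: t s => [|b t IH] s hs //=.
rewrite -[s ++ b :: _]cat_rcons -IH; last first.
  by move=> f; rewrite cat_rcons => hf; apply: hs; move: hf; rewrite !mem_cat !inE => /orP[->|/or3P[]->]; rewrite ?orbT.
have hs' f : f \in s -> form f by move=> fs; apply: hs; rewrite mem_cat fs.
rewrite cat_rcons; split; apply: regular_swap => //; apply: hs.
  by rewrite mem_cat mem_head orbT.
by rewrite mem_cat !inE eqxx !orbT.
Qed.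

End Graded.

(** * Forms without common zeros *)

Section Substitution.
Variable K : comNzRingType.

Definition msubst m r (h : 'I_m -> {mpoly K[r]}) : {mpoly K[m]} -> {mpoly K[r]} :=
  mmap (@mpolyC r K) h.
HB.instance Definition _ m r h := GRing.RMorphism.on (@msubst m r h).

Lemma msubstC m r (h : 'I_m -> {mpoly K[r]}) c : msubst h c%:MP = c%:MP.
Proof. exact: mmapC. Qed.

Lemma msubstX m r (h : 'I_m -> {mpoly K[r]}) i : msubst h 'X_i = h i.
Proof. by rewrite /msubst mmapX mmap1U. Qed.

Lemma msubstZ m r (h : 'I_m -> {mpoly K[r]}) c f : msubst h (c *: f) = c *: msubst h f.
Proof. by rewrite /msubst mmapZ mul_mpolyC. Qed.

Lemma meval_msubst m r (h : 'I_m -> {mpoly K[r]}) f a :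
  (msubst h f).@[a] = f.@[fun i => (h i).@[a]].
Proof.
apply: (mpoly_rmorph_ext (f := meval a \o msubst h)
  (g := meval (fun i => (h i).@[a]))) => [c|i] /=; first by rewrite msubstC !mevalC.
by rewrite msubstX mevalXU.
Qed.

Lemma msubst_comp m r k (h : 'I_m -> {mpoly K[r]}) (g : 'I_r -> {mpoly K[k]}) f :
  msubst g (msubst h f) = msubst (fun i => msubst g (h i)) f.
Proof.
apply: (mpoly_rmorph_ext (f := msubst g \o msubst h)
  (g := msubst (fun i => msubst g (h i)))) => [c|i] /=; first by rewrite !msubstC.
by rewrite !msubstX.
Qed.

Lemma msubst_eq m r (h g : 'I_m -> {mpoly K[r]}) f :
  h =1 g -> msubst h f = msubst g f.
Proof.
move=> hg; apply: (mpoly_rmorph_ext (f := msubst h) (g := msubst g)) => [c|i] /=.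
  by rewrite !msubstC.
by rewrite !msubstX.
Qed.

Lemma msubst_id m (h : 'I_m -> {mpoly K[m]}) f : (forall i, h i = 'X_i) -> msubst h f = f.
Proof.
move=> hX; apply: (mpoly_rmorph_ext (f := msubst h) (g := idfun)) => [c|i] /=.
  by rewrite msubstC.
by rewrite msubstX.
Qed.

Definition lin_subst m r (A : 'M[K]_(m, r)) : {mpoly K[m]} -> {mpoly K[r]} :=
  msubst (fun i => \sum_j A i j *: 'X_j).
HB.instance Definition _ m r A := GRing.RMorphism.on (@lin_subst m r A).

Lemma lin_subst_comp m r k (A : 'M[K]_(m, r)) (B : 'M[K]_(r, k)) f :
  lin_subst B (lin_subst A f) = lin_subst (A *m B) f.
Proof.
rewrite /lin_subst msubst_comp; apply: msubst_eq => i; rewrite raddf_sum /=.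
under eq_bigr => j _ do rewrite msubstZ msubstX scaler_sumr.
rewrite exchange_big /=; apply: eq_bigr => j _; rewrite mxE scaler_suml.
by apply: eq_bigr => l _; rewrite scalerA.
Qed.

Lemma lin_subst1 m f : lin_subst (1%:M : 'M[K]_m) f = f.
Proof.
apply: msubst_id => i; rewrite (bigD1 i) //= mxE eqxx scale1r big1 ?addr0 // => j ji.
by rewrite mxE eq_sym (negbTE ji) scale0r.
Qed.

Lemma meval_lin_subst m r (A : 'M[K]_(m, r)) f a :
  (lin_subst A f).@[a] = f.@[fun i => \sum_j A i j * a j].
Proof.
rewrite meval_msubst; apply: meval_eq => i; rewrite raddf_sum.
by apply: eq_bigr => j _; rewrite /= mevalZ mevalXU.
Qed.

Lemma linear_formE m (f : {mpoly K[m]}) : f \is 1.-homog ->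
  f = \sum_j f@_U_(j) *: 'X_j.
Proof.
move=> /dhomogP hf; apply/mpolyP => mm; rewrite raddf_sum /=.
have [hm|hm] := boolP (mdeg mm == 1%N).
  have /mdeg1P[i /eqP ->] := hm.
  rewrite (bigD1 i) //= mcoeffZ mcoeffX eqxx mulr1 big1 ?addr0 // => j ji.
  by rewrite mcoeffZ mcoeffX eq_mnm1 (negbTE ji) mulr0.
rewrite big1 => [|j _].
  by apply: memN_msupp_eq0; apply: contra hm => /hf ->.
rewrite mcoeffZ mcoeffX; case: eqP => [e|_]; last by rewrite mulr0.
by move: hm; rewrite -e mdeg1.
Qed.

Lemma X_homog r (k : 'I_r) : ('X_k : {mpoly K[r]}) \is 1.-homog.
Proof. by rewrite dhomogX /= mdeg1. Qed.

Lemma msubst_homog_form (r k e d : nat) (h : 'I_r -> {mpoly K[k]}) (f : {mpoly K[r]}) :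
  (forall i, h i \is e.-homog) -> f \is d.-homog -> msubst h f \is (e * d).-homog.
Proof.
move=> hh /dhomogP hf; rewrite /msubst /mmap big_seq; apply: rpred_sum => mm hm.
rewrite mul_mpolyC; apply: rpredZ; rewrite -(hf _ hm) /= mdegE big_distrr /=.
rewrite /mmap1; elim/big_rec2: _ => [|i x y _ IH]; first exact: dhomog1.
by apply: dhomogM => //; apply: dhomogMn.
Qed.

Lemma lin_subst_homog r k (A : 'M[K]_(r, k)) d (f : {mpoly K[r]}) :
  f \is d.-homog -> lin_subst A f \is d.-homog.
Proof.
move=> hf; rewrite -[d]mul1n; apply: msubst_homog_form => // i.
by apply: rpred_sum => j _; apply/rpredZ/X_homog.
Qed.

End Substitution.

Lemma regular_lin_subst (K : fieldType) m (A : 'M[K]_m) s : A \in unitmx ->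
  regular_seq s -> regular_seq (map (lin_subst A) s).
Proof.
move=> uA; apply: (@regular_map _ _ (lin_subst A) (lin_subst (invmx A))) => f /=.
  by rewrite lin_subst_comp mulmxV // lin_subst1.
by rewrite lin_subst_comp mulVmx // lin_subst1.
Qed.

(** Membership in (x_0, ..., x_(k-1)) is tested by setting these variables to 0. *)
Lemma regular_variables (K : fieldType) m :
  regular_seq [seq 'X_i : {mpoly K[m]} | i <- enum 'I_m].
Proof.
move=> k; rewrite size_map size_enum_ord => hk f.
set I := ideal_of _.
have iI : is_ideal I by apply: ideal_of_is_ideal.
pose h (i : 'I_m) : {mpoly K[m]} := if (i < k)%N then 0 else 'X_i.
have IX (i : 'I_m) : (i < k)%N -> I 'X_i.
  move=> ik; apply: mem_ideal_of; rewrite -map_take; apply: map_f.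
  by rewrite in_take ?mem_enum // index_enum_ord.
have Ih g : I g -> msubst h g = 0.
  apply: (ideal_of_min (I := fun g => msubst h g = 0)).
    exact: (preim_ideal (msubst h) (zero_ideal _)).
  move=> x; rewrite -map_take => /mapP [j]; rewrite in_take ?mem_enum // index_enum_ord.
  by move=> jk ->; rewrite msubstX /h jk.
have hI g : I (g - msubst h g).
  apply: (mpoly_rmorph_congr (f := idfun) (g := msubst h)) => // [c|i] /=.
    by rewrite msubstC.
  rewrite msubstX /h; case: ifP => [/IX|_]; first by rewrite subr0.
  by rewrite subrr; apply: ideal0.
rewrite (nth_map (Ordinal hk)) ?size_enum_ord // => /Ih.
rewrite (rmorphM (msubst h)) /= msubstX /h nth_enum_ord // ltnn => /eqP.
rewrite mulf_eq0 => /orP[/eqP X0|/eqP f0].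
  have /mpolyP/(_ U_(nth (Ordinal hk) (enum 'I_m) k)%MM)/eqP := X0.
  by rewrite mcoeffX eqxx mcoeff0 oner_eq0.
by rewrite -[f]subr0 -f0.
Qed.

Definition no_common_zero (K : comNzRingType) m (s : seq {mpoly K[m]}) :=
  forall a : 'I_m -> K, (forall f, f \in s -> f.@[a] = 0) -> forall i, a i = 0.

(** Linear forms without common zero are the images of the variables under an
    invertible linear substitution. *)
Lemma regular_linear_forms (K : fieldType) m (ls : seq {mpoly K[m]}) : size ls = m ->
  (forall l, l \in ls -> l \is 1.-homog) -> no_common_zero ls -> regular_seq ls.
Proof.
move=> sl l1 nz; pose A := \matrix_(i < m, j < m) (ls`_i)@_U_(j).
have lE (i : 'I_m) : ls`_i = \sum_j A i j *: 'X_j.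
  under eq_bigr do rewrite mxE; apply: linear_formE; apply: l1; apply: mem_nth.
  by rewrite sl.
have uA : A \in unitmx.
  rewrite -unitmx_tr -row_free_unit -kermx_eq0; apply/rowV0P => v /sub_kermxP hv.
  apply/rowP => i; rewrite mxE; apply: nz => f fs; rewrite -(nth_index 0 fs).
  have hj : (index f ls < m)%N by rewrite -[X in (_ < X)%N]sl index_mem.
  rewrite (lE (Ordinal hj)) raddf_sum /=; move/rowP/(_ (Ordinal hj)): hv; rewrite !mxE => e0.
  by rewrite -[RHS]e0; apply: eq_bigr => k _; rewrite mevalZ mevalXU mulrC [in RHS]mxE.
have -> : ls = map (lin_subst A) [seq 'X_i : {mpoly K[m]} | i <- enum 'I_m].
  apply: (@eq_from_nth _ 0); first by rewrite 2!size_map -cardE card_ord.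
  move=> i; rewrite sl => hi; rewrite -map_comp (nth_map (Ordinal hi)) ?size_enum_ord //=.
  have -> : nth (Ordinal hi) (enum 'I_m) i = Ordinal hi.
    by apply: val_inj; rewrite /= nth_enum_ord.
  by rewrite /lin_subst msubstX -lE.
by apply: regular_lin_subst => //; apply: regular_variables.
Qed.

Section Criterion.
Variables (K : closedFieldType) (m : nat).
Implicit Types (s ls qs : seq {mpoly K[m]}) (Y Z : proj K m -> Prop).

Definition zeros s : proj K m -> Prop := fun p => forall f, f \in s -> vanishes_at f p.

Lemma zeros_closed s : zclosed (zeros s).
Proof. exact: zclosed_zeros. Qed.

Lemma form_eval0 (f : {mpoly K[m]}) : form f -> f.@[fun=> 0] = 0.
Proof.
by move=> [e e0]; apply: meval0_homog.
Qed.

Lemma no_common_zeroP s : (forall f, f \in s -> form f) ->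
  no_common_zero s <-> forall p, ~ zeros s p.
Proof.
move=> hs; split=> [nz p hp|nz a ha i].
  have [v v0 pv] := proj_gen p; case/eqP: v0; apply/rowP => i; rewrite mxE.
  by apply: nz => f fs; apply: (hp f fs); rewrite pv memv_line.
have [a0|a0] := eqVneq (\row_i a i) 0; first by move/rowP/(_ i): a0; rewrite !mxE.
have [p pv] := proj_of a0; case: (nz p) => f fs.
have [e e0 fe] := hs f fs; apply/(vanishes_at_homog pv fe).
by rewrite -[RHS](ha f fs); apply: meval_eq => j; rewrite mxE.
Qed.

Lemma one_not_ideal s : (forall f, f \in s -> form f) -> ~ ideal_of s 1.
Proof.
move=> hs.
move/(ideal_of_min (meval_ideal _) (fun f fs => form_eval0 (hs f fs)))/eqP.
by rewrite meval1 oner_eq0.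
Qed.

Lemma homog1_form (f : {mpoly K[m]}) : f \is 1.-homog -> form f.
Proof. by exists 1%N. Qed.

(** Induction on the number of forms qs that are not yet linear: q is replaced by a linear
    form l, chosen to vanish identically on no component of the zero set of the others, and
    then l is exchanged for q at the end of the sequence. *)
Theorem regular_of_no_common_zero s : size s = m ->
  (forall f, f \in s -> form f) -> no_common_zero s -> regular_seq s.
Proof.
suff gen qs ls : (size ls + size qs = m)%N -> (forall f, f \in ls -> f \is 1.-homog) ->
    (forall f, f \in qs -> form f) -> no_common_zero (ls ++ qs) -> regular_seq (ls ++ qs).
  by move=> sm hs nz; apply: (gen s [::]).
elim: qs ls => [|q qs IH] ls sz hl hq nz.
  rewrite cats0 in nz *; apply: regular_linear_forms => //.
  by rewrite -[RHS]sz addn0.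
have fl f : f \in ls -> form f by move/hl/homog1_form.
have fq : form q by apply: hq; rewrite mem_head.
have fqs f : f \in qs -> form f by move=> fs; apply: hq; rewrite inE fs orbT.
have fall f : f \in ls ++ q :: qs -> form f by rewrite mem_cat => /orP[/fl|/hq].
have frest f : f \in ls ++ qs -> form f by rewrite mem_cat => /orP[/fl|/fqs].
have [e e0 qe] := fq.
pose Z := zeros (ls ++ qs).
have nzq p : Z p -> ~ vanishes_at q p.
  move=> Zp qp; apply: ((no_common_zeroP fall).1 nz p) => f.
  by rewrite mem_cat inE orbCA -mem_cat => /orP[/eqP ->|/Zp].
have [S cS] := components_exist (zeros_closed (ls ++ qs)).
have [l l1 hcut] := form_cutting_components cS.
have nzl p : Z p -> ~ vanishes_at l p.
  move=> Zp; have [i hi Yp] := cS.2 p Zp; have [irr sub] := cS.1 i hi.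
  by apply: (irreducible_no_zero irr e0 qe _ l1 (hcut i hi)) => // p' /sub/nzq.
have fl' f : f \in rcons ls l -> f \is 1.-homog.
  by rewrite mem_rcons inE => /orP[/eqP ->|/hl].
have fall' f : f \in rcons ls l ++ qs -> form f.
  by rewrite mem_cat => /orP[/fl'/homog1_form|/fqs].
(* The zero set of the new system is the section by l of that of ls ++ qs. *)
have reg : regular_seq (rcons ls l ++ qs).
  apply: IH => //; first by rewrite size_rcons addSnnS.
  apply/(no_common_zeroP fall') => p hp; apply: (nzl p) => [f fs|].
    by apply: hp; rewrite cat_rcons mem_cat inE orbCA -mem_cat fs orbT.
  by apply: hp; rewrite mem_cat mem_rcons mem_head.
move: reg; rewrite cat_rcons => /regular_move.
rewrite -cat_rcons => /(_ fall'); rewrite -rcons_cat => /regular_rcons[reg nzdl].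
apply/regular_move => //; rewrite -rcons_cat; apply/regular_rcons; split=> //.
have iI := ideal_of_is_ideal (ls ++ qs).
pose J := ideal_add (ideal_of (ls ++ qs)) q.
have iJ : is_ideal J by apply: ideal_add_ideal.
(* The zeros of ls ++ qs and q are trivial, so a power of l lies in their ideal. *)
have [|k hk] := nullstellensatz (h := l) iJ.
  move=> a ha; have := meval_eq l (v2 := fun=> 0) (nz a _) => -> //.
    exact: form_eval0 (homog1_form l1).
  move=> f; rewrite mem_cat inE orbCA -mem_cat => /orP[/eqP ->|fs].
    by apply: ha; apply: ideal_add_mem.
  by apply: ha; apply: ideal_add_sub; apply: mem_ideal_of.
exact: nzd_mod_exchange hk.
Qed.

(** The vanishing ideals of the members of the chain, from the largest set to a point,
    followed by the ideal of the polynomials without constant term.  At the last step the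
    nonzerodivisor is a coordinate that does not vanish at the point. *)
Lemma chain_tower Z d : has_chain Z d -> exists Y, [/\ zirreducible Y, zsubset Y Z &
  tower (vanishing_ideal Y) d.+1].
Proof.
move=> [C [h1 h2]]; exists (C d); have [irr sub] := h1 d (leqnn d); split=> //.
elim: d h1 h2 {irr sub} => [|d IH] h1 h2; have [irr sub] := h1 _ (leqnn _).
  have [_ [p Cp] _] := irr; have [v v0 pv] := proj_gen p.
  have [i vi] : exists i, v 0 i != 0.
    apply: contrapT => /forallNP no; case/eqP: v0; apply/rowP => i; rewrite mxE.
    by apply/eqP; apply: contrapT => /negP; apply: no.
  apply: (tower_step (J := fun f => f.@[fun=> 0] = 0) (g := 'X_i)).
  - exact: vanishing_ideal_ideal.
  - exact: meval_ideal.
  - by move=> f; apply: vanishing_ideal_eval0; exists p.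
  - by rewrite mevalXU.
  - move=> f /(primeM (vanishing_ideal_prime irr))[|//] /(_ p Cp v).
    by rewrite pv memv_line mevalXU => /(_ isT) vi0; rewrite vi0 eqxx in vi.
  - apply: tower_base; first exact: meval_ideal.
    by rewrite meval1 => /eqP; rewrite oner_eq0.
have IHd := IH (fun i hi => h1 i (leqW hi)) (fun i hi => h2 i (leqW hi)).
have [s1 s2] := h2 d (ltnSn d); have [[cd _ _] _] := h1 d (leqnSn d).
have [p [Cp nCp]] : exists p, C d.+1 p /\ ~ C d p.
  apply: contrapT => no; apply: s2 => p Cp; apply: contrapT => nCp; apply: no.
  by exists p.
have [e [g [ge Ig ngp]]] := zclosed_separate cd nCp.
apply: (tower_step (J := vanishing_ideal (C d)) (g := g)) => //.
- exact: vanishing_ideal_ideal.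
- exact: vanishing_ideal_ideal.
- by move=> f; apply: vanishing_ideal_sub.
- by move=> f /(primeM (vanishing_ideal_prime irr))[/(_ p Cp)|].
Qed.

Lemma regular_size_bound s : (forall f, f \in s -> form f) -> regular_seq s ->
  (size s <= m)%N.
Proof.
move=> hs rs; have := regular_tower rs (ideal_of_is_ideal s) (fun x h => h)
  (tower_base (ideal_of_is_ideal s) (one_not_ideal hs)).
by move/tower_zero_bound; rewrite addn0.
Qed.

Lemma regular_chain_bound s d : regular_seq s -> has_chain (zeros s) d ->
  (size s + d < m)%N.
Proof.
move=> rs /chain_tower[Y [irr sub ht]].
have iY := vanishing_ideal_ideal Y.
have := regular_tower rs iY _ ht.
rewrite addnS => h; apply: tower_zero_bound; apply: h.
by apply: ideal_of_min => // f fs p /sub; apply.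
Qed.

End Criterion.

(** * Set-theoretic complete intersections *)

Section BaseLocus.
Variables (K : closedFieldType) (m : nat).
Implicit Types (s fs : seq {mpoly K[m]}) (Z : proj K m -> Prop).

Lemma has_chain0 Z : zclosed Z -> (exists p, Z p) -> has_chain Z 0.
Proof.
move=> cZ [p Zp]; have [//|[fs [sf _ nf]]] := chain_or_forms 0 cZ.
by case: (nf p Zp) => f; rewrite (size0nil sf).
Qed.

Lemma zeros_cat s fs p : zeros (s ++ fs) p <-> zeros s p /\ zeros fs p.
Proof.
split=> [h|[h1 h2] f]; last by rewrite mem_cat => /orP[/h1|/h2].
by split=> f hf; apply: h; rewrite mem_cat hf ?orbT.
Qed.

Lemma linear_sections s fs : (forall f, f \in s -> form f) ->
    (forall f, f \in fs -> f \is 1.-homog) ->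
    (forall p, zeros s p -> ~ zeros fs p) -> (size s + size fs)%N = m ->
  regular_seq s.
Proof.
move=> hs hfs nz sz; apply: (@regular_prefix _ _ fs).
have hall f : f \in s ++ fs -> form f by rewrite mem_cat => /orP[/hs|/hfs/homog1_form].
apply: regular_of_no_common_zero => //; first by rewrite size_cat.
by apply/(no_common_zeroP hall) => p /zeros_cat[/nz].
Qed.

(** Linear forms that empty the zero set complete s to a regular sequence. *)
Lemma no_long_chain_regular s : (forall f, f \in s -> form f) -> (size s <= m)%N ->
  ~ has_chain (zeros s) (m - size s) -> regular_seq s.
Proof.
move=> hs sm nc; have [//|[fs [sf hf nf]]] := chain_or_forms (m - size s) (zeros_closed s).
by apply: (linear_sections hs hf nf); rewrite sf subnKC.
Qed.

(** Otherwise d linear forms would empty the zero set.  Appending the form 0 would give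
    as many forms as variables, without common zero, hence a regular sequence: 0 would be a
    nonzerodivisor modulo an ideal that does not contain 1. *)
Lemma regular_has_chain s d : (forall f, f \in s -> form f) -> m = (d + size s).+1 ->
  has_chain (zeros s) d.
Proof.
move=> hs hm; have [//|[fs [sf hf nf]]] := chain_or_forms d (zeros_closed s).
(* The zero polynomial counts as a linear form. *)
pose fs' := rcons fs 0.
have hf' f : f \in fs' -> f \is 1.-homog.
  by rewrite mem_rcons inE => /orP[/eqP ->|/hf //]; apply: dhomog0.
have : regular_seq (s ++ fs').
  have hall f : f \in s ++ fs' -> form f by rewrite mem_cat => /orP[/hs|/hf'/homog1_form].
  apply: regular_of_no_common_zero => //.
    by rewrite size_cat size_rcons sf addnS [RHS]hm addnC.
  apply/(no_common_zeroP hall) => p /zeros_cat[/nf nz h]; apply: nz => f ff.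
  by apply: h; rewrite mem_rcons inE ff orbT.
rewrite -rcons_cat => /regular_rcons[_ /(_ 1)]; rewrite mul0r => h1.
case: (@one_not_ideal K m (s ++ fs)).
  by move=> f; rewrite mem_cat => /orP[/hs|/hf/homog1_form].
by apply: h1; apply: ideal0 (ideal_of_is_ideal _).
Qed.

(** Zeros of s in affine space are the points of the cone over [zeros s] together with
    the origin, where members of the vanishing ideal vanish since [zeros s] is nonempty. *)
Lemma projective_nullstellensatz s : (forall f, f \in s -> form f) ->
    (exists p, zeros s p) ->
  forall f, vanishing_ideal (zeros s) f <-> radical (ideal_of s) f.
Proof.
move=> hs ne f; split=> [hf|[k hk] p hp]; last first.
  apply: (prime_exp (vanishes_at_prime p)); apply: (ideal_of_min (vanishes_at_ideal p)) hk.
  exact: hp.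
apply: (nullstellensatz (ideal_of_is_ideal s)) => a ha.
have [a0|a0] := eqVneq (\row_i a i) 0.
  rewrite -[RHS](vanishing_ideal_eval0 ne hf); apply: meval_eq => i.
  by move/rowP/(_ i): a0; rewrite !mxE.
have [p pv] := proj_of a0; have zp : zeros s p.
  move=> g gs; have [e e0 ge] := hs g gs; apply/(vanishes_at_homog pv ge).
  by rewrite -[RHS](ha g (mem_ideal_of gs)); apply: meval_eq => i; rewrite mxE.
have := hf p zp (\row_i a i); rewrite pv memv_line => /(_ isT) h0.
by rewrite -[RHS]h0; apply: meval_eq => i; rewrite mxE.
Qed.

(** The first alternative of the definition excludes chains of length m - size s, by the
    dimension; the second one is the case of m forms without common zero. *)
Theorem set_theoretic_ci_regular s : (forall f, f \in s -> form f) ->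
  set_theoretic_ci (size s) (zeros s) <-> regular_seq s.
Proof.
move=> hs; split=> [[_ [[d [hm [_ nd] _]]|[cm nz]]]|rs].
- apply: no_long_chain_regular => //; first by lia.
  by have -> : (m - size s = d.+1)%N by lia.
- by apply: (@linear_sections s [::]) => // [p /nz|]; rewrite ?addn0.
split; first exact: zeros_closed.
have := regular_size_bound hs rs; rewrite leq_eqVlt => /orP[/eqP sm|sm].
  right; split=> // p zp; have := has_chain0 (zeros_closed s) (ex_intro _ p zp).
  by move/(regular_chain_bound rs); rewrite addn0 sm ltnn.
left; exists (m - size s).-1.
have hm : m = ((m - size s).-1 + size s).+1 by lia.
have ch := regular_has_chain hs hm; split=> //.
  split=> // /(regular_chain_bound rs); lia.
exists (in_tuple s).
  move=> i; have [|e _ he] := hs (tnth (in_tuple s) i); first exact: mem_tnth.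
  by exists e.
apply: projective_nullstellensatz => //.
have [C [h1 _]] := ch; have [[_ [p Cp] _] sub] := h1 0%N isT.
by exists p; apply: sub.
Qed.

End BaseLocus.

(** * The Euler-symmetric variety *)

(** A relation over A is mapped to B, used there, and brought back by g. *)
Lemma regular_retract (A B : comNzRingType) (f : {rmorphism A -> B}) (g : {rmorphism B -> A}) s :
  cancel f g -> regular_seq (map f s) -> regular_seq s.
Proof.
move=> fK hs i hi x; have := hs i; rewrite size_map => /(_ hi (f x)).
rewrite (nth_map 0) // -rmorphM -map_take => h /(ideal_of_map f)/h/(ideal_of_map g).
by rewrite -map_comp (eq_map (g := id)) ?map_id ?fK.
Qed.

Lemma meval_path (K : comNzRingType) m (g : 'I_m -> {poly K}) (f : {mpoly K[m]}) t :
  (mmap (@polyC K) g f).[t] = f.@[fun i => (g i).[t]].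
Proof.
apply: (mpoly_rmorph_ext (f := horner_eval t \o mmap (@polyC K) g)
  (g := meval (fun i => (g i).[t]))) => [a|i] /=; rewrite /horner_eval.
  by rewrite mmapC mevalC hornerC.
by rewrite mmapX mmap1U mevalXU.
Qed.

Section Coordinates.
Variables (n c : nat).

Definition zvar : 'I_(1 + n.+1 + c) := lshift c (lshift n.+1 ord0).
Definition xvar (j : 'I_n.+1) : 'I_(1 + n.+1 + c) := lshift c (rshift 1 j).
Definition yvar (i : 'I_c) : 'I_(1 + n.+1 + c) := rshift (1 + n.+1) i.

Lemma var_ind (P : 'I_(1 + n.+1 + c) -> Prop) :
  P zvar -> (forall j, P (xvar j)) -> (forall i, P (yvar i)) -> forall k, P k.
Proof.
move=> hz hx hy k; case: (split_ordP k) => [j ->|i ->]; last exact: hy.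
case: (split_ordP j) => [l ->|l ->]; last exact: hx.
by rewrite ord1.
Qed.

(** The family indexed by the coordinates of the ambient space of M with entries z, x, y in
    the three blocks.  It is used with entries in the base field, and with polynomials as
    entries to parametrize M. *)
Definition coords (T : Type) (z : T) (x : 'I_n.+1 -> T) (y : 'I_c -> T) (k : 'I_(1 + n.+1 + c)) : T :=
  row_mx (row_mx (const_mx z) (\row_j x j)) (\row_i y i) (0 : 'I_1) k.

Lemma coords_z T z x y : @coords T z x y zvar = z.
Proof. by rewrite /coords row_mxEl row_mxEl mxE. Qed.

Lemma coords_x T z x y j : @coords T z x y (xvar j) = x j.
Proof. by rewrite /coords row_mxEl row_mxEr mxE. Qed.

Lemma coords_y T z x y i : @coords T z x y (yvar i) = y i.
Proof. by rewrite /coords row_mxEr mxE. Qed.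

Definition coordsE := (coords_z, coords_x, coords_y).

End Coordinates.
Arguments zvar {n c}.
Arguments xvar {n c}.
Arguments yvar {n c}.

Section EulerVariety.
Variables (K : closedFieldType) (n c : nat) (Q : c.-tuple (dhomog n.+1 K 2)).
Local Notation m := (1 + n.+1 + c)%N.
Local Notation M := (euler_symmetric Q).
Local Notation quad i := (mpoly_of_dhomog (tnth Q i)).
Implicit Types (f g : {mpoly K[m]}) (p : proj K m) (w : 'I_n.+1 -> K).

Definition quads : seq {mpoly K[n.+1]} := [seq mpoly_of_dhomog q | q <- Q].

Lemma size_quads : size quads = c.
Proof. by rewrite size_map size_tuple. Qed.

Lemma quad_homog i : quad i \is 2.-homog.
Proof. exact: dhomog_is_dhomog. Qed.

Lemma quad_mem i : quad i \in quads.
Proof. by apply: map_f; apply: mem_tnth. Qed.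

Lemma quadsP (f : {mpoly K[n.+1]}) : f \in quads -> exists i, f = quad i.
Proof. by case/mapP => q /tnthP[i ->] ->; exists i. Qed.

Lemma quads_form (f : {mpoly K[n.+1]}) : f \in quads -> form f.
Proof. by case/quadsP => i ->; exists 2%N => //; apply: quad_homog. Qed.

Definition cone_point (t : K) w : 'I_m -> K := coords (t ^+ 2) (fun j => t * w j) (fun i => (quad i).@[w]).
Definition chart_point w : 'I_m -> K := coords 1 w (fun i => (quad i).@[w]).

Lemma euler_mapE t (w : 'rV[K]_n.+1) i : euler_map Q t w 0 i = cone_point t (w 0) i.
Proof.
rewrite /euler_map /cone_point; elim/var_ind: i => [|j|i]; rewrite coordsE.
- by rewrite row_mxEl row_mxEl mxE mulr1n.
- by rewrite row_mxEl row_mxEr mxE.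
- by rewrite row_mxEr mxE.
Qed.

Lemma cone_point_chart t w k : t != 0 ->
  cone_point t w k = t ^+ 2 * chart_point (fun j => t^-1 * w j) k.
Proof.
move=> t0; rewrite /cone_point /chart_point; elim/var_ind: k => [|j|i]; rewrite !coordsE.
- by rewrite mulr1.
- by rewrite mulrA expr2 mulfK.
- by rewrite (meval_homog _ _ (quad_homog i)) mulrA -exprMn divff // expr1n mul1r.
Qed.

Definition on_chart (p : proj K m) := exists w, val p = <[\row_k chart_point w k]>%VS.

Lemma chart_point_neq0 w : \row_k chart_point w k != 0.
Proof.
apply/eqP => /rowP/(_ zvar); rewrite !mxE /chart_point coordsE => /eqP.
by rewrite oner_eq0.
Qed.

Lemma chart_in_euler : zsubset on_chart M.
Proof.
move=> p [w pw]; apply: sub_zclosure; exists 1, (\row_j w j).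
have -> : euler_map Q 1 (\row_j w j) = \row_k chart_point w k.
  apply/rowP => k; rewrite euler_mapE cone_point_chart ?oner_eq0 // expr1n mul1r mxE.
  rewrite /chart_point; elim/var_ind: k => [|j|i]; rewrite !coordsE ?invr1 ?mul1r ?mxE //.
  by apply: meval_eq => j; rewrite ?invr1 mul1r mxE.
by split=> //; apply: chart_point_neq0.
Qed.

(** The points with t = 0 are limits of multiples of points of the chart. *)
Lemma cone_point_vanish f : (forall a w, f.@[fun k => a * chart_point w k] = 0) ->
  forall a t w, f.@[fun k => a * cone_point t w k] = 0.
Proof.
move=> hf a t w.
pose g : 'I_m -> {poly K} := coords (a%:P * 'X^2) (fun j => (a * w j)%:P * 'X)
  (fun i => (a * (quad i).@[w])%:P).
have gE s k : (g k).[s] = a * cone_point s w k.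
  rewrite /g /cone_point; elim/var_ind: k => [|j|i]; rewrite !coordsE !hornerE //.
  by rewrite mulrAC.
have g0 : mmap (@polyC K) g f = 0.
  apply: poly_eq0_eval => s s0; rewrite meval_path.
  rewrite -[RHS](hf (a * s ^+ 2) (fun j => s^-1 * w j)); apply: meval_eq => k.
  by rewrite gE cone_point_chart // mulrA.
by have := meval_path g f t; rewrite g0 horner0 => h; rewrite [RHS]h; apply: meval_eq => k; rewrite gE.
Qed.

Lemma vanishing_euler f : vanishing_ideal M f <-> forall a w, f.@[fun k => a * chart_point w k] = 0.
Proof.
split=> [hf a w|hf].
  have [p pw] := proj_of (chart_point_neq0 w).
  have /(vanishes_atE _ pw)/(_ a) h := hf p (chart_in_euler (ex_intro _ w pw)).
  by rewrite -[RHS]h; apply: meval_eq => k; rewrite mxE.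
apply: vanishing_zclosure => p [t [w [_ pw]]]; apply/(vanishes_atE _ pw) => a.
rewrite -[RHS](cone_point_vanish hf a t (w 0)); apply: meval_eq => k.
by rewrite euler_mapE.
Qed.

Lemma euler_closed : zclosed M.
Proof. exact: zclosure_closed. Qed.

(** M is the closure of its chart; the points of the parametrization with t = 0 are
    limits. *)
Lemma euler_min Y : zclosed Y -> zsubset on_chart Y -> zsubset M Y.
Proof.
move=> cY hY; apply: (zclosed_subset cY) => f hf; apply/vanishing_euler => a w.
have [p pw] := proj_of (chart_point_neq0 w).
have /(vanishes_atE _ pw)/(_ a) h := hf p (hY p (ex_intro _ w pw)).
by rewrite -[RHS]h; apply: meval_eq => k; rewrite mxE.
Qed.

(** The part of the chart over the image of h; for coordinate projections h these closures
    form a chain in M. *)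
Definition sub_chart (h : 'I_n.+1 -> {mpoly K[n.+1]}) (p : proj K m) :=
  exists w, val p = <[\row_k chart_point (fun j => (h j).@[w]) k]>%VS.

(** The set is parametrized by affine space, whose coordinate ring is a domain. *)
Lemma sub_chart_irreducible h : zirreducible (zclosure (sub_chart h)).
Proof.
apply: zclosure_irreducible.
  have [p pw] := proj_of (chart_point_neq0 (fun j => (h j).@[fun=> 0])).
  by exists p; exists (fun=> 0).
move=> d e f g df eg hfg.
pose H : 'I_m -> {mpoly K[n.+1]} := coords 1 h (fun i => msubst h (quad i)).
have HE k w : (H k).@[w] = chart_point (fun j => (h j).@[w]) k.
  rewrite /H /chart_point; elim/var_ind: k => [|j|i]; rewrite !coordsE ?meval1 //.
  exact: meval_msubst.
have vanH d' f' : f' \is d'.-homog -> msubst H f' = 0 -> vanishing_ideal (sub_chart h) f'.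
  move=> hf' H0 p [w pw]; apply/(vanishes_at_homog pw hf').
  have : (msubst H f').@[w] = 0 by rewrite H0 meval0.
  rewrite meval_msubst => h0; rewrite -[RHS]h0; apply: meval_eq => k.
  by rewrite mxE HE.
have : msubst H f * msubst H g = 0.
  apply: contrapT => /eqP/mpoly_nonroot[w /eqP[]].
  rewrite -rmorphM meval_msubst.
  have [p pw] := proj_of (chart_point_neq0 (fun j => (h j).@[w])).
  have /(vanishes_at_homog pw (dhomogM df eg)) h0 := hfg p (ex_intro _ w pw).
  by rewrite -[RHS]h0; apply: meval_eq => k; rewrite mxE HE.
by move/eqP; rewrite mulf_eq0 => /orP[] /eqP h0; [left; apply: vanH df h0|right; apply: vanH eg h0].
Qed.

Lemma sub_chart_sub h : zsubset (sub_chart h) on_chart.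
Proof. by move=> p [w pw]; exists (fun j => (h j).@[w]). Qed.

Lemma euler_irreducible : zirreducible M.
Proof.
have [_ ne irr] := sub_chart_irreducible (fun j => 'X_j).
have subM : zsubset (zclosure (sub_chart (fun j => 'X_j))) M.
  by apply: (zclosure_min euler_closed) => p /sub_chart_sub/chart_in_euler.
have Msub : zsubset M (zclosure (sub_chart (fun j => 'X_j))).
  apply: euler_min; first exact: zclosure_closed.
  move=> p [w pw]; apply: sub_zclosure; exists w; rewrite pw.
  congr (<[_]>%VS); apply/rowP => k; rewrite !mxE.
  rewrite /chart_point; elim/var_ind: k => [|j|i]; rewrite !coordsE ?mevalXU //.
  by apply: meval_eq => j; rewrite mevalXU.
split; [exact: euler_closed | by have [p hp] := ne; exists p; apply: subM |].
move=> Y1 Y2 c1 c2 cov; have [] := irr Y1 Y2 c1 c2; first by move=> p /subM/cov.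
  by move=> h; left=> p /Msub/h.
by move=> h; right=> p /Msub/h.
Qed.

(** The closures of the parts of the chart over the span of the first k basis vectors of
    W; they are told apart by the coordinates x_k. *)
Lemma euler_chain : has_chain M n.+1.
Proof.
pose h k (j : 'I_n.+1) : {mpoly K[n.+1]} := if (j < k)%N then 'X_j else 0.
exists (fun k => zclosure (sub_chart (h k))); split=> k hk.
  split; first exact: sub_chart_irreducible.
  by apply: (zclosure_min euler_closed) => p /sub_chart_sub/chart_in_euler.
split.
  apply: zclosure_min; first exact: zclosure_closed.
  move=> p [w pw]; apply: sub_zclosure; exists (fun j => (h k j).@[w]); rewrite pw.
  congr (<[_]>%VS); apply/rowP => l; rewrite !mxE.
  have e j : (h k.+1 j).@[fun j => (h k j).@[w]] = (h k j).@[w].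
    rewrite [h k.+1 j]/h ltnS; case: leqP => jk; first by rewrite mevalXU.
    by rewrite meval0 /h ltnNge ltnW //= meval0.
  rewrite /chart_point; elim/var_ind: l => [|j|i]; rewrite !coordsE ?e //.
  by apply: meval_eq => j; rewrite e.
move=> sub; pose w0 (j : 'I_n.+1) : K := (j == Ordinal hk)%:R.
have [p pw] := proj_of (chart_point_neq0 (fun j => (h k.+1 j).@[w0])).
have van : zsubset (sub_chart (h k)) (vanishes_at 'X_(xvar (Ordinal hk))).
  move=> q [w qw]; apply/(vanishes_at_homog qw (d := 1%N)).
    by rewrite dhomogX /= mdeg1.
  by rewrite mevalXU mxE /chart_point coordsE /h ltnn meval0.
have Xh : ('X_(xvar (Ordinal hk)) : {mpoly K[m]}) \is 1.-homog by rewrite dhomogX /= mdeg1.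
have /(zclosure_min (zclosed_vanishes _) van)/(vanishes_at_homog pw Xh) :=
  sub p (sub_zclosure (ex_intro _ w0 pw)).
rewrite mevalXU mxE /chart_point coordsE /h ltnS leqnn mevalXU /w0 eqxx => /eqP.
by rewrite oner_eq0.
Qed.

(** The cone over M is parametrized by N + 1 variables: the base point w and a scalar. *)
Lemma euler_no_chain : ~ has_chain M n.+2.
Proof.
move=> /chain_tower[Y [_ sub ht]].
pose x (j : 'I_n.+1) : {mpoly K[n.+2]} := 'X_(lift ord0 j).
pose h : 'I_m -> {mpoly K[n.+2]} := fun k => 'X_ord0 * coords 1 x (fun i => msubst x (quad i)) k.
have : (n.+3 <= n.+2)%N; last by rewrite ltnn.
apply: (tower_bound (h := h)) ht => f hf; apply: (vanishing_ideal_sub sub).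
apply/vanishing_euler => a w.
pose v (k : 'I_n.+2) := if unlift ord0 k is Some j then w j else a.
have v0 : v ord0 = a by rewrite /v unlift_none.
have vl j : v (lift ord0 j) = w j by rewrite /v liftK.
have := meval_msubst h f v; rewrite /msubst hf meval0 => h0; rewrite [RHS]h0.
apply: meval_eq => k; rewrite /h mevalM mevalXU v0 /chart_point; congr (_ * _).
elim/var_ind: k => [|j|i]; rewrite !coordsE ?meval1 //; first by rewrite mevalXU vl.
by rewrite meval_msubst; apply: meval_eq => j; rewrite mevalXU vl.
Qed.

Lemma euler_zdim : zdim M n.+1.
Proof. by split; [exact: euler_chain | exact: euler_no_chain]. Qed.

Definition to_x : {mpoly K[n.+1]} -> {mpoly K[m]} := msubst (fun j => 'X_(xvar j)).
HB.instance Definition _ := GRing.RMorphism.on to_x.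

Lemma meval_to_x (f : {mpoly K[n.+1]}) a : (to_x f).@[a] = f.@[fun j => a (xvar j)].
Proof. by rewrite meval_msubst; apply: meval_eq => j; rewrite mevalXU. Qed.

Lemma to_x_homog d (f : {mpoly K[n.+1]}) : f \is d.-homog -> to_x f \is d.-homog.
Proof.
move=> hf; rewrite -[d]mul1n; apply: msubst_homog_form => // j.
by rewrite dhomogX /= mdeg1.
Qed.

Definition graph_eq i : {mpoly K[m]} := 'X_zvar * 'X_(yvar i) - to_x (quad i).
Definition graph_eqs : seq {mpoly K[m]} := [seq graph_eq i | i <- enum 'I_c].

Lemma graph_eq_homog i : graph_eq i \is 2.-homog.
Proof.
apply: rpredB; last by apply/to_x_homog/quad_homog.
have hX k : ('X_k : {mpoly K[m]}) \is 1.-homog by rewrite dhomogX /= mdeg1.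
exact: (dhomogM (hX _) (hX _)).
Qed.

Lemma size_graph_eqs : size graph_eqs = c.
Proof. by rewrite size_map size_enum_ord. Qed.

Lemma graph_eqs_form f : f \in graph_eqs -> form f.
Proof. by move/mapP => [i' _ ->]; exists 2%N => //; apply: graph_eq_homog. Qed.

Lemma graph_eq_mem i : graph_eq i \in graph_eqs.
Proof. by apply: map_f; rewrite mem_enum. Qed.

Lemma meval_graph_eq i a :
  (graph_eq i).@[a] = a zvar * a (yvar i) - (quad i).@[fun j => a (xvar j)].
Proof. by rewrite mevalB mevalM !mevalXU meval_to_x. Qed.

Lemma graph_eq_vanishes i : vanishing_ideal M (graph_eq i).
Proof.
apply/vanishing_euler => a w; rewrite meval_graph_eq /chart_point !coordsE.
under [X in _ - X]meval_eq do rewrite coordsE.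
by rewrite (meval_homog _ _ (quad_homog i)) mulr1 mulrA -expr2 subrr.
Qed.

End EulerVariety.

(** * Equations of the Euler-symmetric variety *)

(** The factors have order at least 1 and 2, so the product has order at least 3. *)
Lemma pihomogM_two (K : comNzRingType) n (b g : {mpoly K[n]}) :
    b.@[fun=> 0] = 0 -> pihomog mdeg 0 g = 0 -> pihomog mdeg 1 g = 0 ->
  pihomog mdeg 2 (b * g) = 0.
Proof.
move=> b0 g0 g1; rewrite [in LHS](pihomog_sumE (leqnn (msize b))) mulr_suml raddf_sum /=.
apply: big1 => d _; rewrite mulrC; have hd := pihomogP mdeg d b.
case: (nat_of_ord d) hd => [|[|[|e]]] hd.
- suff -> : pihomog mdeg 0 b = 0 by rewrite mulr0 raddf0.
  rewrite (homog0_const hd) (_ : _.@[_] = 0) ?mpolyC0 //.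
  rewrite -ray_poly_coef -horner_coef0 ray_polyE -[RHS]b0.
  by apply: meval_eq => i; rewrite mul0r.
- by rewrite (pihomogM_homog 1 _ hd) g1 mul0r.
- by rewrite (pihomogM_homog 0 _ hd) g0 mul0r.
- by rewrite (pihomogM_small _ _ hd).
Qed.

Section EulerEquations.
Variables (K : closedFieldType) (n c : nat) (Q : c.-tuple (dhomog n.+1 K 2)).
Local Notation m := (1 + n.+1 + c)%N.
Local Notation M := (euler_symmetric Q).
Local Notation quad i := (mpoly_of_dhomog (tnth Q i)).
Local Notation incl := (@to_x K n c).
Implicit Types (f g : {mpoly K[m]}) (p : proj K m) (w : 'I_n.+1 -> K).

Definition lifted_quads : seq {mpoly K[m]} := map incl (quads Q).

Lemma lifted_quads_form f : f \in lifted_quads -> form f.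
Proof.
case/mapP => q /quadsP[i ->] ->; exists 2%N => //; exact/to_x_homog/quad_homog.
Qed.

(** On z = 0 the equations z y_i = q_i(x) reduce to q_i(x) = 0.  So the equations, z, the
    linear forms in x that empty the base locus, and the y_i have no common zero, and their
    number is that of the variables. *)
Lemma graph_eqs_zvar_regular : regular_seq (quads Q) ->
  nzd_mod (ideal_of (graph_eqs Q)) 'X_zvar.
Proof.
move=> rQ; have cN := regular_size_bound (@quads_form _ _ _ Q) rQ.
have [ch|[fs [sf hf nf]]] := chain_or_forms (n.+1 - size (quads Q)) (zeros_closed (quads Q)).
  by have := regular_chain_bound rQ ch; rewrite subnKC // ltnn.
rewrite size_quads in cN sf.
pose t : seq {mpoly K[m]} := map incl fs ++ [seq 'X_(yvar i) | i <- enum 'I_c].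
suff : regular_seq (rcons (graph_eqs Q) 'X_zvar ++ t).
  by move/regular_prefix/regular_rcons=> [].
have hform f : f \in rcons (graph_eqs Q) 'X_zvar ++ t -> form f.
  rewrite mem_cat mem_rcons inE -orbA => /or3P[/eqP ->|/graph_eqs_form //|].
    exact/homog1_form/X_homog.
  rewrite mem_cat => /orP[]/mapP[q hq ->]; apply: homog1_form; last exact: X_homog.
  by apply/to_x_homog/hf.
apply: regular_of_no_common_zero => //.
  rewrite size_cat size_rcons size_graph_eqs size_cat 2!size_map sf -cardE card_ord.
  by rewrite addnA addSn subnKC.
move=> a ha.
have az : a zvar = 0.
  by have := ha 'X_zvar; rewrite mem_cat mem_rcons mem_head mevalXU; apply.
have ay i : a (yvar i) = 0.
  have := ha 'X_(yvar i); rewrite mevalXU; apply; rewrite !mem_cat.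
  by apply/orP; right; apply/orP; right; apply: map_f; rewrite mem_enum.
have hall (f : {mpoly K[n.+1]}) : f \in quads Q ++ fs -> form f.
  by rewrite mem_cat => /orP[/quads_form|/hf/homog1_form].
have nz : no_common_zero (quads Q ++ fs).
  by apply/(no_common_zeroP hall) => p /zeros_cat[/nf].
have ax : forall j, a (xvar j) = 0.
  apply: (nz (fun j => a (xvar j))) => f; rewrite mem_cat => /orP[/quadsP[i ->]|ff].
    have := ha (graph_eq Q i); rewrite meval_graph_eq az mul0r sub0r.
    rewrite mem_cat mem_rcons inE graph_eq_mem orbT => /(_ isT)/eqP.
    by rewrite oppr_eq0 => /eqP.
  rewrite -meval_to_x; apply: ha; rewrite !mem_cat.
  by apply/orP; right; apply/orP; left; apply: map_f.
by elim/var_ind.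
Qed.

(** For f of degree d, z^d f is f with every variable multiplied by z.  Modulo the
    equations, z y_i may be replaced by q_i(x), which turns it into f(z^2, z x, q(x)); this
    is zero if f vanishes on M.  Then z^d can be cancelled. *)
Lemma vanishing_euler_graph_eqs f : regular_seq (quads Q) ->
  vanishing_ideal M f <-> ideal_of (graph_eqs Q) f.
Proof.
move=> rQ; have iI := ideal_of_is_ideal (graph_eqs Q).
split; last first.
  apply: ideal_of_min; first exact: vanishing_ideal_ideal.
  by move=> _ /mapP[i' _ ->]; apply: graph_eq_vanishes.
move=> hf; apply: (graded_comp iI) => d.
have := vanishing_ideal_pihomog d hf; have := pihomogP mdeg d f.
move: (pihomog mdeg d f) => {hf}f df hf.
have nzd := graph_eqs_zvar_regular rQ.
suff : ideal_of (graph_eqs Q) ('X_zvar ^+ d * f).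
  by elim: d {df} => [|d IH]; rewrite ?mul1r // exprS -mulrA => /nzd/IH.
pose h k : {mpoly K[m]} := 'X_zvar * 'X_k.
pose e : 'I_m -> {mpoly K[m]} := coords ('X_zvar ^+ 2) (fun j => 'X_zvar * 'X_(xvar j))
  (fun i => incl (quad i)).
have hE : msubst h f = 'X_zvar ^+ d * f.
  have /dhomogP hd := df; rewrite [in RHS](mpolyE f) mulr_sumr /msubst /mmap big_seq [RHS]big_seq.
  apply: eq_bigr => mm /hd hmm; rewrite mul_mpolyC -scalerAr; congr (_ *: _).
  rewrite /mmap1 /h; under eq_bigr do rewrite exprMn.
  by rewrite big_split /= -mpolyXE_id -hmm /= mdegE expr_sum.
have e0 : msubst e f = 0.
  apply: contrapT => /eqP/mpoly_nonroot[a /eqP[]]; rewrite meval_msubst.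
  have hc := cone_point_vanish ((vanishing_euler Q f).1 hf) 1 (a zvar) (fun j => a (xvar j)).
  rewrite -[RHS]hc; apply: meval_eq => k; rewrite mul1r /e /cone_point.
  elim/var_ind: k => [|j|i]; rewrite !coordsE.
  - by rewrite rmorphXn /= mevalXU.
  - by rewrite mevalM !mevalXU.
  - by rewrite meval_to_x.
rewrite -hE -[msubst h f]subr0 -e0.
apply: (mpoly_rmorph_congr (f := msubst h) (g := msubst e) iI) => [a|k] /=.
  by rewrite !msubstC.
rewrite !msubstX /h /e; elim/var_ind: k => [|j|i]; rewrite !coordsE.
- by rewrite expr2 subrr; apply: ideal0 iI.
- by rewrite subrr; apply: ideal0 iI.
- by apply: mem_ideal_of; apply: graph_eq_mem.
Qed.

Theorem regular_complete_intersection : regular_seq (quads Q) -> complete_intersection c M.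
Proof.
move=> rQ; split; first exact: euler_closed.
exists n.+1; split; [by lia | exact: euler_zdim |].
have sg : size (graph_eqs Q) == c by rewrite size_graph_eqs.
by exists (Tuple sg) => f; apply: vanishing_euler_graph_eqs.
Qed.

(** On the chart, a linear form with coefficients a, b_j, c_i restricts to
    a + sum b_j w_j + sum c_i q_i(w), whose homogeneous parts vanish separately; the q_i are
    linearly independent. *)
Lemma no_low_degree : free Q -> forall f, vanishing_ideal M f ->
  pihomog mdeg 0 f = 0 /\ pihomog mdeg 1 f = 0.
Proof.
move=> fQ f hf; split.
  have := vanishing_ideal_pihomog 0 hf; move: (pihomog mdeg 0 f) (pihomogP mdeg 0 f).
  move=> {hf}f hf0 /vanishing_euler/(_ 0 (fun=> 0)).
  rewrite (homog0_const hf0) => h; rewrite (_ : f.@[_] = 0) ?mpolyC0 //.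
  by rewrite -[RHS]h mevalC.
have := vanishing_ideal_pihomog 1 hf; move: (pihomog mdeg 1 f) (pihomogP mdeg 1 f).
move=> {hf}f /linear_formE fE /vanishing_euler hf.
pose co k : K := f@_U_(k).
pose lin : {mpoly K[n.+1]} := \sum_j co (xvar j) *: 'X_j.
pose qu : {mpoly K[n.+1]} := \sum_i co (yvar i) *: quad i.
have P0 : (co zvar)%:MP + lin + qu = 0.
  apply: contrapT => /eqP/mpoly_nonroot[w /eqP[]].
  rewrite -[RHS](hf 1 w) fE raddf_sum /= 2!big_split_ord /= big_ord1 !mevalD mevalC.
  congr (_ + _ + _).
  - by rewrite mevalZ mevalXU mul1r [X in _ * X]coords_z mulr1.
  - rewrite raddf_sum; apply: eq_bigr => j _ /=; rewrite !mevalZ !mevalXU mul1r.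
    by rewrite [X in _ = _ * X]coords_x.
  - rewrite raddf_sum; apply: eq_bigr => i _ /=; rewrite !mevalZ !mevalXU mul1r.
    by rewrite [X in _ = _ * X]coords_y.
have linh : lin \is 1.-homog by apply: rpred_sum => j _; apply/rpredZ/X_homog.
have quh : qu \is 2.-homog by apply: rpred_sum => i _; apply/rpredZ/quad_homog.
have zh : (co zvar)%:MP \is [in K[n.+1], 0.-homog].
  by rewrite -[_%:MP]mulr1 mul_mpolyC; apply: rpredZ; apply: dhomog1.
have comp d : pihomog mdeg d ((co zvar)%:MP + lin + qu) = 0 by rewrite P0 raddf0.
have co_z : co zvar = 0.
  have := comp 0%N; rewrite !raddfD /= (pihomog_dE zh) (pihomog_ne0 _ linh) //.
  by rewrite (pihomog_ne0 _ quh) // !addr0 => /eqP; rewrite mpolyC_eq0 => /eqP.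
have lin0 : lin = 0.
  have := comp 1%N; rewrite !raddfD /= (pihomog_dE linh) (pihomog_ne0 _ zh) //.
  by rewrite (pihomog_ne0 _ quh) // addr0 add0r.
have qu0 : qu = 0.
  have := comp 2%N; rewrite !raddfD /= (pihomog_dE quh) (pihomog_ne0 _ zh) //.
  by rewrite (pihomog_ne0 _ linh) // !add0r.
have co_x j : co (xvar j) = 0.
  have /mpolyP/(_ U_(j)%MM) := lin0; rewrite mcoeff0 raddf_sum /= (bigD1 j) //=.
  rewrite mcoeffZ mcoeffXU eqxx mulr1 big1 ?addr0 // => l lj.
  by rewrite mcoeffZ mcoeffXU (negbTE lj) mulr0.
have co_y i : co (yvar i) = 0.
  have /(_ (fun i => co (yvar i))) := freeP fQ; apply; apply: val_inj; rewrite /= raddf_sum -[RHS]qu0.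
  by apply: eq_bigr => l _; rewrite /= -tnth_nth.
by rewrite fE big1 // => k _; have -> : f@_U_(k) = 0; [elim/var_ind: k | rewrite scale0r].
Qed.

Lemma coef_to_x (f : {mpoly K[n.+1]}) i : (incl f)@_(U_(zvar) + U_(yvar i)) = 0.
Proof.
pose I (g : {mpoly K[m]}) := forall mm : 'X_{1..m}, (0 < mm (yvar i))%N -> g@_mm = 0.
suff : I (incl f) by apply; rewrite mnmDE !mnm1E eqxx addn1.
rewrite /to_x /msubst /mmap.
elim/big_ind: _ => [mm _|x y hx hy mm h|mm _ mm' h].
- by rewrite mcoeff0.
- by rewrite mcoeffD hx // hy // addr0.
rewrite mul_mpolyC mcoeffZ /mmap1.
rewrite mprodXnE mcoeffX.
case: eqP => [e|_]; last by rewrite mulr0.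
move: h; rewrite -e mnm_sumE big1 // => j _.
by rewrite mulmnE mnm1E /xvar /yvar eq_lrshift.
Qed.

(** Write the equations as combinations, with matrix A, of the c generators g_j of the
    ideal of M.  The g_j have no terms of degree less than 2, so the quadratic parts only see
    the value A(0); as the equations are linearly independent, A(0) is invertible.  By
    Cramer's rule det(A) g_j is in the ideal of the equations, and det(A) vanishes at no
    point of projective space in the sense of [vanishes_at], since it is nonzero at the
    origin. *)
Lemma graph_eqs_zeros_euler (g : c.-tuple {mpoly K[m]}) : free Q ->
    (forall f, vanishing_ideal M f <-> ideal_of g f) ->
  zsubset (zeros (graph_eqs Q)) M.
Proof.
move=> fQ hg.
have gM j : vanishing_ideal M (tnth g j) by apply/hg; apply: mem_ideal_of; apply: mem_tnth.
have ex (i : 'I_c) : exists a : 'I_c -> {mpoly K[m]}, graph_eq Q i = \sum_j a j * tnth g j.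
  have /hg[a ha] := @graph_eq_vanishes _ _ _ Q i; exists (fun j => a (cast_ord (esym (size_tuple g)) j)).
  rewrite ha (reindex (cast_ord (esym (size_tuple g)))) /=.
    by apply: eq_bigr => j _; rewrite -tnth_nth.
  by exists (cast_ord (size_tuple g)) => j _; rewrite ?cast_ordK ?cast_ordKV.
have [a ha] := choice ex.
pose A := \matrix_(i < c, j < c) a i j.
pose A0 := map_mx (meval (fun=> 0)) A.
(* A row of the kernel of A(0) gives a combination of the equations without
   quadratic part, that is, zero; its coefficient at z y_i is the i-th entry. *)
have uA0 : A0 \in unitmx.
  rewrite -row_free_unit -kermx_eq0; apply/rowV0P => v /sub_kermxP hv.
  apply/rowP => i; rewrite mxE.
  pose H := \sum_i v 0 i *: graph_eq Q i.
  have HE : H = \sum_j (\sum_i v 0 i *: a i j) * tnth g j.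
    rewrite /H; under eq_bigr => k _ do rewrite ha scaler_sumr.
    rewrite exchange_big; apply: eq_bigr => j _; rewrite mulr_suml.
    by apply: eq_bigr => k _; rewrite scalerAl.
  have H0 : H = 0.
    have hH : H \is 2.-homog by apply: rpred_sum => k _; apply/rpredZ/graph_eq_homog.
    rewrite -(pihomog_dE hH) HE raddf_sum /= big1 // => j _.
    have [g0 g1] := no_low_degree fQ (gM j); apply: pihomogM_two => //.
    move/rowP/(_ j): hv; rewrite !mxE => h0; rewrite -[RHS]h0 raddf_sum.
    by apply: eq_bigr => k _; rewrite !mxE /= mevalZ.
  have /mpolyP/(_ (U_(zvar) + U_(yvar i))%MM) := H0.
  rewrite mcoeff0 raddf_sum /= (bigD1 i) //= big1 ?addr0 => [|k ki].
    by rewrite mcoeffZ /graph_eq mcoeffB -mpolyXD mcoeffX eqxx coef_to_x ?subr0 ?mulr1 //.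
  rewrite mcoeffZ /graph_eq mcoeffB -mpolyXD mcoeffX coef_to_x subr0.
  case: eqP => [/addmI/eqP|_]; last by rewrite mulr0.
  by rewrite eq_mnm1 /yvar (inj_eq (@rshift_inj _ _)) (negbTE ki).
move=> p hp; apply: (zclosedP (euler_closed Q)) => f /hg.
have ip := vanishes_at_ideal p.
apply: (ideal_of_min ip) => _ /tnthP[j ->].
have [||//] := @vanishes_atM _ _ (\det A) (tnth g j) p.
- have : (\adj A *m (A *m \col_i tnth g i)) j 0 = \det A * tnth g j.
    by rewrite mulmxA mul_adj_mx mul_scalar_mx !mxE.
  move=> <-; rewrite mxE; apply: (ideal_sum ip) => k _; apply: (idealM ip).
  have -> : (A *m \col_i tnth g i) k 0 = graph_eq Q k.
    by rewrite mxE ha; apply: eq_bigr => l _; rewrite !mxE.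
  by apply: hp; apply: graph_eq_mem.
- have [v v0 pv] := proj_gen p; move/(vanishes_atE _ pv)/(_ 0).
  rewrite (meval_eq _ (v2 := fun=> 0)) => [|k]; last by rewrite mul0r.
  by rewrite -det_map_mx => h0; move: uA0; rewrite unitmxE unitfE /A0 h0 eqxx.
Qed.

(** The section of M by z = 0 contains no chain of length N, since M would prolong it.  So
    N linear forms empty it, and as it is defined by z and the q_i(x), these 1 + c + N forms
    make a regular sequence.  The q_i are then regular in all variables, and in the variables
    x because setting z and y to 0 retracts the larger ring onto the smaller one. *)
Theorem complete_intersection_regular : free Q -> complete_intersection c M ->
  regular_seq (quads Q).
Proof.
move=> fQ [_ [d [_ _ [g hg]]]].
pose Z p := M p /\ vanishes_at 'X_zvar p.
have cZ : zclosed Z := zclosedI (euler_closed Q) (zclosed_vanishes _).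
have [ch|[fs [sf hf nf]]] := chain_or_forms n.+1 cZ.
  case: (@euler_no_chain K n c Q); apply: (has_chain_extend (euler_irreducible Q) _ _ ch).
    by move=> p [].
  move=> sub; have [p pw] := proj_of (chart_point_neq0 Q (fun=> 0)).
  have [_] := sub p (chart_in_euler (ex_intro _ _ pw)).
  move/(vanishes_at_homog pw (X_homog _ _)); rewrite mevalXU mxE /chart_point coordsE => /eqP.
  by rewrite oner_eq0.
have: regular_seq lifted_quads; last first.
  apply: (regular_retract (g := msubst (coords 0 (fun j => 'X_j) (fun=> 0)))) => f /=.
  by rewrite msubst_comp; apply: msubst_id => j; rewrite msubstX coordsE.
have hl f : f \in 'X_zvar :: fs -> f \is 1.-homog.
  by rewrite inE => /orP[/eqP ->|/hf //]; apply: X_homog.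
apply: (linear_sections lifted_quads_form hl); last first.
  by rewrite /= sf !size_map size_tuple; lia.
move=> p hq hz; have pz : vanishes_at 'X_zvar p by apply: hz; apply: mem_head.
apply: (nf p); last by move=> f ff; apply: hz; rewrite inE ff orbT.
split=> //; apply: (graph_eqs_zeros_euler fQ hg) => _ /mapP[i' _ ->].
have ip := vanishes_at_ideal p.
apply: (idealB ip); first exact: (idealMr ip).
by apply: hq; apply: map_f; apply: quad_mem.
Qed.

End EulerEquations.

(** * Tangent spaces *)

Lemma submm n (mm : 'X_{1..n}) : (mm - mm = 0)%MM.
Proof. by apply/mnmP => k; rewrite mnmBE subnn mnm0E. Qed.

Definition directional_deriv (K : comNzRingType) m (f : {mpoly K[m]}) (v u : 'I_m -> K) : K :=
  \sum_k (f^`M(k)).@[v] * u k.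

(** Chain rule along a polynomial path g. *)
Lemma directional_deriv_path (K : comNzRingType) m (g : 'I_m -> {poly K}) (f : {mpoly K[m]}) t :
  ((mmap (@polyC K) g f)^`()).[t] = directional_deriv f (fun k => (g k).[t]) (fun k => ((g k)^`()).[t]).
Proof.
pose P f := ((mmap (@polyC K) g f)^`()).[t]
  = directional_deriv f (fun k => (g k).[t]) (fun k => ((g k)^`()).[t]).
have PC a : P a%:MP.
  rewrite /P mmapC derivC horner0 /directional_deriv big1 // => k _.
  by rewrite mderivC meval0 mul0r.
have PX i : P 'X_i.
  rewrite /P mmapX mmap1U /directional_deriv (bigD1 i) //= big1 ?addr0 => [|k ki].
    by rewrite mderivX mnm1E eqxx scale1r submm mpolyX0 meval1 mul1r.
  by rewrite mderivX mnm1E eq_sym (negbTE ki) scale0r meval0 mul0r.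
have PD p q : P p -> P q -> P (p + q).
  rewrite /P rmorphD /= derivD hornerD => -> ->; rewrite /directional_deriv -big_split /=.
  by apply: eq_bigr => k _; rewrite mderivD mevalD mulrDl.
have PM p q : P p -> P q -> P (p * q).
  rewrite /P rmorphM /= derivM hornerD !hornerM => -> ->; rewrite !meval_path.
  rewrite /directional_deriv mulr_suml mulr_sumr -big_split /=; apply: eq_bigr => k _.
  by rewrite mderivM mevalD !mevalM mulrDl mulrAC mulrA.
have Pone : P 1 by rewrite -mpolyC1.
suff : P f by [].
elim/mpolyind: f => [|a mm p _ _ IH]; first by rewrite -mpolyC0.
apply: (PD) => //; rewrite -mul_mpolyC; apply: (PM) => //.
rewrite mpolyXE_id; elim/big_ind: _ => [||k _]; [exact: Pone|exact: PM|].
by elim: (mm k) => [|e IHe]; rewrite ?expr0 // exprS; apply: (PM).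
Qed.

Lemma directional_deriv_linear (K : comNzRingType) m (f : {mpoly K[m]}) v u u' a :
  directional_deriv f v (fun k => a * u k + u' k) = a * directional_deriv f v u + directional_deriv f v u'.
Proof.
rewrite /directional_deriv mulr_sumr -big_split /=; apply: eq_bigr => k _.
by rewrite mulrDr mulrCA.
Qed.

(** Both sides are additive and homogeneous in q, so products of two variables suffice. *)
Lemma quadratic_taylor (K : comNzRingType) m (q : {mpoly K[m]}) w u : q \is 2.-homog ->
  q.@[fun j => w j + u j] = q.@[w] + directional_deriv q w u + q.@[u].
Proof.
move=> /dhomogP hq; rewrite [q]mpolyE /directional_deriv.
pose P q := q.@[fun j => w j + u j] = q.@[w] + directional_deriv q w u + q.@[u].
suff : P (\sum_(mm <- msupp q) q@_mm *: 'X_[mm]) by [].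
rewrite big_seq; elim/big_ind: _ => [|p p' hp hp'|mm /hq hmm].
- by rewrite /P !meval0 /directional_deriv big1 ?addr0 // => k _; rewrite mderiv0 meval0 mul0r.
- rewrite /P !mevalD hp hp' /directional_deriv.
  have -> : \sum_k (p + p')^`M(k).@[w] * u k
     = \sum_k p^`M(k).@[w] * u k + \sum_k p'^`M(k).@[w] * u k.
    by rewrite -big_split; apply: eq_bigr => k _; rewrite mderivD mevalD mulrDl.
  rewrite /directional_deriv; ring.
have PZ a p : P p -> P (a *: p).
  rewrite /P !mevalZ => ->; rewrite /directional_deriv !mulrDr; congr (_ + _ + _).
  by rewrite mulr_sumr; apply: eq_bigr => k _; rewrite mderivZ mevalZ mulrA.
apply: PZ; have [i mi] : exists i, mm i != 0%N.
  apply: contrapT => /forallNP no; have : mdeg mm = 0%N.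
    by rewrite mdegE big1 // => i _; apply/eqP/negPn/negP/no.
  by rewrite hmm.
have le1 : (U_(i) <= mm)%MM by rewrite lep1mP.
have /mdeg1P[j /eqP hj] : mdeg (mm - U_(i))%MM == 1%N.
  by rewrite -(eqn_add2r (mdeg U_(i)%MM)) -mdegD submK // hmm mdeg1.
have -> : mm = (U_(i) + U_(j))%MM by rewrite -hj addmC submK.
rewrite /P mpolyXD !mevalM !mevalXU.
have dX (l k : 'I_m) : (('X_l : {mpoly K[m]})^`M(k)).@[w] = (l == k)%:R.
  rewrite mderivX mnm1E; case: eqP => [->|_]; last by rewrite scale0r meval0.
  by rewrite scale1r submm mpolyX0 meval1.
have -> : directional_deriv ('X_i * 'X_j) w u = u i * w j + w i * u j.
  rewrite /directional_deriv.
  under eq_bigr => k _ do rewrite mderivM mevalD !mevalM !mevalXU !dX mulrDl.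
  rewrite big_split /=; congr (_ + _).
    rewrite (bigD1 i) //= eqxx big1 ?addr0 => [|k /negbTE ki]; first by rewrite mul1r mulrC.
    by rewrite eq_sym ki !mul0r.
  rewrite (bigD1 j) //= eqxx big1 ?addr0 => [|k /negbTE ki]; first by rewrite mulr1.
  by rewrite eq_sym ki mulr0 mul0r.
ring.
Qed.

Lemma span_tupleP (K : fieldType) (V : vectType K) d (B : d.-tuple V) u :
  u \in <<B>>%VS <-> exists k : 'I_d -> K, u = \sum_j k j *: tnth B j.
Proof.
split=> [/coord_span ->|[k ->]].
  by exists (fun j => coord B j u); apply: eq_bigr => j _; rewrite -tnth_nth.
by apply: memv_suml => j _; apply/memvZ/memv_span/mem_tnth.
Qed.

Section TangentSpace.
Variables (K : closedFieldType) (n c : nat) (Q : c.-tuple (dhomog n.+1 K 2)).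
Local Notation m := (1 + n.+1 + c)%N.
Local Notation M := (euler_symmetric Q).
Local Notation quad i := (mpoly_of_dhomog (tnth Q i)).
Implicit Types (f g : {mpoly K[m]}) (p x : proj K m) (w u : 'I_n.+1 -> K).

Definition chart_row w : 'rV[K]_m := \row_k chart_point Q w k.
(** The velocity at w of the chart along the direction u of W. *)
Definition tangent_row w u : 'rV[K]_m := \row_k coords 0 u (fun i => directional_deriv (quad i) w u) k.

Lemma chart_row_z w : chart_row w 0 zvar = 1.
Proof. by rewrite mxE /chart_point coordsE. Qed.

Lemma tangent_row_z w u : tangent_row w u 0 zvar = 0.
Proof. by rewrite mxE coordsE. Qed.

Lemma tangent_row_x w u j : tangent_row w u 0 (xvar j) = u j.
Proof. by rewrite mxE coordsE. Qed.

Lemma tangent_row_sum w r (k : 'I_r -> K) (v : 'I_r -> 'I_n.+1 -> K) :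
  tangent_row w (fun j => \sum_l k l * v l j) = \sum_l k l *: tangent_row w (v l).
Proof.
apply/rowP => s; rewrite summxE mxE; elim/var_ind: s => [|j|i]; rewrite !coordsE.
- by rewrite big1 // => l _; rewrite !mxE coordsE mulr0.
- by apply: eq_bigr => l _; rewrite !mxE coordsE.
- rewrite /directional_deriv; under eq_bigr do rewrite mulr_sumr.
  rewrite exchange_big /=; apply: eq_bigr => l _; rewrite !mxE coordsE /directional_deriv mulr_sumr.
  by apply: eq_bigr => j _; rewrite mulrCA.
Qed.

(** Where z = 1, the equations determine the y_i. *)
Lemma affine_point_chart p : M p -> ~ vanishes_at 'X_zvar p ->
  exists w, val p = <[chart_row w]>%VS.
Proof.
move=> Mp nz; have [v v0 pv] := proj_gen p.
have vz : v 0 zvar != 0.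
  apply: contra_notN nz => /eqP vz; apply/(vanishes_at_homog pv (X_homog _ _)).
  by rewrite mevalXU.
pose a := (v 0 zvar)^-1; have a0 : a != 0 by rewrite invr_eq0.
pose w j := a * v 0 (xvar j); exists w.
have -> : chart_row w = a *: v.
  apply/rowP => k; rewrite !mxE /chart_point; elim/var_ind: k => [|j|i]; rewrite !coordsE //.
    by rewrite mulVf.
  have /(vanishes_atE _ pv)/(_ a) := graph_eq_vanishes i Mp.
  by rewrite meval_graph_eq mulVf // mul1r => /eqP; rewrite subr_eq0 => /eqP <-.
rewrite pv; apply/eqP; rewrite eqEsubv -!memvE memvZ ?memv_line // andbT.
by apply/vlineP; exists a^-1; rewrite scalerA mulVf // scale1r.
Qed.

(** The equations z y_i = q_i(x) bound the tangent cone from above.  From below, it contains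
    the velocities of the polynomial paths on the cone over M that scale a point or move it
    along the chart. *)
Lemma tangent_coneE x w : val x = <[chart_row w]>%VS -> forall u : 'rV[K]_m,
  tangent_cone M x u <-> exists s (u' : 'I_n.+1 -> K), u = s *: chart_row w + tangent_row w u'.
Proof.
move=> xw u; split=> [hu|[s [u' ->]] f hf v].
  exists (u 0 zvar), (fun j => u 0 (xvar j) - u 0 zvar * w j).
  apply/rowP => k; rewrite !mxE /chart_point; elim/var_ind: k => [|j|i]; rewrite !coordsE.
  - by rewrite mulr1 addr0.
  - by rewrite addrC subrK.
  have := hu _ (@graph_eq_vanishes _ _ _ Q i) (chart_row w); rewrite xw memv_line => /(_ isT).
  pose g k : {poly K} := (chart_row w 0 k)%:P + (u 0 k)%:P * 'X.
  have g0 k : (g k).[0] = chart_row w 0 k by rewrite !hornerE.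
  have g1 k : ((g k)^`()).[0] = u 0 k.
    by rewrite /g derivD derivC add0r derivM derivC mul0r add0r derivX mulr1 hornerC.
  have hd (f : {mpoly K[m]}) : \sum_k f^`M(k).@[chart_row w 0] * u 0 k = ((mmap (@polyC K) g f)^`()).[0].
    rewrite directional_deriv_path; apply: eq_bigr => k _; rewrite g1; congr (_ * _).
    by apply: meval_eq => l; rewrite g0.
  rewrite hd /graph_eq rmorphB rmorphM /= !mmapX !mmap1U derivB derivM hornerD hornerN.
  rewrite hornerD !hornerM !g1 !g0 chart_row_z mul1r.
  have -> : mmap (@polyC K) g (to_x c (quad i)) = mmap (@polyC K) (fun j => g (xvar j)) (quad i).
    apply: (mpoly_rmorph_ext (f := mmap (@polyC K) g \o @to_x K n c)
      (g := mmap (@polyC K) (fun j => g (xvar j)))) => [a|j] /=.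
      by rewrite /to_x msubstC !mmapC.
    by rewrite /to_x msubstX !mmapX !mmap1U.
  rewrite directional_deriv_path => h.
  have e1 : directional_deriv (quad i) (fun k => (g (xvar k)).[0]) (fun k => ((g (xvar k))^`()).[0])
     = directional_deriv (quad i) w (fun j => u 0 (xvar j)).
    apply: eq_bigr => j _; rewrite g1; congr (_ * _).
    by apply: meval_eq => l; rewrite g0 mxE /chart_point coordsE.
  (* Euler's relation, from q(2 w) = 4 q(w). *)
  have e2 : directional_deriv (quad i) w w = 2%:R * (quad i).@[w].
    have := quadratic_taylor w w (quad_homog Q i).
    have -> : (quad i).@[fun j => w j + w j] = 2%:R ^+ 2 * (quad i).@[w].
      rewrite -(meval_homog _ _ (quad_homog Q i)); apply: meval_eq => j.
      by rewrite mulr_natl mulr2n.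
    move=> e; have -> : directional_deriv (quad i) w w = (2%:R ^+ 2) * (quad i).@[w] - 2%:R * (quad i).@[w].
      by rewrite e; ring.
    by ring.
  have -> : directional_deriv (quad i) w (fun j => u 0 (xvar j) - u 0 zvar * w j)
     = - u 0 zvar * directional_deriv (quad i) w w + directional_deriv (quad i) w (fun j => u 0 (xvar j)).
    rewrite -directional_deriv_linear; apply: eq_bigr => j _; congr (_ * _).
    by rewrite addrC mulNr.
  move: h; rewrite e1 e2 [chart_row w 0 _]mxE /chart_point coordsE => h.
  have -> : u 0 (yvar i) = directional_deriv (quad i) w (fun j => u 0 (xvar j)) - u 0 zvar * (quad i).@[w].
    apply/eqP; rewrite -subr_eq0 -[X in _ == X]h; apply/eqP; ring.
  ring.
rewrite xw => /vlineP[a ->].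
pose der (y : 'rV[K]_m) := \sum_k f^`M(k).@[(a *: chart_row w) 0] * y 0 k.
have -> : \sum_k f^`M(k).@[(a *: chart_row w) 0] * (s *: chart_row w + tangent_row w u') 0 k
    = s * der (chart_row w) + der (tangent_row w u').
  rewrite /der mulr_sumr -big_split /=; apply: eq_bigr => k _.
  by rewrite !mxE mulrDr mulrCA.
have hf' := (vanishing_euler Q f).1 hf.
have path0 (g : 'I_m -> {poly K}) : (forall t, f.@[fun k => (g k).[t]] = 0) ->
    directional_deriv f (fun k => (g k).[0]) (fun k => ((g k)^`()).[0]) = 0.
  move=> h; rewrite -directional_deriv_path.
  have -> : mmap (@polyC K) g f = 0 by apply: poly_eq0_eval => t _; rewrite meval_path.
  by rewrite deriv0 horner0.
have radial : der (chart_row w) = 0.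
  pose g k : {poly K} := (chart_point Q w k) *: (a%:P + 'X).
  have := path0 g _ => <-; last first.
    move=> t; rewrite -[RHS](hf' (a + t) w); apply: meval_eq => k.
    by rewrite /g hornerZ hornerD hornerC hornerX mulrC.
  apply: eq_bigr => k _; congr (_ * _).
    by apply: meval_eq => l; rewrite !mxE /g hornerZ hornerD hornerC hornerX addr0 mulrC.
  by rewrite mxE /g derivZ derivD derivC add0r derivX hornerZ hornerC mulr1.
(* The factor b excludes the vertex of the cone, which is reached by continuity below. *)
have along b : b * \sum_k f^`M(k).@[(b *: chart_row w) 0] * (tangent_row w u') 0 k = 0.
  pose lx j : {poly K} := (w j)%:P + (u' j)%:P * 'X.
  have lxE t j : (lx j).[t] = w j + u' j * t by rewrite !hornerE.
  pose g k : {poly K} := b *: coords 1 lx (fun i => mmap (@polyC K) lx (quad i)) k.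
  have gE t k : (g k).[t] = b * chart_point Q (fun j => w j + u' j * t) k.
    rewrite /g hornerZ /chart_point; congr (_ * _).
    elim/var_ind: k => [|j|i]; rewrite !coordsE ?hornerC ?lxE // meval_path.
    by apply: meval_eq => j; rewrite lxE.
  have lx' j : ((lx j)^`()).[0] = u' j.
    by rewrite /lx derivD derivC add0r derivM derivC mul0r add0r derivX mulr1 hornerC.
  have g'E k : ((g k)^`()).[0] = b * tangent_row w u' 0 k.
    rewrite /g derivZ hornerZ mxE; congr (_ * _).
    elim/var_ind: k => [|j|i]; rewrite !coordsE ?derivC ?horner0 ?lx' // directional_deriv_path.
    apply: eq_bigr => j _; rewrite lx'; congr (_ * _).
    by apply: meval_eq => l; rewrite lxE mulr0 addr0.
  have := path0 g _ => h; rewrite -[RHS]h; last first.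
    by move=> t; rewrite -[RHS](hf' b (fun j => w j + u' j * t)); apply: meval_eq => k; rewrite gE.
  rewrite mulr_sumr; apply: eq_bigr => k _; rewrite g'E mulrCA; congr (_ * _).
  apply: meval_eq => l; rewrite gE !mxE /chart_point; congr (_ * coords _ _ _ _).
    by apply: funext => j; rewrite mulr0 addr0.
  by apply: funext => i; apply: meval_eq => j; rewrite mulr0 addr0.
rewrite radial mulr0 add0r.
pose F : {poly K} := \sum_k mmap (@polyC K) (fun l => chart_point Q w l *: 'X) f^`M(k) * ((tangent_row w u') 0 k)%:P.
have FE b : F.[b] = \sum_k f^`M(k).@[(b *: chart_row w) 0] * (tangent_row w u') 0 k.
  rewrite horner_sum; apply: eq_bigr => k _; rewrite hornerM hornerC meval_path; congr (_ * _).
  by apply: meval_eq => l; rewrite hornerZ hornerX !mxE mulrC.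
have F0 : F = 0.
  apply: poly_eq0_eval => b b0; apply: (mulfI b0); rewrite FE along mulr0 //.
by rewrite /der -FE F0 horner0.
Qed.

End TangentSpace.

(** * Lines through a point of the chart *)

Lemma vline_scale (K : fieldType) (V : vectType K) a (v : V) : a != 0 ->
  (<[a *: v]> = <[v]>)%VS.
Proof.
move=> a0; apply/eqP; rewrite eqEsubv -!memvE memvZ ?memv_line //=.
by apply/vlineP; exists a^-1; rewrite scalerA mulVf // scale1r.
Qed.

Section Lines.
Variables (K : closedFieldType) (n c : nat) (Q : c.-tuple (dhomog n.+1 K 2)).
Local Notation m := (1 + n.+1 + c)%N.
Local Notation M := (euler_symmetric Q).
Local Notation quad i := (mpoly_of_dhomog (tnth Q i)).
Local Notation chart w := (chart_row Q w).
Local Notation tgt w u := (tangent_row Q w u).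
Implicit Types (p x : proj K m) (w u : 'I_n.+1 -> K).

Definition standard_basis w : n.+1.-tuple 'rV[K]_m :=
  [tuple tgt w (fun j => (j == l)%:R) | l < n.+1].

Lemma standard_basis_sum w (k : 'I_n.+1 -> K) :
  \sum_l k l *: tnth (standard_basis w) l = tgt w k.
Proof.
under eq_bigr do rewrite tnth_mktuple.
rewrite -tangent_row_sum; congr (tangent_row _ _ _); apply: funext => j.
rewrite (bigD1 j) //= eqxx mulr1 big1 ?addr0 // => l lj.
by rewrite eq_sym (negbTE lj) mulr0.
Qed.

Lemma tangent_row_scale w a u : tgt w (fun j => a * u j) = a *: tgt w u.
Proof.
apply/rowP => k; rewrite !mxE; elim/var_ind: k => [|j|i]; rewrite !coordsE ?mulr0 //.
by rewrite /directional_deriv mulr_sumr; apply: eq_bigr => j _; rewrite mulrCA.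
Qed.

Lemma tangent_row_eq0 w u : tgt w u = 0 -> u = fun=> 0.
Proof.
by move=> h; apply: funext => j; rewrite -(tangent_row_x Q w u j) h mxE.
Qed.

Lemma standard_tangent_basis x w : val x = <[chart w]>%VS ->
  tangent_basis M x (standard_basis w).
Proof.
move=> xw; split.
- apply/freeP => k hk i; have h : tgt w k = 0.
    by rewrite -standard_basis_sum -[RHS]hk; apply: eq_bigr => l _; rewrite -tnth_nth.
  by rewrite (tangent_row_eq0 h).
- apply/eqP; rewrite -subv0; apply/subvP => v; rewrite memv_cap xw => /andP[/vlineP[a ->]].
  case/span_tupleP => k; rewrite standard_basis_sum => /rowP/(_ zvar).
  by rewrite mxE chart_row_z tangent_row_z mulr1 => ->; rewrite scale0r mem0v.
move=> u; rewrite (tangent_coneE xw); split=> [[s [u' ->]]|/memv_addP[v]].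
  rewrite xw; apply: memv_add; first by rewrite memvZ ?memv_line.
  by apply/span_tupleP; exists u'; rewrite standard_basis_sum.
rewrite xw => /vlineP[s ->] [v' /span_tupleP[k ->] ->].
by exists s, k; rewrite standard_basis_sum.
Qed.

(** Both bases span a complement of x in the cone over the tangent space. *)
Lemma tangent_basis_dim x w d (B : d.-tuple 'rV[K]_m) : val x = <[chart w]>%VS ->
  tangent_basis M x B -> d = n.+1.
Proof.
move=> xw [fB cap hB]; have [fB0 cap0 hB0] := standard_tangent_basis xw.
have e : (val x + <<B>> = val x + <<standard_basis w>>)%VS.
  by apply/vspaceP => u; apply/idP/idP => /[dup] _; [move/hB/hB0 | move/hB0/hB].
have := congr1 (fun V => \dim V) e; rewrite !dimv_disjoint_sum // => /addnI.
by move: fB fB0; rewrite /free !size_tuple => /eqP -> /eqP ->.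
Qed.

(** The point at infinity of the line t |-> chart(w + t u), which lies on M when all
    q_i(u) = 0. *)
Lemma tangent_row_in_euler w u p : (forall i, (quad i).@[u] = 0) -> val p = <[tgt w u]>%VS -> M p.
Proof.
move=> hu pv; apply: (zclosedP (euler_closed Q)) => f /vanishing_euler hf.
apply/(vanishes_atE _ pv) => a.
pose F : {poly K} := mmap (@polyC K) (fun k => (chart w 0 k) *: 'X + (a * tgt w u 0 k)%:P) f.
have FE t : F.[t] = f.@[fun k => t * chart w 0 k + a * tgt w u 0 k].
  by rewrite meval_path; apply: meval_eq => k; rewrite !hornerE mulrC.
have F0 : F = 0.
  apply: poly_eq0_eval => t t0; rewrite FE -[RHS](hf t (fun j => w j + a / t * u j)).
  apply: meval_eq => k; rewrite !mxE /chart_point; elim/var_ind: k => [|j|i]; rewrite !coordsE.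
  - by rewrite mulr0 addr0.
  - by rewrite mulrDr !mulrA [t * a]mulrC mulfK.
  - rewrite (quadratic_taylor _ _ (quad_homog Q i)) (meval_homog _ _ (quad_homog Q i)) hu.
    rewrite mulr0 addr0 mulrDr; congr (_ + _); rewrite /directional_deriv !mulr_sumr.
    by apply: eq_bigr => j _; field.
have := FE 0; rewrite F0 horner0 => h; rewrite [RHS]h; apply: meval_eq => k.
by rewrite mul0r add0r.
Qed.

(** In the coordinates of B, let A be the matrix sending a tangent direction to its
    component u in W.  By Taylor's formula, chart(w) + velocity(u) satisfies the equations
    z y_i = q_i(x) iff q_i(u) = 0 for all i.  So a line through x in the direction u lies on
    M iff u is in the base locus. *)
Lemma lines_through_zeros x w (B : n.+1.-tuple 'rV[K]_m) : val x = <[chart w]>%VS ->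
    tangent_basis M x B ->
  exists2 A : 'M[K]_n.+1, A \in unitmx &
    forall p : proj K n.+1, lines_through M x B p <-> zeros [seq lin_subst A q | q <- quads Q] p.
Proof.
move=> xw [fB cap hB].
have hBj j : exists su : K * ('I_n.+1 -> K), tnth B j = su.1 *: chart w + tgt w su.2.
  have /hB/(tangent_coneE xw)[s [u e]] : tnth B j \in (val x + <<B>>)%VS.
    by apply: (subvP (addvSr _ _)); apply/memv_span/mem_tnth.
  by exists (s, u).
have [su hsu] := choice hBj.
pose A := \matrix_(i < n.+1, j < n.+1) (su j).2 i.
have sumE (a : 'I_n.+1 -> K) : \sum_j a j *: tnth B j =
    (\sum_j a j * (su j).1) *: chart w + tgt w (fun i => \sum_j A i j * a j).
  transitivity ((\sum_j a j * (su j).1) *: chart w + tgt w (fun i => \sum_j a j * (su j).2 i)).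
    rewrite tangent_row_sum scaler_suml -big_split /=; apply: eq_bigr => j _.
    by rewrite hsu scalerDr scalerA.
  congr (_ + tangent_row _ _ _); apply: funext => i.
  by apply: eq_bigr => j _; rewrite mxE mulrC.
have kerA (a : 'I_n.+1 -> K) : (forall i, \sum_j A i j * a j = 0) -> forall j, a j = 0.
  move=> h; have h0 : (fun i => \sum_j A i j * a j) = fun=> 0 by apply: funext.
  have t0 : tgt w (fun=> 0) = 0.
    apply/rowP => k; rewrite !mxE; elim/var_ind: k => [|j|i]; rewrite ?coordsE //.
    by rewrite /directional_deriv big1 // => j _; rewrite mulr0.
  have e := sumE a; rewrite h0 t0 addr0 in e.
  have : \sum_j a j *: tnth B j \in (val x :&: <<B>>)%VS.
    rewrite memv_cap {1}e xw memvZ ?memv_line //=; apply/span_tupleP; by exists a.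
  rewrite cap memv0 => /eqP s0; apply: (freeP fB); rewrite -[RHS]s0.
  by apply: eq_bigr => j _; rewrite -tnth_nth.
have uA : A \in unitmx.
  rewrite -unitmx_tr -row_free_unit -kermx_eq0; apply/rowV0P => v /sub_kermxP hv.
  apply/rowP => j; rewrite [RHS]mxE; move: j; apply: kerA => i.
  move/rowP/(_ i): hv; rewrite !mxE => h; rewrite -[RHS]h.
  by apply: eq_bigr => j _; rewrite [in RHS]mxE mulrC.
exists A => // p; have [v v0 pv] := proj_gen p.
pose u i := \sum_j A i j * v 0 j.
have zE : zeros [seq lin_subst A q | q <- quads Q] p <-> forall i, (quad i).@[u] = 0.
  have ev i : vanishes_at (lin_subst A (quad i)) p <-> (quad i).@[u] = 0.
    have hl : lin_subst A (quad i) \is 2.-homog.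
      exact/lin_subst_homog/quad_homog.
    by rewrite (vanishes_at_homog pv hl) meval_lin_subst.
  split=> [h i|h f /mapP[q /quadsP[i ->] ->]]; last exact/ev.
  by apply/ev; apply: h; apply: map_f; apply: quad_mem.
have uN0 : tgt w u <> 0.
  move/tangent_row_eq0 => hu; case/eqP: v0; apply/rowP => j; rewrite mxE; move: j.
  by apply: kerA => i; rewrite -/(u i) hu.
have xl l : (val x <= l)%VS -> chart w \in l by rewrite xw memvE.
rewrite zE; split=> [[l [dl xsl lM hl]] i|hu].
  have ul : tgt w u \in l.
    have := hl v; rewrite pv memv_line => /(_ isT); rewrite sumE -/u => h.
    set S := (X in X *: _) in h.
    have -> : tgt w u = (S *: chart w + tgt w u) - S *: chart w by rewrite addrAC subrr add0r.
    by apply: memvB => //; apply/memvZ/xl.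
  (* The point of the line at parameter 1 is enough for the necessity. *)
  have wN0 : chart w + tgt w u != 0.
    apply/eqP => /rowP/(_ zvar); rewrite mxE chart_row_z tangent_row_z addr0 mxE => /eqP.
    by rewrite oner_eq0.
  have [y yv] := proj_of wN0.
  have My : M y by apply: lM; rewrite yv -memvE memvD // xl.
  have /(vanishes_atE _ yv)/(_ 1) := graph_eq_vanishes i My.
  rewrite meval_graph_eq !mul1r !mxE /chart_point !coordsE addr0 mul1r.
  have -> : (quad i).@[fun j => 1 * (chart w + tgt w u) 0 (xvar j)]
     = (quad i).@[w] + directional_deriv (quad i) w u + (quad i).@[u].
    rewrite -(quadratic_taylor _ _ (quad_homog Q i)); apply: meval_eq => j.
    by rewrite mul1r !mxE /chart_point !coordsE.
  by rewrite opprD addrA subrr sub0r => /eqP; rewrite oppr_eq0 => /eqP.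
exists (<[chart w]> + <[tgt w u]>)%VS; split.
- rewrite dimv_disjoint_sum ?dim_vline; last first.
    apply/eqP; rewrite -subv0; apply/subvP => y; rewrite memv_cap => /andP[/vlineP[a ->]].
    case/vlineP => b /rowP/(_ zvar); rewrite !mxE /chart_point !coordsE mulr1 mulr0 => ->.
    by rewrite scale0r mem0v.
  have -> : chart w != 0 by apply: chart_point_neq0.
  by have -> : tgt w u != 0 by apply/eqP.
- by rewrite xw addvSl.
- move=> y; have [v' v'0 yv] := proj_gen y; rewrite yv -memvE => /memv_addP[_ /vlineP[a ->]].
  case=> _ /vlineP[b ->] v'E; have [a0|a0] := eqVneq a 0.
    apply: (tangent_row_in_euler (w := w) (u := fun j => b * u j)).
      by move=> i; rewrite (meval_homog _ _ (quad_homog Q i)) hu mulr0.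
    by rewrite yv v'E a0 scale0r add0r tangent_row_scale.
  apply: chart_in_euler; exists (fun j => w j + b / a * u j).
  rewrite yv v'E -[RHS](vline_scale _ a0); congr (<[_]>%VS).
  apply/rowP => k; rewrite !mxE /chart_point; elim/var_ind: k => [|j|i]; rewrite !coordsE.
  + by rewrite mulr0 addr0.
  + by field.
  + rewrite (quadratic_taylor _ _ (quad_homog Q i)) (meval_homog _ _ (quad_homog Q i)) hu.
    rewrite mulr0 addr0 mulrDr; congr (_ + _); rewrite /directional_deriv !mulr_sumr.
    by apply: eq_bigr => j _; field.
move=> a'; rewrite pv => /vlineP[t ->].
have -> : \sum_i (t *: v) 0 i *: tnth B i = t *: \sum_j v 0 j *: tnth B j.
  by rewrite scaler_sumr; apply: eq_bigr => j _; rewrite mxE scalerA.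
apply: memvZ; rewrite sumE; apply: memv_add; last exact: memv_line.
by apply/memvZ/memv_line.
Qed.

End Lines.

(** * The four equivalent conditions *)

Section Equivalences.
Variables (K : closedFieldType) (n c : nat) (Q : c.-tuple (dhomog n.+1 K 2)).
Local Notation m := (1 + n.+1 + c)%N.
Local Notation M := (euler_symmetric Q).

Lemma base_locus_zeros : base_locus Q = zeros (quads Q).
Proof.
apply: funext => p; apply: propext; split=> [h f /quadsP[i ->]|h i]; first exact: h.
by apply: h; apply: quad_mem.
Qed.

Lemma base_locus_ci_regular : set_theoretic_ci c (base_locus Q) <-> regular_seq (quads Q).
Proof.
rewrite base_locus_zeros -set_theoretic_ci_regular ?size_quads //.
exact: quads_form.
Qed.

Lemma lines_ci_regular x w (B : n.+1.-tuple 'rV[K]_m) : val x = <[chart_row Q w]>%VS ->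
    tangent_basis M x B ->
  set_theoretic_ci c (lines_through M x B) <-> regular_seq (quads Q).
Proof.
move=> xw tB; have [A uA hA] := lines_through_zeros xw tB.
have -> : lines_through M x B = zeros [seq lin_subst A q | q <- quads Q].
  by apply: funext => p; apply: propext.
have hf f : f \in [seq lin_subst A q | q <- quads Q] -> form f.
  case/mapP => q /quadsP[i ->] ->; exists 2%N => //.
  exact/lin_subst_homog/quad_homog.
have := set_theoretic_ci_regular hf; rewrite size_map size_quads => ->.
split; last exact: regular_lin_subst.
apply: (regular_retract (f := lin_subst A) (g := lin_subst (invmx A))) => f /=.
by rewrite lin_subst_comp mulmxV // lin_subst1.
Qed.

(** The condition is tested on the chart, a dense open subset: a general point can be
    chosen there, and at each of its points the variety of lines is the base locus up to a
    change of coordinates. *)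
Lemma general_lines_ci_regular :
  for_general_point M (fun x => smooth_at M x /\
    forall d (B : d.-tuple 'rV[K]_m), tangent_basis M x B ->
      set_theoretic_ci c (lines_through M x B)) <-> regular_seq (quads Q).
Proof.
split=> [[Y [cY dense hY]]|rQ].
  have [x [w xw] nYx] : exists2 x, on_chart Q x & ~ Y x.
    apply: contrapT => no; have MY : zsubset M Y.
      apply: euler_min => // x cx; apply: contrapT => nYx; apply: no.
      by exists x.
    have [_ [p Mp] _] := euler_irreducible Q.
    have := dense p Mp _ (zclosed_vanishes 1) => h.
    apply: (prime_proper (vanishes_at_prime p)); apply: h.
    by move=> q [/MY Yq].
  have [_ h] := hY x (chart_in_euler (ex_intro _ w xw)) nYx.
  apply/(lines_ci_regular xw (standard_tangent_basis xw)); apply: h.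
  exact: standard_tangent_basis.
exists (vanishes_at 'X_zvar); split; first exact: zclosed_vanishes.
  move=> p Mp Y' cY' sub; apply: (euler_min cY') Mp => q cq.
  apply: sub; split; first exact: chart_in_euler.
  have [w qw] := cq; move/(vanishes_at_homog qw (X_homog _ _)).
  by rewrite mevalXU mxE /chart_point coordsE => /eqP; rewrite oner_eq0.
move=> x Mx nx; have [w xw] := affine_point_chart Mx nx; split.
  exists n.+1; split; first exact: euler_zdim.
  by exists (standard_basis Q w); apply: standard_tangent_basis.
move=> d B tB; have ed := tangent_basis_dim xw tB.
by subst d; apply/(lines_ci_regular xw tB).
Qed.

End Equivalences.

Theorem theorem1p3 (R : realType) (n c : nat)
    (F : graded_subspace R[i] n) (Q : c.-tuple (dhomog n.+1 R[i] 2))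
    (hF : symbol_system2 F) (hQ : <<Q>>%VS = F 2%N) (hc : \dim (F 2%N) = c) :
  [<-> complete_intersection c (euler_symmetric Q);
       set_theoretic_ci c (base_locus Q);
       for_general_point (euler_symmetric Q) (fun x =>
         smooth_at (euler_symmetric Q) x /\
         forall d (B : d.-tuple 'rV[R[i]]_(1 + n.+1 + c)),
           tangent_basis (euler_symmetric Q) x B ->
           set_theoretic_ci c (lines_through (euler_symmetric Q) x B));
       regular_seq [seq mpoly_of_dhomog q | q <- Q] ].
Proof.
have fQ : free Q by rewrite /free hQ hc size_tuple.
tfae.
- by move/(complete_intersection_regular fQ)/base_locus_ci_regular.
- by move/base_locus_ci_regular/general_lines_ci_regular.
- by move/general_lines_ci_regular.
- exact: regular_complete_intersection.
Qed.
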